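(* Let $r\in\mathbb{R}$ and $\delta=(c_{00},c_{10},c_{01},c_{02},c_{11},c_{20})\in\mathbb{R}^6$, and consider the near-Hamiltonian system $$\dot u=H_v(u,v)+\varepsilon p(u,v,\delta),\qquad \dot v=-H_u(u,v)+\varepsilon q(u,v,\delta),$$ where $$H(u,v)=\tfrac12(u^2+v^2)-\tfrac12u^3+v^3+\tfrac18u^4-uv^3+rv^4,$$ and $p,q$ are polynomials of degree at most $3$ in $(u,v)$, depending linearly on $\delta$, with $$p_u+q_v=c_{00}+c_{10}u+c_{01}v+c_{20}u^2+c_{11}uv+c_{02}v^2 .$$ Let $\sigma=(r)$, and let $\delta_0=(c_{00}^*,c_{10}^*,c_{01}^*,c_{02}^*,c_{11}^*,c_{20}^* )$, $\sigma_0=(r^* )$ satisfy $$f(r^* )=0,\quad c_{00}^*=0,\quad c_{02}^*=-\tfrac32c_{10}^*+3c_{01}^*-c_{20}^*,\quad c_{01}^*\neq0,$$ $$c_{11}^*=\big(12r^*-\tfrac{191}{4}\big)c_{10}^*+(40r^*+3)c_{01}^*+\big(8r^*-\tfrac{47}{2}\big)c_{20}^*,$$ $$c_{10}^*=\frac{2}{17680r^*-43347}\Big[\big(1792(r^* )^2-17328r^*-696\big)c_{01}^*+\big(11107-5680r^*\big)c_{20}^*\Big],$$ $$c_{20}^*=\frac{6544683+11682846r^*+30378720(r^* )^2-40278528(r^* )^3-21471232(r^* )^4}{2\big(2770317-11417834r^*+11442688(r^* )^2+442880(r^* )^3\big)}\,c_{01}^*,$$ where $$f(r)=780900831-459924741r-2093583104r^2-1597844992r^3-108363776r^4+1381957632r^5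 .$$ Then for some $(\varepsilon,\delta,\sigma)$ near $(0,\delta_0,\sigma_0)$ (with $\varepsilon\neq0$) the system has $6$ limit cycles near the origin.
   Context: ''For some $(\varepsilon,\delta,\sigma)$ near $(0,\delta_0,\sigma_0)$ the system has $N$ limit cycles near the origin'' means: for every neighborhood $V$ of the origin and every $\eta>0$ there exist $\varepsilon,\delta,\sigma$ with $0<|\varepsilon|<\eta$, $|\delta-\delta_0|<\eta$, $|\sigma-\sigma_0|<\eta$ for which the system has $N$ limit cycles in $V$. *)

(* Defs.v *)
From Stdlib Require Import Reals.
From Coquelicot Require Import Coquelicot.
Open Scope R_scope.

Definition H (r u v : R) : R :=
  /2 * (u^2 + v^2) - /2 * u^3 + v^3 + /8 * u^4 - u * v^3 + r * v^4.

Definition H_u (r u v : R) : R := Derive (fun s => H r s v) u.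
Definition H_v (r u v : R) : R := Derive (fun s => H r u s) v.

(* Parameter vectors delta are encoded as d : nat -> R, with
   d 0 = c00, d 1 = c10, d 2 = c01, d 3 = c02, d 4 = c11, d 5 = c20
   (only indices 0..5 are relevant). *)

Definition cubic_linear_in_delta (p : R -> R -> (nat -> R) -> R) : Prop :=
  exists c : nat -> nat -> nat -> R,
    forall u v (d : nat -> R),
      p u v d =
      sum_f_R0 (fun k =>
        sum_f_R0 (fun i =>
          sum_f_R0 (fun j => d k * c k i j * u ^ i * v ^ j) (3 - i)) 3) 5.

Definition is_solution (F1 F2 : R -> R -> R) (x y : R -> R) : Prop :=
  forall t, is_derive x t (F1 (x t) (y t)) /\ is_derive y t (F2 (x t) (y t)).

Definition periodic_orbit (F1 F2 : R -> R -> R) (G : R -> R -> Prop) : Prop :=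
  exists (x y : R -> R) (T : R),
    is_solution F1 F2 x y /\ 0 < T /\
    (forall t, x (t + T) = x t /\ y (t + T) = y t) /\
    (exists t1 t2, (x t1, y t1) <> (x t2, y t2)) /\
    (forall a b, G a b <-> exists t, a = x t /\ b = y t).

Definition same_set (G G' : R -> R -> Prop) : Prop :=
  forall a b, G a b <-> G' a b.

Definition limit_cycle (F1 F2 : R -> R -> R) (G : R -> R -> Prop) : Prop :=
  periodic_orbit F1 F2 G /\
  exists e, 0 < e /\
    forall G', periodic_orbit F1 F2 G' ->
      (exists a b a' b', G a b /\ G' a' b' /\ (a - a')^2 + (b - b')^2 < e^2) ->
      same_set G G'.

Definition has_limit_cycles_in (N : nat) (F1 F2 : R -> R -> R) (rho : R) : Prop :=
  exists L : nat -> (R -> R -> Prop),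
    (forall i, (i < N)%nat ->
       limit_cycle F1 F2 (L i) /\ (forall a b, L i a b -> a^2 + b^2 < rho^2)) /\
    (forall i j, (i < j < N)%nat -> ~ same_set (L i) (L j)).

Definition sysF1 (p : R -> R -> (nat -> R) -> R) (eps : R) (d : nat -> R) (r : R)
  (u v : R) : R := H_v r u v + eps * p u v d.
Definition sysF2 (q : R -> R -> (nat -> R) -> R) (eps : R) (d : nat -> R) (r : R)
  (u v : R) : R := - H_u r u v + eps * q u v d.

Definition f_poly (r : R) : R :=
  780900831 - 459924741 * r - 2093583104 * r^2 - 1597844992 * r^3
  - 108363776 * r^4 + 1381957632 * r^5.

(* Main.v *)
(* Put u = mu a, v = mu b, eps = mu^15 with mu small. Since the quadratic part of H generates a
   rotation, the homological equation {G, H} = m(H) - (H_u p + H_v q) has a polynomial solution G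
   up to terms of degree 15, with m(h) = m_1 h + ... + m_7 h^7, so that W = H + eps G satisfies
   dW/dt = eps (m(H) + O(mu^15)) along the flow. Each m_j is linear in delta with coefficients
   polynomial in r. At (delta_0, sigma_0) the coefficients m_1, ..., m_6 vanish and m_7 = kappa is
   not zero, while m_1, ..., m_6 can be varied independently because f has a simple root at r*.
   Moving (delta, r) one makes m(mu^2 x) = mu^14 (kappa x (x-1) ... (x-6) + o(1)), hence W / mu^2
   moves monotonically across the levels i +- 1/32 (i = 1, ..., 6), always inwards or always
   outwards. Each annulus between two such levels contains a periodic orbit, a fixed point of the
   return map of the scalar equation d rho / d theta; two periodic orbits in it coincide because
   dW/dtheta is strictly monotone in rho there, so that the difference of the two values of W at
   equal angle, which is periodic, would be strictly monotone in time. *)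
Require Import Defs.
From Stdlib Require Import Reals ZArith QArith Qreals List Lra Lia Psatz.
From Stdlib Require Import IndefiniteDescription.
From Coquelicot Require Import Coquelicot.
Import ListNotations.
Open Scope R_scope.

(** * Scalar differential equations *)

(** Along the unperturbed flow [{G, H}] is the time derivative of [G], so its integral over a closed
    level curve vanishes; hence [m(h)] is, up to truncation, the first-order Melnikov integral
    divided by the period, and working with [m] replaces integrals by polynomial algebra. The
    exponent 15 balances the errors: the main part of [dW/dt] has size [eps mu^14 = mu^29], while
    the truncation [eps mu^15] and the second-order terms [eps^2] both have size [mu^30]. At first
    order [p] and [q] matter only through their divergence: two fields with the same divergence
    differ by a Hamiltonian field, whose Hamiltonian is absorbed into [G], so six model fields
    suffice. With [c01] kept as a fixed scale, the five other entries of [delta] prescribe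
    [m_1, ..., m_5] exactly, and [r] moves [m_6] at order [mu^2]; [m_6] and [m_7] need only be right
    to leading order. A limit cycle must be isolated among all periodic orbits of the plane, so
    uniqueness is proved for every periodic orbit that meets the annulus, by monotonicity and
    without differentiating a return map. *)

Lemma is_derive_Rplus (f g : R -> R) (x df dg : R) :
  is_derive f x df -> is_derive g x dg -> is_derive (fun t => f t + g t) x (df + dg).
Proof. intros A B. exact (is_derive_plus f g x df dg A B). Qed.

Lemma is_derive_Rminus (f g : R -> R) (x df dg : R) :
  is_derive f x df -> is_derive g x dg -> is_derive (fun t => f t - g t) x (df - dg).
Proof. intros A B. exact (is_derive_minus f g x df dg A B). Qed.

Lemma is_derive_Ropp (f : R -> R) (x df : R) :
  is_derive f x df -> is_derive (fun t => - f t) x (- df).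
Proof. intros A. exact (is_derive_opp f x df A). Qed.

Lemma is_derive_Rmult (f g : R -> R) (x df dg : R) :
  is_derive f x df -> is_derive g x dg ->
  is_derive (fun t => f t * g t) x (df * g x + f x * dg).
Proof. intros A B. exact (is_derive_mult f g x df dg A B Rmult_comm). Qed.

Lemma is_derive_Rcomp (f g : R -> R) (x df dg : R) :
  is_derive f (g x) df -> is_derive g x dg ->
  is_derive (fun t => f (g t)) x (df * dg).
Proof.
  intros A B. rewrite Rmult_comm. exact (is_derive_comp f g x df dg A B).
Qed.

Lemma is_derive_val (f : R -> R) (x l l' : R) :
  is_derive f x l -> l = l' -> is_derive f x l'.
Proof. now intros H <-. Qed.

Lemma is_derive_continuous (f : R -> R) (x l : R) :
  is_derive f x l -> continuous f x.
Proof. intros H. apply (ex_derive_continuous f x). now exists l. Qed.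

Lemma nondecreasing_of_derive (f f' : R -> R) (a b : R) :
  a <= b -> (forall t, a <= t <= b -> is_derive f t (f' t)) ->
  (forall t, a <= t <= b -> 0 <= f' t) -> f a <= f b.
Proof.
  intros Hab Hd Hp.
  destruct (MVT_gen f a b f') as [c [Hc E]].
  - rewrite Rmin_left, Rmax_right by lra. intros x Hx. apply Hd; lra.
  - rewrite Rmin_left, Rmax_right by lra. intros x Hx.
    apply continuity_pt_filterlim. apply (ex_derive_continuous f x).
    exists (f' x). apply Hd; lra.
  - rewrite Rmin_left, Rmax_right in Hc by lra.
    assert (0 <= f' c * (b - a)) by (apply Rmult_le_pos; [apply Hp; lra | lra]). lra.
Qed.

(** Integration preserves the weight [exp (lam |t|)] and gains a factor [1 / lam], which makes
    Picard iteration contract on the whole line at once. Both signs of [phi] and of [t] reduce to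
    one comparison with [K exp (lam t)]. *)
Lemma growth_bound (phi phi' : R -> R) (K lam : R) :
  0 < lam -> phi 0 = 0 -> (forall t, is_derive phi t (phi' t)) ->
  (forall t, Rabs (phi' t) <= K * lam * exp (lam * Rabs t)) ->
  forall t, Rabs (phi t) <= K * exp (lam * Rabs t).
Proof.
  assert (pos : forall (phi phi' : R -> R),
    0 < lam -> phi 0 = 0 -> (forall t, is_derive phi t (phi' t)) ->
    (forall t, Rabs (phi' t) <= K * lam * exp (lam * Rabs t)) ->
    forall t, 0 <= t -> phi t <= K * exp (lam * t)).
  { clear phi phi'. intros phi phi' Hl H0 Hd Hb t Ht.
    assert (HK : 0 <= K).
    { specialize (Hb 0). rewrite Rabs_R0, Rmult_0_r, exp_0 in Hb.
      pose proof (Rabs_pos (phi' 0)). nra. }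
    assert (K * exp (lam * 0) - phi 0 <= K * exp (lam * t) - phi t).
    { apply (nondecreasing_of_derive (fun s => K * exp (lam * s) - phi s)
               (fun s => K * (lam * exp (lam * s)) - phi' s)); [lra | |].
      - intros s _. apply is_derive_Rminus; [| apply Hd].
        auto_derive; [easy | ring].
      - intros s Hs. specialize (Hb s). rewrite (Rabs_right s) in Hb by lra.
        pose proof (Rle_abs (phi' s)). lra. }
    rewrite Rmult_0_r, exp_0 in H. lra. }
  intros Hl H0 Hd Hb t.
  apply Rabs_le.
  assert (Hneg : forall t, is_derive (fun s => - phi s) t (- phi' t)).
  { intros s. apply is_derive_Ropp. apply Hd. }
  assert (Hrev : forall t, is_derive (fun s => phi (- s)) t (- phi' (- t))).
  { intros s. eapply is_derive_val.
    - apply (is_derive_Rcomp phi Ropp); [apply Hd |].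
      apply (is_derive_Ropp (fun t => t)). apply @is_derive_id.
    - unfold one; simpl. ring. }
  destruct (Rle_dec 0 t) as [Ht|Ht].
  - rewrite (Rabs_right t) by lra.
    pose proof (pos phi phi' Hl H0 Hd Hb t Ht).
    pose proof (pos (fun s => - phi s) (fun s => - phi' s) Hl) as A.
    simpl in A. rewrite H0, Ropp_0 in A. specialize (A eq_refl Hneg).
    assert (B : forall s, Rabs (- phi' s) <= K * lam * exp (lam * Rabs s))
      by (intros s; rewrite Rabs_Ropp; apply Hb).
    specialize (A B t Ht). simpl in A. lra.
  - rewrite (Rabs_left t) by lra.
    assert (Hb' : forall s, Rabs (- phi' (- s)) <= K * lam * exp (lam * Rabs s))
      by (intros s; rewrite Rabs_Ropp, <- (Rabs_Ropp s); apply Hb).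
    assert (Hb'' : forall s, Rabs (- - phi' (- s)) <= K * lam * exp (lam * Rabs s))
      by (intros s; rewrite Rabs_Ropp; apply Hb').
    pose proof (pos (fun s => phi (- s)) (fun s => - phi' (- s)) Hl) as A.
    simpl in A. rewrite Ropp_0 in A. specialize (A H0 Hrev Hb' (- t)).
    pose proof (pos (fun s => - phi (- s)) (fun s => - - phi' (- s)) Hl) as B.
    simpl in B. rewrite Ropp_0, H0, Ropp_0 in B. specialize (B eq_refl).
    assert (Hd2 : forall t, is_derive (fun s => - phi (- s)) t (- - phi' (- t))).
    { intros s. apply is_derive_Ropp. apply Hrev. }
    specialize (B Hd2 Hb'' (- t)). rewrite Ropp_involutive in A, B.
    assert (0 <= - t) by lra. specialize (A H). specialize (B H). lra.
Qed.

Lemma exp_nondecreasing (x y : R) : x <= y -> exp x <= exp y.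
Proof. intros [H| ->]; [apply Rlt_le; now apply exp_increasing | lra]. Qed.

Definition picard_step (f : R -> R -> R) (x0 : R) (x : R -> R) (t : R) : R :=
  x0 + RInt (fun s => f s (x s)) 0 t.

Lemma picard_step_derive (f : R -> R -> R) (x0 : R) (x : R -> R) (t : R) :
  (forall s, continuous (fun s => f s (x s)) s) ->
  is_derive (picard_step f x0 x) t (f t (x t)).
Proof.
  intros Hc. unfold picard_step.
  eapply is_derive_val.
  - apply is_derive_Rplus. apply @is_derive_const.
    apply (is_derive_RInt (fun s => f s (x s)) _ 0 t).
    + exists (mkposreal 1 Rlt_0_1). intros y _.
      apply (RInt_correct (V := R_CompleteNormedModule)).
      apply (ex_RInt_continuous (V := R_CompleteNormedModule)). intros z _. apply Hc.
    + apply Hc.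
  - unfold zero; simpl. ring.
Qed.

Lemma picard_step_0 (f : R -> R -> R) (x0 : R) (x : R -> R) :
  picard_step f x0 x 0 = x0.
Proof. unfold picard_step. rewrite RInt_point. unfold zero; simpl. ring. Qed.

(** Global Picard iteration; the bound [M] controls the first increment on the whole line.
    Continuity of [f] is asked along continuous curves, which is what the iterates supply. *)
Lemma ode_exists (f : R -> R -> R) (L M x0 : R) :
  0 < L ->
  (forall t x y, Rabs (f t x - f t y) <= L * Rabs (x - y)) ->
  (forall x, (forall t, continuous x t) -> forall t, continuous (fun s => f s (x s)) t) ->
  (forall t x, Rabs (f t x) <= M) ->
  exists x, x 0 = x0 /\ forall t, is_derive x t (f t (x t)).
Proof.
  intros HL Hlip Hcont HM.
  set (xn := fun n => Nat.iter n (picard_step f x0) (fun _ => x0)).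
  (* With this weight each iteration gains [L / lam = 1/2]; [C] comes from integrating the bound [M]
     on the first increment. *)
  set (lam := 2 * L). set (C := M / lam).
  assert (Hlam : 0 < lam) by (unfold lam; lra).
  assert (Hxc : forall n t, continuous (xn n) t).
  { induction n; intros t.
    - simpl. apply continuous_const.
    - eapply is_derive_continuous, picard_step_derive. intros s. apply Hcont, IHn. }
  assert (Hxd : forall n t, is_derive (xn (S n)) t (f t (xn n t))).
  { intros n t. apply picard_step_derive. intros s. apply Hcont, Hxc. }
  assert (Hx0 : forall n, xn n 0 = x0).
  { intros [|n]; [reflexivity | apply picard_step_0]. }
  assert (HC : 0 <= C).
  { unfold C. apply Rdiv_le_0_compat; [|lra].
    eapply Rle_trans; [apply Rabs_pos | apply (HM 0 0)]. }
  assert (Hstep : forall n t,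
    Rabs (xn (S n) t - xn n t) <= C * (/2) ^ n * exp (lam * Rabs t)).
  { induction n; intros t.
    - apply (growth_bound (fun t => xn 1%nat t - xn 0%nat t) (fun t => f t (xn 0%nat t) - 0)); auto.
      + rewrite !Hx0. ring.
      + intros s. apply is_derive_Rminus; [apply Hxd | apply @is_derive_const].
      + intros s. rewrite Rminus_0_r. eapply Rle_trans; [apply HM |].
        replace (C * (/2)^0 * lam) with M by (unfold C; simpl; field; lra).
        assert (0 <= M) by (eapply Rle_trans; [apply Rabs_pos | apply (HM 0 0)]).
        assert (1 <= exp (lam * Rabs s)).
        { rewrite <- exp_0. apply exp_nondecreasing. apply Rmult_le_pos; [lra | apply Rabs_pos]. }
        nra.
    - apply (growth_bound (fun t => xn (S (S n)) t - xn (S n) t)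
               (fun t => f t (xn (S n) t) - f t (xn n t))); auto.
      + rewrite !Hx0. ring.
      + intros s. apply is_derive_Rminus; apply Hxd.
      + intros s. eapply Rle_trans; [apply Hlip |].
        eapply Rle_trans; [apply Rmult_le_compat_l; [lra | apply IHn] |].
        unfold lam. simpl. apply Req_le. field. }
  assert (Hcauchy : forall n k t,
    Rabs (xn (k + n)%nat t - xn n t) <= 2 * C * exp (lam * Rabs t) * (/2) ^ n).
  { intros n k t.
    assert (Rabs (xn (k + n)%nat t - xn n t)
            <= 2 * C * exp (lam * Rabs t) * ((/2) ^ n - (/2)^(k + n))); cycle 1.
    { eapply Rle_trans; [apply H |]. apply Rmult_le_compat_l.
      - pose proof (exp_pos (lam * Rabs t)). apply Rmult_le_pos; lra.
      - assert (0 < (/2)^(k+n)) by (apply pow_lt; lra). lra. }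
    induction k.
    - simpl. rewrite !Rminus_diag, Rabs_R0. lra.
    - replace (xn (S k + n)%nat t - xn n t)
        with ((xn (S (k + n)) t - xn (k + n)%nat t) + (xn (k + n)%nat t - xn n t))
        by (simpl; ring).
      eapply Rle_trans; [apply Rabs_triang |].
      specialize (Hstep (k + n)%nat t). simpl. simpl in Hstep. lra. }
  assert (Hsmall : forall K eps, 0 < eps -> exists N, forall n, (N <= n)%nat -> K * (/2) ^ n < eps).
  { intros K eps He.
    assert (Hl : is_lim_seq (fun n => K * (/2)^n) (K * 0)).
    { apply (is_lim_seq_scal_l (fun n => (/2)^n) K 0). apply is_lim_seq_geom. rewrite Rabs_right; lra. }
    rewrite Rmult_0_r in Hl. apply is_lim_seq_spec in Hl.
    destruct (Hl (mkposreal eps He)) as [N HN]. exists N. intros n Hn. specialize (HN n Hn). simpl in HN.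
    rewrite Rminus_0_r in HN. eapply Rle_lt_trans; [apply Rle_abs | apply HN]. }
  assert (Hex : forall t, ex_finite_lim_seq (fun n => xn n t)).
  { intros t. apply ex_lim_seq_cauchy_corr. intros eps.
    destruct (Hsmall (2 * C * exp (lam * Rabs t)) (eps / 2)) as [N HN].
    { destruct eps; simpl; lra. }
    exists N. intros n m Hn Hm.
    pose proof (Hcauchy N (n - N)%nat t) as A. pose proof (Hcauchy N (m - N)%nat t) as B.
    rewrite Nat.sub_add in A, B by lia. specialize (HN N (le_n N)).
    replace (xn n t - xn m t) with ((xn n t - xn N t) + - (xn m t - xn N t)) by ring.
    eapply Rle_lt_trans; [apply Rabs_triang |]. rewrite Rabs_Ropp. lra. }
  set (x := fun t => real (Lim_seq (fun n => xn n t))).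
  assert (Hlim : forall t, is_lim_seq (fun n => xn n t) (x t)).
  { intros t. apply Lim_seq_correct', Hex. }
  assert (Hclose : forall n t, Rabs (x t - xn n t) <= 2 * C * exp (lam * Rabs t) * (/2) ^ n).
  { intros n t.
    apply (is_lim_seq_le (fun k => Rabs (xn (k + n)%nat t - xn n t)) (fun _ => 2 * C * exp (lam * Rabs t) * (/2) ^ n)
             (Rabs (x t - xn n t)) (2 * C * exp (lam * Rabs t) * (/2) ^ n)).
    - intros k. apply Hcauchy.
    - apply (is_lim_seq_abs _ (Finite (x t - xn n t))).
      apply (is_lim_seq_minus' (fun k => xn (k + n)%nat t) (fun _ => xn n t)).
      + apply (is_lim_seq_incr_n (fun k => xn k t) n). apply Hlim.
      + apply is_lim_seq_const.
    - apply is_lim_seq_const. }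
  assert (Hcx : forall t, continuous x t).
  { intros t. apply continuity_pt_filterlim. intros eps He.
    set (E := 2 * C * exp (lam * (Rabs t + 1))).
    destruct (Hsmall E (eps / 3)) as [N HN]; [lra |]. specialize (HN N (le_n N)).
    assert (Hc := Hxc N t). apply continuity_pt_filterlim in Hc.
    destruct (Hc (eps / 3)) as [al [Hal Hc']]; [lra |].
    exists (Rmin al 1). split; [apply Rmin_glb_lt; lra |].
    intros y [Hy1 Hy2]. simpl in *. unfold R_dist in *.
    assert (Hy3 : Rabs (y - t) < al) by (eapply Rlt_le_trans; [apply Hy2 | apply Rmin_l]).
    assert (Hy4 : Rabs (y - t) < 1) by (eapply Rlt_le_trans; [apply Hy2 | apply Rmin_r]).
    assert (HE : forall s, Rabs s <= Rabs t + 1 -> Rabs (x s - xn N s) < eps / 3).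
    { intros s Hs. eapply Rle_lt_trans; [apply Hclose |]. eapply Rle_lt_trans; [| apply HN].
      apply Rmult_le_compat_r; [apply pow_le; lra |]. unfold E.
      apply Rmult_le_compat_l; [lra |]. apply exp_nondecreasing, Rmult_le_compat_l; lra. }
    assert (A := HE t ltac:(lra)).
    assert (B := HE y ltac:(replace y with (t + (y - t)) at 1 by ring;
        eapply Rle_trans; [apply Rabs_triang | lra])).
    specialize (Hc' y (conj Hy1 Hy3)).
    replace (x y - x t) with ((x y - xn N y) + (xn N y - xn N t) + - (x t - xn N t)) by ring.
    eapply Rle_lt_trans; [apply Rabs_triang |]. rewrite Rabs_Ropp.
    pose proof (Rabs_triang (x y - xn N y) (xn N y - xn N t)). lra. }
  (* [x] and its Picard image both lie within a multiple of [2^-n] of the same iterate, so they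
     coincide. *)
  assert (Hy : forall t, x t = picard_step f x0 x t).
  { intros t.
    assert (Hb : forall n t, Rabs (picard_step f x0 x t - xn (S n) t) <= C * (/2)^n * exp (lam * Rabs t)).
    { intros n. apply (growth_bound (fun t => picard_step f x0 x t - xn (S n) t)
               (fun t => f t (x t) - f t (xn n t))); auto.
      + rewrite Hx0, picard_step_0. ring.
      + intros s. apply is_derive_Rminus; [apply picard_step_derive; intros; apply Hcont, Hcx | apply Hxd].
      + intros s. eapply Rle_trans; [apply Hlip |].
        eapply Rle_trans; [apply Rmult_le_compat_l; [lra | apply Hclose] |].
        unfold lam. apply Req_le. field. }
    apply cond_eq. intros eps He.
    destruct (Hsmall (2 * C * exp (lam * Rabs t)) (eps / 2)) as [N HN]; [lra |].
    pose proof (HN N (le_n N)) as A. pose proof (HN (S N) (le_S _ _ (le_n N))) as B.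
    specialize (Hb N t). specialize (Hclose (S N) t).
    replace (x t - picard_step f x0 x t)
      with ((x t - xn (S N) t) + - (picard_step f x0 x t - xn (S N) t)) by ring.
    eapply Rle_lt_trans; [apply Rabs_triang |]. rewrite Rabs_Ropp.
    assert (0 <= (/2)^N * exp (lam * Rabs t)).
    { apply Rmult_le_pos; [apply pow_le; lra | apply Rlt_le, exp_pos]. }
    assert (0 <= C * ((/2)^N * exp (lam * Rabs t))) by (apply Rmult_le_pos; lra).
    lra. }
  exists x. split.
  - rewrite Hy. apply picard_step_0.
  - intros t. apply (is_derive_ext (picard_step f x0 x)).
    + intros s. now rewrite <- Hy.
    + apply picard_step_derive. intros s. apply Hcont, Hcx.
Qed.

(** Gronwall for [z^2 exp (-2 L t)], which is nonincreasing; the square avoids differentiating an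
    absolute value. Equal initial values give uniqueness of solutions. *)
Lemma ode_dependence (f : R -> R -> R) (L : R) (x y : R -> R) :
  (forall t x y, Rabs (f t x - f t y) <= L * Rabs (x - y)) ->
  (forall t, is_derive x t (f t (x t))) -> (forall t, is_derive y t (f t (y t))) ->
  forall t, Rabs (x t - y t) <= Rabs (x 0 - y 0) * exp (L * Rabs t).
Proof.
  intros Hlip Hx Hy.
  assert (key : forall (g : R -> R -> R) x y,
    (forall t x y, Rabs (g t x - g t y) <= L * Rabs (x - y)) ->
    (forall t, is_derive x t (g t (x t))) -> (forall t, is_derive y t (g t (y t))) ->
    forall t, 0 <= t -> Rabs (x t - y t) <= Rabs (x 0 - y 0) * exp (L * t)).
  { clear. intros g x y Hlip Hx Hy t Ht.
    set (z := fun t => x t - y t).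
    assert (Hz : forall t, is_derive z t (g t (x t) - g t (y t))).
    { intros s. apply is_derive_Rminus; auto. }
    assert (A : - (z 0 * z 0 * exp (- (2 * L) * 0)) <= - (z t * z t * exp (- (2 * L) * t))).
    { apply (nondecreasing_of_derive (fun s => - (z s * z s * exp (- (2 * L) * s)))
        (fun s => - (((g s (x s) - g s (y s)) * z s + z s * (g s (x s) - g s (y s))) * exp (- (2 * L) * s)
                   + z s * z s * (- (2 * L) * exp (- (2 * L) * s))))); [lra | |].
      - intros s _. apply is_derive_Ropp.
        apply (is_derive_Rmult (fun s => z s * z s) (fun s => exp (- (2 * L) * s))).
        + apply (is_derive_Rmult z z); apply Hz.
        + auto_derive; [easy | ring].
      - intros s _. pose proof (exp_pos (- (2 * L) * s)).
        specialize (Hlip s (x s) (y s)). fold (z s) in Hlip.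
        assert ((g s (x s) - g s (y s)) * z s <= L * (z s * z s)).
        { eapply Rle_trans; [apply Rle_abs |]. rewrite Rabs_mult.
          rewrite <- (Rabs_right (z s * z s)) by nra. rewrite Rabs_mult, <- Rmult_assoc.
          apply Rmult_le_compat_r; [apply Rabs_pos | exact Hlip]. }
        nra. }
    rewrite Rmult_0_r, exp_0 in A.
    assert (B : z t * z t <= (Rabs (z 0) * exp (L * t)) ^ 2).
    { rewrite Rpow_mult_distr, pow2_abs.
      assert (exp (L * t) ^ 2 * exp (- (2 * L) * t) = 1).
      { replace (exp (L*t)^2) with (exp (L * t + L * t)) by (rewrite exp_plus; ring).
        rewrite <- exp_plus. replace (L * t + L * t + - (2 * L) * t) with 0 by ring. apply exp_0. }
      pose proof (exp_pos (- (2 * L) * t)). pose proof (exp_pos (L * t)).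
      set (e := exp (L * t) ^ 2) in *. set (k := exp (- (2 * L) * t)) in *.
      assert (0 < e) by (unfold e; nra).
      assert (e * (z t * z t * k) <= e * (z 0 * z 0)) by (apply Rmult_le_compat_l; lra).
      replace (e * (z t * z t * k)) with (z t * z t * (e * k)) in H3 by ring.
      rewrite H in H3. lra. }
    apply Rsqr_incr_0_var.
    - unfold Rsqr. rewrite <- Rabs_mult, Rabs_right by apply Rle_ge, Rle_0_sqr.
      replace ((Rabs (x 0 - y 0) * exp (L * t)) * (Rabs (x 0 - y 0) * exp (L * t)))
        with ((Rabs (z 0) * exp (L * t)) ^ 2) by (unfold z; ring). exact B.
    - apply Rmult_le_pos; [apply Rabs_pos | apply Rlt_le, exp_pos]. }
  intros t. destruct (Rle_dec 0 t) as [Ht|Ht].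
  - rewrite (Rabs_right t) by lra. now apply (key f).
  - rewrite (Rabs_left t) by lra.
    assert (rev : forall x, (forall t, is_derive x t (f t (x t))) ->
      forall t, is_derive (fun s => x (- s)) t (- f (- t) (x (- t)))).
    { clear. intros x Hx s. eapply is_derive_val.
      - apply (is_derive_Rcomp x Ropp); [apply Hx |].
        apply (is_derive_Ropp (fun t => t)). apply @is_derive_id.
      - unfold one; simpl. ring. }
    pose proof (key (fun t x => - f (- t) x) (fun s => x (- s)) (fun s => y (- s))) as K.
    simpl in K. rewrite Ropp_0 in K.
    rewrite <- (Ropp_involutive t) at 1 2. apply K; [| | | lra].
    + intros s a b. replace (- f (- s) a - - f (- s) b) with (- (f (- s) a - f (- s) b)) by ring.
      rewrite Rabs_Ropp. apply Hlip.
    + exact (rev x Hx).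
    + exact (rev y Hy).
Qed.

(** * Uniformly bounded Lipschitz families and polynomials in two variables *)

(** One constant serves all parameters [p]: the parameter is an angle, or later the whole tuple of
    perturbation data, and the estimates have to be uniform in it. *)
Definition unif_lip {P : Type} (D : P -> R -> Prop) (f : P -> R -> R) : Prop :=
  exists M, forall p x y, D p x -> D p y ->
    Rabs (f p x) <= M /\ Rabs (f p x - f p y) <= M * Rabs (x - y).

Lemma unif_lip_ext {P} (D : P -> R -> Prop) (f g : P -> R -> R) :
  (forall p x, D p x -> f p x = g p x) -> unif_lip D f -> unif_lip D g.
Proof.
  intros E [M HM]. exists M. intros p x y Hx Hy. rewrite <- !E by auto. auto.
Qed.

Lemma unif_lip_const {P} (D : P -> R -> Prop) (c : P -> R) (B : R) :
  (forall p x, D p x -> Rabs (c p) <= B) -> unif_lip D (fun p _ => c p).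
Proof.
  intros H. exists B. intros p x y Hx Hy. split; [eauto |].
  rewrite Rminus_diag, Rabs_R0. apply Rmult_le_pos; [| apply Rabs_pos].
  eapply Rle_trans; [apply Rabs_pos | eauto].
Qed.

Lemma unif_lip_num {P} (D : P -> R -> Prop) (c : R) : unif_lip D (fun _ _ => c).
Proof. apply (unif_lip_const D (fun _ => c) (Rabs c)). intros; lra. Qed.

Lemma unif_lip_plus {P} (D : P -> R -> Prop) (f g : P -> R -> R) :
  unif_lip D f -> unif_lip D g -> unif_lip D (fun p x => f p x + g p x).
Proof.
  intros [M HM] [N HN]. exists (M + N). intros p x y Hx Hy.
  destruct (HM p x y Hx Hy) as [A B], (HN p x y Hx Hy) as [A' B']. split.
  - eapply Rle_trans; [apply Rabs_triang | lra].
  - replace (f p x + g p x - (f p y + g p y)) with ((f p x - f p y) + (g p x - g p y)) by ring.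
    eapply Rle_trans; [apply Rabs_triang | lra].
Qed.

Lemma unif_lip_mult {P} (D : P -> R -> Prop) (f g : P -> R -> R) :
  unif_lip D f -> unif_lip D g -> unif_lip D (fun p x => f p x * g p x).
Proof.
  intros [M HM] [N HN]. exists (M * N + M * N). intros p x y Hx Hy.
  destruct (HM p x y Hx Hy) as [A B], (HN p x y Hx Hy) as [A' B'].
  destruct (HN p y x Hy Hx) as [A'' _].
  pose proof (Rabs_pos (f p x)). pose proof (Rabs_pos (g p x)).
  pose proof (Rabs_pos (f p x - f p y)). pose proof (Rabs_pos (g p x - g p y)).
  pose proof (Rabs_pos (x - y)). split.
  - rewrite Rabs_mult.
    assert (Rabs (f p x) * Rabs (g p x) <= M * N) by (apply Rmult_le_compat; lra). nra.
  - replace (f p x * g p x - f p y * g p y)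
      with (f p x * (g p x - g p y) + (f p x - f p y) * g p y) by ring.
    eapply Rle_trans; [apply Rabs_triang |]. rewrite !Rabs_mult.
    assert (Rabs (f p x) * Rabs (g p x - g p y) <= M * (N * Rabs (x - y)))
      by (apply Rmult_le_compat; lra).
    assert (Rabs (f p x - f p y) * Rabs (g p y) <= (M * Rabs (x - y)) * N)
      by (apply Rmult_le_compat; try lra; apply Rabs_pos).
    lra.
Qed.

Lemma unif_lip_opp {P} (D : P -> R -> Prop) (f : P -> R -> R) :
  unif_lip D f -> unif_lip D (fun p x => - f p x).
Proof.
  intros H. apply (unif_lip_ext D (fun p x => (-1) * f p x)); [intros; ring |].
  apply (unif_lip_mult D (fun _ _ => -1)); [apply unif_lip_num | exact H].
Qed.

Lemma unif_lip_minus {P} (D : P -> R -> Prop) (f g : P -> R -> R) :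
  unif_lip D f -> unif_lip D g -> unif_lip D (fun p x => f p x - g p x).
Proof.
  intros Hf Hg. apply (unif_lip_plus D f (fun p x => - g p x) Hf (unif_lip_opp D g Hg)).
Qed.

Lemma unif_lip_pow {P} (D : P -> R -> Prop) (f : P -> R -> R) (n : nat) :
  unif_lip D f -> unif_lip D (fun p x => f p x ^ n).
Proof.
  intros H. induction n; simpl.
  - apply unif_lip_num.
  - now apply (unif_lip_mult D f (fun p x => f p x ^ n)).
Qed.

Ltac unif_lip_auto := repeat first
  [ assumption
  | match goal with
    | |- unif_lip _ (fun p x => _ + _) => apply unif_lip_plus
    | |- unif_lip _ (fun p x => _ - _) => apply unif_lip_minus
    | |- unif_lip _ (fun p x => - _) => apply unif_lip_opp
    | |- unif_lip _ (fun p x => _ * _) => apply unif_lip_mult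
    | |- unif_lip _ (fun p x => _ ^ _) => apply unif_lip_pow
    | |- unif_lip _ (fun p x => _ / _) => unfold Rdiv
    | H : forall k, (k < 6)%nat -> unif_lip _ _ |- _ => apply H; lia
    | H : forall i j : nat, unif_lip _ _ |- _ => apply H
    end
  | apply unif_lip_num ].

Lemma unif_lip_inv {P} (D : P -> R -> Prop) (f : P -> R -> R) (m : R) :
  0 < m -> (forall p x, D p x -> m <= f p x) ->
  unif_lip D f -> unif_lip D (fun p x => / f p x).
Proof.
  intros Hm Hf [M HM]. exists (/ m + / m * / m * M). intros p x y Hx Hy.
  pose proof (Hf p x Hx). pose proof (Hf p y Hy).
  destruct (HM p x y Hx Hy) as [A B].
  assert (0 <= M) by (eapply Rle_trans; [apply Rabs_pos | apply A]).
  assert (I : forall z, m <= z -> 0 < / z <= / m).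
  { intros z Hz. split; [apply Rinv_0_lt_compat; lra | apply Rinv_le_contravar; lra]. }
  pose proof (I _ H). pose proof (I _ H0). pose proof (I m (Rle_refl m)).
  pose proof (Rabs_pos (x - y)). split.
  - rewrite Rabs_right by lra.
    assert (0 <= / m * / m * M) by (apply Rmult_le_pos; [apply Rmult_le_pos |]; lra). lra.
  - replace (/ f p x - / f p y) with (/ f p x * / f p y * - (f p x - f p y)) by (field; lra).
    rewrite !Rabs_mult, Rabs_Ropp, (Rabs_right (/ f p x)), (Rabs_right (/ f p y)) by lra.
    assert (/ f p x * / f p y * Rabs (f p x - f p y) <= / m * / m * (M * Rabs (x - y))).
    { apply Rmult_le_compat; [apply Rmult_le_pos; lra | apply Rabs_pos | | exact B].
      apply Rmult_le_compat; lra. }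
    assert (0 <= / m * Rabs (x - y)) by (apply Rmult_le_pos; lra).
    lra.
Qed.

Lemma continuous_Rplus (f g : R -> R) x : continuous f x -> continuous g x -> continuous (fun y => f y + g y) x.
Proof. intros. now apply (continuous_plus f g). Qed.
Lemma continuous_Rminus (f g : R -> R) x : continuous f x -> continuous g x -> continuous (fun y => f y - g y) x.
Proof. intros. now apply (continuous_minus f g). Qed.
Lemma continuous_Rmult (f g : R -> R) x : continuous f x -> continuous g x -> continuous (fun y => f y * g y) x.
Proof. intros. now apply (continuous_mult f g). Qed.
Lemma continuous_Rdiv (f g : R -> R) x : g x <> 0 -> continuous f x -> continuous g x -> continuous (fun y => f y / g y) x.
Proof.
  intros H Hf Hg. apply (continuous_Rmult f (fun y => / g y)); [exact Hf |].
  apply (continuous_comp g Rinv); [exact Hg | now apply continuous_Rinv].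
Qed.
Lemma continuous_Rpow (f : R -> R) n x : continuous f x -> continuous (fun y => f y ^ n) x.
Proof.
  intros H. induction n; simpl; [apply continuous_const | now apply continuous_Rmult].
Qed.

Ltac cont := repeat first
  [ assumption
  | apply continuous_const
  | match goal with
    | |- continuous (fun y => _ + _) _ => apply continuous_Rplus
    | |- continuous (fun y => _ - _) _ => apply continuous_Rminus
    | |- continuous (fun y => - _) _ => apply (continuous_opp (V := R_NormedModule))
    | |- continuous (fun y => _ * _) _ => apply continuous_Rmult
    | |- continuous (fun y => _ / _) _ => apply continuous_Rdiv
    | |- continuous (fun y => _ ^ _) _ => apply continuous_Rpow
    end
  | apply continuous_id ].

(** A predicate on functions instead of a syntax: continuity and Lipschitz bounds follow by
    induction, and [bipoly_ext] allows rewriting up to pointwise equality. *)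
Inductive bipoly : (R -> R -> R) -> Prop :=
| bipoly_const c : bipoly (fun _ _ => c)
| bipoly_fst : bipoly (fun a _ => a)
| bipoly_snd : bipoly (fun _ b => b)
| bipoly_plus f g : bipoly f -> bipoly g -> bipoly (fun a b => f a b + g a b)
| bipoly_mult f g : bipoly f -> bipoly g -> bipoly (fun a b => f a b * g a b)
| bipoly_ext f g : (forall a b, f a b = g a b) -> bipoly f -> bipoly g.

Lemma bipoly_pow (f : R -> R -> R) (n : nat) : bipoly f -> bipoly (fun a b => f a b ^ n).
Proof.
  intros H. induction n; simpl; [apply bipoly_const | now apply (bipoly_mult f)].
Qed.

Lemma bipoly_opp (f : R -> R -> R) : bipoly f -> bipoly (fun a b => - f a b).
Proof.
  intros H. apply (bipoly_ext (fun a b => (-1) * f a b)); [intros; ring |].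
  apply (bipoly_mult (fun _ _ => -1)); [apply bipoly_const | exact H].
Qed.

Lemma bipoly_minus (f g : R -> R -> R) :
  bipoly f -> bipoly g -> bipoly (fun a b => f a b - g a b).
Proof. intros Hf Hg. apply (bipoly_plus f (fun a b => - g a b) Hf), bipoly_opp, Hg. Qed.

Ltac bipoly_auto := repeat first
  [ assumption
  | apply bipoly_const | apply bipoly_fst | apply bipoly_snd
  | match goal with
    | |- bipoly (fun a b => _ + _) => apply bipoly_plus
    | |- bipoly (fun a b => _ - _) => apply bipoly_minus
    | |- bipoly (fun a b => - _) => apply bipoly_opp
    | |- bipoly (fun a b => _ * _) => apply bipoly_mult
    | |- bipoly (fun a b => _ ^ _) => apply bipoly_pow
    end ].

Lemma bipoly_continuous (f : R -> R -> R) : bipoly f ->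
  forall (x y : R -> R) t, continuous x t -> continuous y t -> continuous (fun s => f (x s) (y s)) t.
Proof.
  induction 1; intros x y t Hx Hy; auto.
  - apply continuous_const.
  - apply (continuous_plus (fun s => f (x s) (y s)) (fun s => g (x s) (y s))); auto.
  - apply (continuous_mult (fun s => f (x s) (y s)) (fun s => g (x s) (y s))); auto.
  - apply (continuous_ext (fun s => f (x s) (y s))); auto.
Qed.

Lemma bipoly_unif_lip (f : R -> R -> R) : bipoly f ->
  forall {P : Type} (D : P -> R -> Prop) (a b : P -> R -> R),
  unif_lip D a -> unif_lip D b -> unif_lip D (fun p x => f (a p x) (b p x)).
Proof.
  induction 1; intros P D u v Hu Hv; auto.
  - apply unif_lip_num.
  - apply (unif_lip_plus D (fun p x => f (u p x) (v p x))); auto.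
  - apply (unif_lip_mult D (fun p x => f (u p x) (v p x))); auto.
  - apply (unif_lip_ext D (fun p x => f (u p x) (v p x))); auto.
Qed.

(** A barrier argument with two kinds of wall: [B] cannot vanish while both functions are
    nonnegative, and [A] can vanish only while increasing. In the applications [A] measures the gap
    to the levels [c1], [c2] of [W], and [B] the gap to the radii [r1], [r2]. *)
Lemma trapping (A B : R -> R) :
  (forall t, continuous A t) -> (forall t, continuous B t) ->
  (forall t, 0 <= A t -> 0 <= B t -> 0 < B t) ->
  (forall t, A t = 0 -> 0 < B t -> exists d, 0 < d /\ is_derive A t d) ->
  0 <= A 0 -> 0 <= B 0 -> forall t, 0 < t -> 0 < A t /\ 0 < B t.
Proof.
  intros HcA HcB HB HA A0 B0.
  assert (sgn : forall t, A t = 0 -> 0 < B t -> exists e, 0 < e /\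
     (forall s, t < s < t + e -> 0 < A s /\ 0 < B s) /\ (forall s, t - e < s < t -> A s < 0)).
  { intros t HAt HBt. destruct (HA t HAt HBt) as [d [Hd Hder]].
    apply is_derive_Reals in Hder. destruct (Hder (d / 2)) as [e1 He1]; [lra |].
    assert (Hc := HcB t). apply continuity_pt_filterlim in Hc.
    destruct (Hc (B t)) as [e2 [He2 Hc2]]; [lra |].
    assert (Hder' : forall h, h <> 0 -> Rabs h < e1 -> 0 < A (t + h) / h).
    { intros h Hh Hh1. specialize (He1 h Hh Hh1). rewrite HAt, Rminus_0_r in He1.
      apply Rabs_def2 in He1. lra. }
    pose proof (cond_pos e1). exists (Rmin e1 e2). split; [apply Rmin_glb_lt; lra |].
    pose proof (Rmin_l e1 e2). pose proof (Rmin_r e1 e2).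
    split; intros s Hs.
    - split.
      + specialize (Hder' (s - t) ltac:(lra) ltac:(rewrite Rabs_right; lra)).
        replace (t + (s - t)) with s in Hder' by ring.
        apply (Rmult_lt_compat_r (s - t)) in Hder'; [| lra].
        unfold Rdiv in Hder'. rewrite Rmult_assoc, Rinv_l in Hder' by lra. lra.
      + specialize (Hc2 s). simpl in Hc2. unfold R_dist in Hc2.
        assert (Rabs (B s - B t) < B t).
        { apply Hc2. split; [split; [exact I | lra] | rewrite Rabs_right; lra]. }
        apply Rabs_def2 in H2. lra.
    - specialize (Hder' (s - t) ltac:(lra) ltac:(rewrite Rabs_left; lra)).
      replace (t + (s - t)) with s in Hder' by ring.
      apply (Rmult_lt_compat_r (t - s)) in Hder'; [| lra].
      replace (A s / (s - t) * (t - s)) with (- A s) in Hder' by (field; lra). lra. }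
  assert (nn : forall t, 0 <= t -> 0 <= A t /\ 0 <= B t).
  { intros t1 Ht1. destruct (Rlt_dec (Rmin (A t1) (B t1)) 0) as [Hneg|Hpos]; cycle 1.
    { pose proof (Rmin_l (A t1) (B t1)). pose proof (Rmin_r (A t1) (B t1)). lra. }
    exfalso. set (m := fun t => Rmin (A t) (B t)).
    (* [ts] is the last time up to [t1] at which both functions are nonnegative; it lies strictly
       before [t1], yet both turn out positive just after it. *)
    destruct (completeness (fun t => 0 <= t <= t1 /\ 0 <= m t)) as [ts [Hub Hlub]].
    { exists t1. intros t [Ht _]. lra. }
    { exists 0. split; [lra | unfold m; apply Rmin_glb; lra]. }
    assert (H0s : 0 <= ts) by (apply Hub; split; [lra | apply Rmin_glb; lra]).
    assert (Hs1 : ts <= t1) by (apply Hlub; intros t [Ht _]; lra).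
    assert (Hcm : forall t, forall e, 0 < e -> exists d, 0 < d /\
               forall s, Rabs (s - t) < d -> A t - e < A s < A t + e /\ B t - e < B s < B t + e).
    { intros t e He. pose proof (HcA t) as Ha. pose proof (HcB t) as Hb.
      apply continuity_pt_filterlim in Ha, Hb.
      destruct (Ha e He) as [d1 [Hd1 Ha']], (Hb e He) as [d2 [Hd2 Hb']].
      exists (Rmin d1 d2). split; [apply Rmin_glb_lt; lra |]. intros s Hs.
      pose proof (Rmin_l d1 d2). pose proof (Rmin_r d1 d2).
      simpl in Ha', Hb'. unfold R_dist in Ha', Hb'.
      destruct (Req_dec s t) as [->|Hst]; [lra |].
      specialize (Ha' s ltac:(split; [split; [exact I | auto] | lra])).
      specialize (Hb' s ltac:(split; [split; [exact I | auto] | lra])).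
      apply Rabs_def2 in Ha', Hb'. lra. }
    assert (Hge : 0 <= A ts /\ 0 <= B ts).
    { destruct (Rlt_dec (m ts) 0) as [Hn|Hn]; cycle 1.
      { unfold m in Hn. pose proof (Rmin_l (A ts) (B ts)). pose proof (Rmin_r (A ts) (B ts)). lra. }
      exfalso. destruct (Hcm ts (- m ts)) as [d [Hd Hd']]; [lra |].
      assert (ts <= Rmax 0 (ts - d / 2)).
      { apply Hlub. intros t [Ht Hmt]. destruct (Rle_dec t (ts - d/2)); [eapply Rle_trans; [eassumption | apply Rmax_r] |].
        exfalso. pose proof (Hub t (conj Ht Hmt)).
        specialize (Hd' t ltac:(apply Rabs_def1; lra)).
        unfold m in *. unfold Rmin in Hn, Hmt, Hd'.
        destruct (Rle_dec (A ts) (B ts)), (Rle_dec (A t) (B t)); lra. }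
      assert (Hm0 : m 0 < 0).
      { unfold Rmax in H. destruct (Rle_dec 0 (ts - d/2)); [lra |].
        assert (E : ts = 0) by lra. rewrite E in Hn. exact Hn. }
      unfold m, Rmin in Hm0. destruct (Rle_dec (A 0) (B 0)); lra. }
    destruct Hge as [HAs HBs]. pose proof (HB ts HAs HBs) as HBp.
    assert (Hlt : ts < t1).
    { destruct (Req_dec ts t1) as [E|E]; [| lra]. rewrite E in HAs, HBs. unfold Rmin in Hneg.
      destruct (Rle_dec (A t1) (B t1)); lra. }
    assert (exists e, 0 < e /\ forall s, ts < s < ts + e -> 0 < A s /\ 0 < B s) as [e [He Hs]].
    { destruct (Req_dec (A ts) 0) as [Ez|En].
      - destruct (sgn ts Ez HBp) as [e [He [Hp _]]]. now exists e.
      - destruct (Hcm ts (Rmin (A ts) (B ts))) as [d [Hd Hd']]; [apply Rmin_glb_lt; lra |].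
        exists d. split; [exact Hd |]. intros s Hs. specialize (Hd' s ltac:(apply Rabs_def1; lra)).
        pose proof (Rmin_l (A ts) (B ts)). pose proof (Rmin_r (A ts) (B ts)). lra. }
    set (s := ts + Rmin (e / 2) (t1 - ts)).
    assert (0 < Rmin (e / 2) (t1 - ts)) by (apply Rmin_glb_lt; lra).
    pose proof (Rmin_l (e / 2) (t1 - ts)). pose proof (Rmin_r (e / 2) (t1 - ts)).
    destruct (Hs s) as [P Q]; [unfold s; lra |].
    assert (s <= ts) by (apply Hub; split; [unfold s; lra | apply Rmin_glb; lra]).
    unfold s in *; lra. }
  intros t Ht. destruct (nn t ltac:(lra)) as [HAt HBt].
  pose proof (HB t HAt HBt) as HBp. split; [| exact HBp].
  destruct HAt as [|E]; [assumption |]. exfalso.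
  (* A zero of [A] at a positive time would be preceded by negative values. *)
  destruct (sgn t (eq_sym E) HBp) as [e [He [_ Hm]]].
  set (h := Rmin (e / 2) t). assert (0 < h) by (apply Rmin_glb_lt; lra).
  assert (h <= e / 2) by apply Rmin_l. assert (h <= t) by apply Rmin_r.
  specialize (Hm (t - h) ltac:(lra)). destruct (nn (t - h) ltac:(lra)). lra.
Qed.

(** * Limit cycles in an annulus transverse to the flow *)

(* Clockwise polar coordinates [a = rho cos theta, b = - rho sin theta], in which the unperturbed rotation has [theta' = 1]. *)
Definition polar (f : R -> R -> R) (rho theta : R) : R :=
  f (rho * cos theta) (- (rho * sin theta)).

Definition ang_speed (X1 X2 : R -> R -> R) (rho theta : R) : R :=
  - (sin theta * polar X1 rho theta + cos theta * polar X2 rho theta) / rho.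

Definition rad_speed (X1 X2 : R -> R -> R) (rho theta : R) : R :=
  cos theta * polar X1 rho theta - sin theta * polar X2 rho theta.

Definition flux (X1 X2 W1 W2 : R -> R -> R) (rho theta : R) : R :=
  polar W1 rho theta * polar X1 rho theta + polar W2 rho theta * polar X2 rho theta.

(** The chain rule along differentiable curves is taken as the definition: orbits use the gradient
    in this form, and it is stable under sums and products. *)
Definition has_gradient (W W1 W2 : R -> R -> R) : Prop :=
  forall (x y : R -> R) (t dx dy : R), is_derive x t dx -> is_derive y t dy ->
  is_derive (fun s => W (x s) (y s)) t (W1 (x t) (y t) * dx + W2 (x t) (y t) * dy).

(* The flow leaves the annulus [c1 <= W <= c2] when [s = 1] and enters it when [s = -1]. *)
Record annulus (X1 X2 W W1 W2 : R -> R -> R) (r1 r2 c1 c2 om s : R) : Prop := {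
  ann_r1 : 0 < r1;
  ann_r2 : r1 < r2;
  ann_c : c1 < c2;
  ann_om : 0 < om;
  ann_s : s = 1 \/ s = -1;
  ann_X1 : bipoly X1;
  ann_X2 : bipoly X2;
  ann_W : bipoly W;
  ann_grad : has_gradient W W1 W2;
  ann_rot : forall rho theta, r1 <= rho <= r2 -> om <= ang_speed X1 X2 rho theta;
  ann_radial : forall rho rho' theta, r1 <= rho -> rho < rho' -> rho' <= r2 ->
    polar W rho theta < polar W rho' theta;
  ann_inner : forall theta, polar W r1 theta < c1;
  ann_outer : forall theta, c2 < polar W r2 theta;
  ann_flux1 : forall rho theta, r1 <= rho <= r2 -> polar W rho theta = c1 ->
    s * flux X1 X2 W1 W2 rho theta < 0;
  ann_flux2 : forall rho theta, r1 <= rho <= r2 -> polar W rho theta = c2 ->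
    0 < s * flux X1 X2 W1 W2 rho theta;
  ann_mono : forall rho rho' theta, r1 <= rho -> rho < rho' -> rho' <= r2 ->
    c1 <= polar W rho theta -> polar W rho' theta <= c2 ->
    s * (flux X1 X2 W1 W2 rho theta / ang_speed X1 X2 rho theta)
    < s * (flux X1 X2 W1 W2 rho' theta / ang_speed X1 X2 rho' theta) }.

Ltac open_annulus An :=
  pose proof An as [Hr1 Hr2 Hc12 Hom Hs HX1 HX2 HW Hgrad Hrot Hrad Hin Hout Hfl1 Hfl2 Hmono].

(** * The radial equation inside the annulus *)

Definition clamp (r1 r2 x : R) : R := Rmax r1 (Rmin r2 x).

Lemma clamp_bounds (r1 r2 x : R) : r1 <= r2 -> r1 <= clamp r1 r2 x <= r2.
Proof.
  intros H. unfold clamp, Rmax, Rmin.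
  destruct (Rle_dec r2 x);
    match goal with |- context [Rle_dec r1 ?z] => destruct (Rle_dec r1 z) end; lra.
Qed.

Lemma clamp_id (r1 r2 x : R) : r1 <= x <= r2 -> clamp r1 r2 x = x.
Proof.
  intros H. unfold clamp, Rmax, Rmin.
  destruct (Rle_dec r2 x);
    match goal with |- context [Rle_dec r1 ?z] => destruct (Rle_dec r1 z) end; lra.
Qed.

Lemma clamp_lip (r1 r2 x y : R) : Rabs (clamp r1 r2 x - clamp r1 r2 y) <= Rabs (x - y).
Proof.
  unfold clamp, Rmax, Rmin, Rabs.
  destruct (Rle_dec r2 x), (Rle_dec r2 y);
    repeat match goal with |- context [Rle_dec r1 ?z] => destruct (Rle_dec r1 z) end;
    repeat match goal with |- context [Rcase_abs ?z] => destruct (Rcase_abs z) end; lra.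
Qed.

Lemma clamp_continuous (r1 r2 : R) (x : R -> R) (t : R) :
  continuous x t -> continuous (fun s => clamp r1 r2 (x s)) t.
Proof.
  intros H. apply continuity_pt_filterlim. apply continuity_pt_filterlim in H.
  intros e He. destruct (H e He) as [d [Hd H']]. exists d. split; [exact Hd |].
  intros y Hy. specialize (H' y Hy). simpl in *. unfold R_dist in *.
  eapply Rle_lt_trans; [apply clamp_lip | exact H'].
Qed.

Lemma unif_lip_clamp {P} (D : P -> R -> Prop) (r1 r2 : R) :
  0 < r1 -> r1 < r2 -> unif_lip D (fun _ x => clamp r1 r2 x).
Proof.
  intros H1 H2. exists (r2 + 1). intros p x y _ _. split.
  - pose proof (clamp_bounds r1 r2 x). rewrite Rabs_right; lra.
  - eapply Rle_trans; [apply clamp_lip |]. pose proof (Rabs_pos (x - y)).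
    assert (0 <= r2 * Rabs (x - y)) by (apply Rmult_le_pos; lra). lra.
Qed.

Lemma Rabs_cos_le (x : R) : Rabs (cos x) <= 1.
Proof. apply Rabs_le. pose proof (COS_bound x). lra. Qed.

Lemma Rabs_sin_le (x : R) : Rabs (sin x) <= 1.
Proof. apply Rabs_le. pose proof (SIN_bound x). lra. Qed.

(** The right-hand side of the equation for [d rho / d theta]. Clamping the radius makes it bounded
    and Lipschitz for all [x], as global existence requires; solutions that stay in the annulus do
    not feel the clamp. *)
Definition radial_field (X1 X2 : R -> R -> R) (r1 r2 theta x : R) : R :=
  rad_speed X1 X2 (clamp r1 r2 x) theta / ang_speed X1 X2 (clamp r1 r2 x) theta.

Lemma unif_lip_polar {P} (D : P -> R -> Prop) (f : R -> R -> R) (rho : P -> R -> R) (theta : P -> R) :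
  bipoly f -> unif_lip D rho -> unif_lip D (fun p x => polar f (rho p x) (theta p)).
Proof.
  intros Hf Hr. unfold polar.
  apply (bipoly_unif_lip f Hf D (fun p x => rho p x * cos (theta p))
           (fun p x => - (rho p x * sin (theta p)))).
  - apply unif_lip_mult; [exact Hr |].
    apply (unif_lip_const D _ 1). intros; apply Rabs_cos_le.
  - apply unif_lip_opp, unif_lip_mult; [exact Hr |].
    apply (unif_lip_const D _ 1). intros; apply Rabs_sin_le.
Qed.

Lemma polar_continuous (f : R -> R -> R) (rho theta : R -> R) (t : R) :
  bipoly f -> continuous rho t -> continuous theta t ->
  continuous (fun s => polar f (rho s) (theta s)) t.
Proof.
  intros Hf Hr Ht. unfold polar.
  apply (bipoly_continuous f Hf (fun s => rho s * cos (theta s)) (fun s => - (rho s * sin (theta s)))).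
  - apply continuous_Rmult; [exact Hr |].
    apply (continuous_comp theta cos); [exact Ht | apply continuous_cos].
  - apply (continuous_opp (V := R_NormedModule)). apply continuous_Rmult; [exact Hr |].
    apply (continuous_comp theta sin); [exact Ht | apply continuous_sin].
Qed.

Lemma radial_field_lip X1 X2 W W1 W2 r1 r2 c1 c2 om s :
  annulus X1 X2 W W1 W2 r1 r2 c1 c2 om s ->
  unif_lip (fun _ _ => True) (radial_field X1 X2 r1 r2).
Proof.
  intros An. open_annulus An.
  assert (Hcl := unif_lip_clamp (fun (_ : R) _ => True) r1 r2 Hr1 Hr2).
  assert (H1 := unif_lip_polar (fun (_ : R) _ => True) X1 _ (fun p => p) HX1 Hcl).
  assert (H2 := unif_lip_polar (fun (_ : R) _ => True) X2 _ (fun p => p) HX2 Hcl).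
  assert (Hcos : unif_lip (fun (_ : R) _ => True) (fun p _ => cos p))
    by (apply (unif_lip_const _ _ 1); intros; apply Rabs_cos_le).
  assert (Hsin : unif_lip (fun (_ : R) _ => True) (fun p _ => sin p))
    by (apply (unif_lip_const _ _ 1); intros; apply Rabs_sin_le).
  assert (Hi : unif_lip (fun (_ : R) _ => True) (fun p x => / clamp r1 r2 x)).
  { apply (unif_lip_inv _ (fun p x => clamp r1 r2 x) r1); auto.
    intros p x _. apply clamp_bounds; lra. }
  assert (Ha : unif_lip (fun (_ : R) _ => True) (fun p x => / ang_speed X1 X2 (clamp r1 r2 x) p)).
  { apply (unif_lip_inv _ (fun p x => ang_speed X1 X2 (clamp r1 r2 x) p) om); [assumption | |].
    - intros p x _. apply Hrot, clamp_bounds. lra.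
    - unfold ang_speed. unif_lip_auto. }
  unfold radial_field, rad_speed. unif_lip_auto.
Qed.

Lemma ang_speed_continuous (X1 X2 : R -> R -> R) (rho theta : R -> R) (t : R) :
  bipoly X1 -> bipoly X2 -> rho t <> 0 -> continuous rho t -> continuous theta t ->
  continuous (fun s => ang_speed X1 X2 (rho s) (theta s)) t.
Proof.
  intros H1 H2 Hr Hrho Hth.
  pose proof (polar_continuous X1 rho theta t H1 Hrho Hth).
  pose proof (polar_continuous X2 rho theta t H2 Hrho Hth).
  assert (continuous (fun s => cos (theta s)) t)
    by (apply (continuous_comp theta cos); [exact Hth | apply continuous_cos]).
  assert (continuous (fun s => sin (theta s)) t)
    by (apply (continuous_comp theta sin); [exact Hth | apply continuous_sin]).
  unfold ang_speed. cont.
Qed.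

Lemma radial_field_continuous X1 X2 W W1 W2 r1 r2 c1 c2 om s :
  annulus X1 X2 W W1 W2 r1 r2 c1 c2 om s ->
  forall x, (forall t, continuous x t) ->
  forall t, continuous (fun th => radial_field X1 X2 r1 r2 th (x th)) t.
Proof.
  intros An x Hx t. open_annulus An.
  assert (Hc : continuous (fun th => clamp r1 r2 (x th)) t) by apply clamp_continuous, Hx.
  pose proof (clamp_bounds r1 r2 (x t) ltac:(lra)) as Hb.
  assert (Hi : continuous (fun th : R => th) t) by apply continuous_id.
  pose proof (polar_continuous X1 _ _ t HX1 Hc Hi). pose proof (polar_continuous X2 _ _ t HX2 Hc Hi).
  pose proof (continuous_cos t). pose proof (continuous_sin t).
  unfold radial_field. apply continuous_Rdiv.
  - pose proof (Hrot (clamp r1 r2 (x t)) t Hb). lra.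
  - unfold rad_speed. cont.
  - apply (ang_speed_continuous X1 X2 (fun th => clamp r1 r2 (x th)) (fun th => th)); auto. lra.
Qed.

Lemma polar_components (X1 X2 : R -> R -> R) (rho theta : R) : rho <> 0 ->
  polar X1 rho theta = rad_speed X1 X2 rho theta * cos theta - rho * ang_speed X1 X2 rho theta * sin theta /\
  polar X2 rho theta = - rad_speed X1 X2 rho theta * sin theta - rho * ang_speed X1 X2 rho theta * cos theta.
Proof.
  intros H. unfold rad_speed, ang_speed.
  pose proof (sin2_cos2 theta) as S. unfold Rsqr in S.
  assert (S' : sin theta * sin theta = 1 - cos theta * cos theta) by lra.
  split; field_simplify; try assumption;
    (replace (sin theta ^ 2) with (1 - cos theta ^ 2) by (simpl; lra)); field.
Qed.

Lemma cartesian_derive (rho theta : R -> R) (t dr dth : R) :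
  is_derive rho t dr -> is_derive theta t dth ->
  is_derive (fun s => rho s * cos (theta s)) t (dr * cos (theta t) - rho t * dth * sin (theta t)) /\
  is_derive (fun s => - (rho s * sin (theta s))) t (- dr * sin (theta t) - rho t * dth * cos (theta t)).
Proof.
  intros Hr Ht. split.
  - eapply is_derive_val.
    + apply (is_derive_Rmult rho (fun s => cos (theta s))); [exact Hr |].
      apply (is_derive_Rcomp cos theta); [apply is_derive_cos | exact Ht].
    + simpl. ring.
  - eapply is_derive_val.
    + apply is_derive_Ropp. apply (is_derive_Rmult rho (fun s => sin (theta s))); [exact Hr |].
      apply (is_derive_Rcomp sin theta); [apply is_derive_sin | exact Ht].
    + simpl. ring.
Qed.

(** A two-sided bound becomes the sign of one product, so that each pair of walls is a single
    function for [trapping]. *)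
Lemma bracket_iff (c1 c2 w : R) : c1 < c2 -> (0 <= (c2 - w) * (w - c1) <-> c1 <= w <= c2).
Proof. intros H. split; [intros; split; nra | intros; apply Rmult_le_pos; lra]. Qed.

Lemma bracket_iff_strict (c1 c2 w : R) : c1 < c2 -> (0 < (c2 - w) * (w - c1) <-> c1 < w < c2).
Proof. intros H. split; [intros; split; nra | intros; apply Rmult_lt_0_compat; lra]. Qed.

Lemma bracket_zero (c1 c2 w : R) : (c2 - w) * (w - c1) = 0 -> w = c1 \/ w = c2.
Proof. intros H. apply Rmult_integral in H. destruct H; [right | left]; lra. Qed.

(** Along a solution of the radial equation [dW / dtheta] is the flux divided by the angular speed.
    The factor [dth] covers both uses: the angle as time, run in either direction, and the angle of
    an orbit as a function of the true time. *)
Lemma polar_W_derive X1 X2 W W1 W2 r1 r2 c1 c2 om s (rho theta : R -> R) (t dth : R) :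
  annulus X1 X2 W W1 W2 r1 r2 c1 c2 om s -> r1 <= rho t <= r2 ->
  is_derive theta t dth ->
  is_derive rho t (rad_speed X1 X2 (rho t) (theta t) / ang_speed X1 X2 (rho t) (theta t) * dth) ->
  is_derive (fun s => polar W (rho s) (theta s)) t
    (flux X1 X2 W1 W2 (rho t) (theta t) / ang_speed X1 X2 (rho t) (theta t) * dth).
Proof.
  intros An Hr Ht Hd.
  destruct (cartesian_derive rho theta t _ _ Hd Ht) as [Ha Hb].
  eapply is_derive_val.
  - apply (ann_grad _ _ _ _ _ _ _ _ _ _ _ An _ _ t _ _ Ha Hb).
  - pose proof (ann_rot _ _ _ _ _ _ _ _ _ _ _ An (rho t) (theta t) Hr) as Hrot.
    pose proof (ann_om _ _ _ _ _ _ _ _ _ _ _ An). pose proof (ann_r1 _ _ _ _ _ _ _ _ _ _ _ An).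
    destruct (polar_components X1 X2 (rho t) (theta t)) as [E1 E2]; [lra |].
    unfold flux. rewrite E1, E2. fold (polar W1 (rho t) (theta t)). fold (polar W2 (rho t) (theta t)).
    field. lra.
Qed.

(** The angle runs in the direction [-s], hence against the flow when the flow leaves the annulus,
    so that the annulus is attracting in either case. *)
Lemma polar_trapped X1 X2 W W1 W2 r1 r2 c1 c2 om s (x : R -> R) :
  annulus X1 X2 W W1 W2 r1 r2 c1 c2 om s ->
  (forall th, is_derive x th (radial_field X1 X2 r1 r2 th (x th))) ->
  r1 <= x 0 <= r2 -> c1 <= polar W (x 0) 0 <= c2 ->
  forall t, 0 < t ->
    r1 < x (- s * t) < r2 /\ c1 < polar W (x (- s * t)) (- s * t) < c2.
Proof.
  intros An Hx Hr0 Hc0 t Ht. open_annulus An.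
  set (th := fun t => - s * t).
  assert (Hth : forall t, is_derive th t (- s)).
  { intros u. unfold th. auto_derive; [easy | ring]. }
  assert (Hthc : forall t, continuous th t) by (intros; eapply is_derive_continuous, Hth).
  assert (Hxth : forall t, continuous (fun t => x (th t)) t).
  { intros u. apply (continuous_comp th x); [apply Hthc |]. eapply is_derive_continuous, Hx. }
  set (w := fun t => polar W (x (th t)) (th t)).
  assert (Hwc : forall t, continuous w t).
  { intros u. now apply (polar_continuous W (fun t => x (th t)) th). }
  destruct (trapping (fun t => (c2 - w t) * (w t - c1)) (fun t => (r2 - x (th t)) * (x (th t) - r1))) with (t := t)
    as [HA HB]; auto.
  - intros u. specialize (Hwc u). cont.
  - intros u. specialize (Hxth u). cont.
  - intros u HA HB. apply (bracket_iff _ _ _ Hc12) in HA. apply (bracket_iff _ _ _ Hr2) in HB.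
    apply (bracket_iff_strict _ _ _ Hr2).
    (* On the two boundary circles [W] lies outside [[c1, c2]], so the radial walls cannot be
       touched while the level bounds hold. *)
    destruct HB as [[HB1|HB1] [HB2|HB2]]; try lra; exfalso.
    + pose proof (Hout (th u)). unfold w in HA. rewrite HB2 in HA. lra.
    + pose proof (Hin (th u)). unfold w in HA. rewrite <- HB1 in HA. lra.
  - intros u HA HB. apply (bracket_iff_strict _ _ _ Hr2) in HB.
    assert (Hrot' := Hrot (x (th u)) (th u) ltac:(lra)).
    set (g := flux X1 X2 W1 W2 (x (th u)) (th u) / ang_speed X1 X2 (x (th u)) (th u)).
    assert (Hw : is_derive w u (g * - s)).
    { apply (polar_W_derive X1 X2 W W1 W2 r1 r2 c1 c2 om s (fun t => x (th t)) th); auto; [lra |].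
      eapply is_derive_val.
      - apply (is_derive_Rcomp x th); [apply Hx | apply Hth].
      - simpl. unfold radial_field. rewrite clamp_id by lra. reflexivity. }
    (* At the level [c1] or [c2] one of the two summands vanishes, and the flux condition gives the
       other its sign. *)
    exists ((0 - g * - s) * (w u - c1) + (c2 - w u) * (g * - s - 0)). split.
    + assert (Hsg : forall y, 0 < s * y -> 0 < s * (y / ang_speed X1 X2 (x (th u)) (th u))).
      { intros y Hy. unfold Rdiv. rewrite <- Rmult_assoc. apply Rmult_lt_0_compat; [exact Hy |].
        apply Rinv_0_lt_compat. lra. }
      apply bracket_zero in HA. destruct HA as [HA|HA].
      * pose proof (Hfl1 _ _ (conj (Rlt_le _ _ (proj1 HB)) (Rlt_le _ _ (proj2 HB))) HA) as Hf.
        assert (0 < s * ((- flux X1 X2 W1 W2 (x (th u)) (th u)) / ang_speed X1 X2 (x (th u)) (th u)))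
          by (apply Hsg; lra).
        rewrite HA. unfold g. unfold Rdiv in *. nra.
      * pose proof (Hfl2 _ _ (conj (Rlt_le _ _ (proj1 HB)) (Rlt_le _ _ (proj2 HB))) HA) as Hf.
        assert (0 < s * (flux X1 X2 W1 W2 (x (th u)) (th u) / ang_speed X1 X2 (x (th u)) (th u)))
          by (apply Hsg; lra).
        rewrite HA. unfold g. unfold Rdiv in *. nra.
    + apply (is_derive_Rmult (fun t => c2 - w t) (fun t => w t - c1)).
      * apply is_derive_Rminus; [apply @is_derive_const | exact Hw].
      * apply is_derive_Rminus; [exact Hw | apply @is_derive_const].
  - simpl. apply (bracket_iff _ _ _ Hc12). unfold w, th. now rewrite Rmult_0_r.
  - simpl. apply (bracket_iff _ _ _ Hr2). unfold th. now rewrite Rmult_0_r.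
  - apply (bracket_iff_strict _ _ _ Hc12) in HA. apply (bracket_iff_strict _ _ _ Hr2) in HB. auto.
Qed.

Lemma intermediate_value (f : R -> R) (a b y : R) :
  (forall t, continuous f t) -> a <= b -> f a <= y <= f b -> exists c, a <= c <= b /\ f c = y.
Proof.
  intros Hc Hab Hy. destruct (IVT_gen f a b y) as [c [Hc1 Hc2]].
  - intros t. apply continuity_pt_filterlim, Hc.
  - rewrite Rmin_left, Rmax_right; lra.
  - rewrite Rmin_left, Rmax_right in Hc1 by lra. exists c. auto.
Qed.

Lemma unif_lip_elim {P : Type} (f : P -> R -> R) :
  unif_lip (fun _ _ => True) f ->
  exists L, 0 < L /\ (forall p x, Rabs (f p x) <= L) /\
    forall p x y, Rabs (f p x - f p y) <= L * Rabs (x - y).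
Proof.
  intros [M HM]. exists (Rmax M 1).
  pose proof (Rmax_l M 1). pose proof (Rmax_r M 1).
  split; [lra | split].
  - intros p x. destruct (HM p x x I I). lra.
  - intros p x y. destruct (HM p x y I I) as [_ E]. eapply Rle_trans; [exact E |].
    apply Rmult_le_compat_r; [apply Rabs_pos | lra].
Qed.

Lemma sincos_turn (theta : R) (s : R) : s = 1 \/ s = -1 ->
  cos (theta + - s * (2 * PI)) = cos theta /\ sin (theta + - s * (2 * PI)) = sin theta.
Proof.
  intros [-> | ->].
  - replace (theta + - (1) * (2 * PI)) with (theta - 2 * PI) by ring.
    rewrite cos_minus, sin_minus, cos_2PI, sin_2PI. split; ring.
  - replace (theta + - (-1) * (2 * PI)) with (theta + 2 * PI) by ring.
    rewrite cos_plus, sin_plus, cos_2PI, sin_2PI. split; ring.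
Qed.

Lemma polar_turn (f : R -> R -> R) (rho theta : R) (s : R) : s = 1 \/ s = -1 ->
  polar f rho (theta + - s * (2 * PI)) = polar f rho theta.
Proof. intros Hs. unfold polar. now destruct (sincos_turn theta s Hs) as [-> ->]. Qed.

Lemma radial_field_turn (X1 X2 : R -> R -> R) (r1 r2 theta x s : R) : s = 1 \/ s = -1 ->
  radial_field X1 X2 r1 r2 (theta + - s * (2 * PI)) x = radial_field X1 X2 r1 r2 theta x.
Proof.
  intros Hs. unfold radial_field, rad_speed, ang_speed.
  destruct (sincos_turn theta s Hs) as [-> ->]. now rewrite !polar_turn.
Qed.

(** The return map [Pm] takes the segment of radii between the two levels at angle 0 strictly into
    itself, so [x - Pm x] changes sign on it; its zero gives a closed graph over the circle. *)
Lemma periodic_graph X1 X2 W W1 W2 r1 r2 c1 c2 om s :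
  annulus X1 X2 W W1 W2 r1 r2 c1 c2 om s ->
  exists rho : R -> R,
    (forall th, r1 < rho th < r2 /\ c1 < polar W (rho th) th < c2) /\
    (forall th, rho (th + 2 * PI) = rho th) /\
    (forall th, is_derive rho th (rad_speed X1 X2 (rho th) th / ang_speed X1 X2 (rho th) th)).
Proof.
  intros An. open_annulus An.
  destruct (unif_lip_elim _ (radial_field_lip _ _ _ _ _ _ _ _ _ _ _ An)) as [L [HL [Hbd Hlip]]].
  assert (Hode : forall x0, exists x, x 0 = x0 /\
     forall t, is_derive x t (radial_field X1 X2 r1 r2 t (x t))).
  { intros x0. apply (ode_exists (radial_field X1 X2 r1 r2) L L); auto.
    exact (radial_field_continuous _ _ _ _ _ _ _ _ _ _ _ An). }
  destruct (functional_choice _ Hode) as [sol Hsol].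
  set (sg := - s * (2 * PI)). pose proof PI_RGT_0 as HPI.
  set (Pm := fun x0 => sol x0 sg).
  assert (Hsg : Rabs sg = 2 * PI).
  { unfold sg. destruct Hs as [-> | ->]; [rewrite Rabs_left | rewrite Rabs_right]; lra. }
  assert (HPc : forall x0, continuous (fun x => x - Pm x) x0).
  { intros x0. apply (continuous_minus (fun x => x) Pm); [apply continuous_id |].
    apply continuity_pt_filterlim. intros e He.
    set (K := exp (L * (2 * PI))). assert (HK : 0 < K) by apply exp_pos.
    exists (e / K). split; [apply Rdiv_lt_0_compat; lra |].
    intros y [_ Hy]. simpl in *. unfold R_dist in *. unfold Pm.
    eapply Rle_lt_trans;
      [apply (ode_dependence (radial_field X1 X2 r1 r2) L (sol y) (sol x0)); auto; apply Hsol |].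
    rewrite (proj1 (Hsol y)), (proj1 (Hsol x0)), Hsg. fold K.
    apply (Rmult_lt_compat_r K) in Hy; [| exact HK].
    replace (e / K * K) with e in Hy by (field; lra). exact Hy. }
  assert (HWc : forall t, continuous (fun x => polar W x 0) t).
  { intros t. apply (polar_continuous W (fun x => x) (fun _ => 0)); auto.
    apply continuous_id. apply continuous_const. }
  destruct (intermediate_value (fun x => polar W x 0) r1 r2 c1 HWc) as [x1 [Hx1 Ex1]];
    [lra | pose proof (Hin 0); pose proof (Hout 0); lra |].
  destruct (intermediate_value (fun x => polar W x 0) r1 r2 c2 HWc) as [x2 [Hx2 Ex2]];
    [lra | pose proof (Hin 0); pose proof (Hout 0); lra |].
  assert (Hx12 : x1 < x2).
  { destruct (Rlt_dec x1 x2); [assumption |]. destruct (Req_dec x1 x2) as [E|E].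
    - rewrite E in Ex1. lra.
    - pose proof (Hrad x2 x1 0 ltac:(lra) ltac:(lra) ltac:(lra)). lra. }
  assert (Htr : forall x0, x1 <= x0 <= x2 -> forall t, 0 < t ->
    r1 < sol x0 (- s * t) < r2 /\ c1 < polar W (sol x0 (- s * t)) (- s * t) < c2).
  { intros x0 Hx0. apply (polar_trapped _ _ _ _ _ _ _ _ _ _ _ _ An).
    - apply Hsol.
    - rewrite (proj1 (Hsol x0)). lra.
    - rewrite (proj1 (Hsol x0)). split.
      + destruct (Req_dec x1 x0) as [<-|]; [lra |]. rewrite <- Ex1. apply Rlt_le, Hrad; lra.
      + destruct (Req_dec x2 x0) as [<-|]; [lra |]. rewrite <- Ex2. apply Rlt_le, Hrad; lra. }
  assert (Hturn : forall x0, x1 <= x0 <= x2 -> r1 < Pm x0 < r2 /\ c1 < polar W (Pm x0) 0 < c2).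
  { intros x0 Hx0. destruct (Htr x0 Hx0 (2 * PI) ltac:(lra)) as [A B]. split; [exact A |].
    rewrite <- (polar_turn W (Pm x0) 0 s Hs), Rplus_0_l. exact B. }
  destruct (intermediate_value (fun x => x - Pm x) x1 x2 0 HPc) as [x0 [Hx0 Ex0]]; [lra | |].
  { split.
    - destruct (Hturn x1 ltac:(lra)) as [A B]. destruct (Rle_dec x1 (Pm x1)); [lra |].
      pose proof (Hrad (Pm x1) x1 0 ltac:(lra) ltac:(lra) ltac:(lra)). lra.
    - destruct (Hturn x2 ltac:(lra)) as [A B]. destruct (Rle_dec (Pm x2) x2); [lra |].
      pose proof (Hrad x2 (Pm x2) 0 ltac:(lra) ltac:(lra) ltac:(lra)). lra. }
  set (rho := sol x0). destruct (Hsol x0) as [Hrho0 Hrhod]. fold rho in Hrho0, Hrhod.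
  (* The graph shifted by one turn solves the same equation, with the same initial value by the
     choice of [x0]. *)
  assert (Hper : forall th, rho (th + sg) = rho th).
  { intros th. apply cond_eq. intros e He. eapply Rle_lt_trans; [| exact He].
    eapply Rle_trans;
      [apply (ode_dependence (radial_field X1 X2 r1 r2) L (fun th => rho (th + sg)) rho); auto |].
    - intros t. eapply is_derive_val.
      + apply (is_derive_Rcomp rho (fun th => th + sg)); [apply Hrhod |].
        apply is_derive_Rplus; [apply @is_derive_id | apply @is_derive_const].
      + unfold one, zero; simpl. unfold sg. rewrite radial_field_turn by exact Hs. ring.
    - simpl. rewrite Rplus_0_l, Hrho0. fold (Pm x0) in *.
      replace (rho sg - x0) with 0; [rewrite Rabs_R0; lra |].
      unfold Pm in Ex0. fold rho in Ex0. lra. }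
  assert (Hpern : forall n th, rho (th + INR n * sg) = rho th).
  { induction n; intros th.
    - simpl. f_equal. ring.
    - rewrite S_INR. replace (th + (INR n + 1) * sg) with ((th + INR n * sg) + sg) by ring.
      now rewrite Hper. }
  assert (Hpol : forall n th x, polar W x (th + INR n * sg) = polar W x th).
  { induction n; intros th x.
    - simpl. f_equal. ring.
    - rewrite S_INR. replace (th + (INR n + 1) * sg) with ((th + INR n * sg) + sg) by ring.
      unfold sg at 2. now rewrite polar_turn. }
  (* Trapping holds only ahead of the starting angle in the direction [-s]; a shift by [n] whole
     turns brings any angle there. *)
  assert (Hall : forall th, r1 < rho th < r2 /\ c1 < polar W (rho th) th < c2).
  { intros th. destruct (INR_unbounded (s * th)) as [n Hn].
    specialize (Htr x0 ltac:(lra) (- s * (th + INR n * sg))). fold rho in Htr.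
    assert (Ht : - s * (th + INR n * sg) = - (s * th) + INR n * (2 * PI) /\
             - s * (- s * (th + INR n * sg)) = th + INR n * sg).
    { unfold sg. destruct Hs as [-> | ->]; split; ring. }
    destruct Ht as [Ht1 Ht2]. rewrite Ht2, Hpern, Hpol in Htr. apply Htr.
    rewrite Ht1. pose proof (pos_INR n). pose proof PI2_1. unfold PI2 in *.
    assert (INR n * 1 <= INR n * (2 * PI)) by (apply Rmult_le_compat_l; lra). lra. }
  exists rho. split; [exact Hall | split].
  - intros th. destruct Hs as [-> | ->].
    + rewrite <- (Hper (th + 2 * PI)). f_equal. unfold sg. ring.
    + rewrite <- (Hper th). f_equal. unfold sg. ring.
  - intros th. eapply is_derive_val; [apply Hrhod |]. unfold radial_field.
    destruct (Hall th). rewrite clamp_id by lra. reflexivity.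
Qed.

(** * From the closed graph to a periodic orbit *)

Lemma unif_lip_of_derive (f f' : R -> R) (M : R) :
  (forall t, is_derive f t (f' t)) -> (forall t, Rabs (f t) <= M) ->
  (forall t, Rabs (f' t) <= M) -> unif_lip (fun (_ : unit) _ => True) (fun _ x => f x).
Proof.
  intros Hd Hf Hf'. exists M. intros _ x y _ _. split; [apply Hf |].
  destruct (MVT_gen f y x f') as [c [_ E]].
  - intros t _. apply Hd.
  - intros t _. apply continuity_pt_filterlim. eapply is_derive_continuous, Hd.
  - rewrite E, Rabs_mult. apply Rmult_le_compat_r; [apply Rabs_pos | apply Hf'].
Qed.

Lemma polar_2PI (f : R -> R -> R) (rho theta : R) :
  polar f rho (theta + 2 * PI) = polar f rho theta.
Proof.
  replace (theta + 2 * PI) with (theta + - (-1) * (2 * PI)) by ring.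
  apply polar_turn. now right.
Qed.

Lemma ang_speed_2PI (X1 X2 : R -> R -> R) (rho theta : R) :
  ang_speed X1 X2 rho (theta + 2 * PI) = ang_speed X1 X2 rho theta.
Proof.
  unfold ang_speed. rewrite !polar_2PI.
  replace (theta + 2 * PI) with (theta + - (-1) * (2 * PI)) by ring.
  destruct (sincos_turn theta (-1) (or_intror eq_refl)) as [-> ->]. reflexivity.
Qed.

Definition graph_curve (rho : R -> R) (a b : R) : Prop :=
  exists th, a = rho th * cos th /\ b = - (rho th * sin th).

Lemma surjective_of_speed (theta theta' : R -> R) (om : R) :
  0 < om -> theta 0 = 0 -> (forall t, is_derive theta t (theta' t)) ->
  (forall t, om <= theta' t) ->
  (forall t, 0 <= t -> om * t <= theta t) /\ (forall t, t <= 0 -> theta t <= om * t) /\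
  forall y, exists t, theta t = y.
Proof.
  intros Hom H0 Hd Hp.
  assert (Hmon : forall a b, a <= b -> theta a - om * a <= theta b - om * b).
  { intros a b Hab. apply (nondecreasing_of_derive (fun t => theta t - om * t) (fun t => theta' t - om)); auto.
    - intros t _. apply is_derive_Rminus; [apply Hd |]. auto_derive; [easy | ring].
    - intros t _. specialize (Hp t). lra. }
  assert (H1 : forall t, 0 <= t -> om * t <= theta t).
  { intros t Ht. specialize (Hmon 0 t Ht). lra. }
  assert (H2 : forall t, t <= 0 -> theta t <= om * t).
  { intros t Ht. specialize (Hmon t 0 Ht). lra. }
  repeat split; auto. intros y.
  assert (0 <= Rabs y / om) by (apply Rdiv_le_0_compat; [apply Rabs_pos | lra]).
  assert (om * (Rabs y / om) = Rabs y) by (field; lra).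
  destruct (intermediate_value theta (- (Rabs y / om)) (Rabs y / om) y) as [t [_ Ht]].
  - intros t. eapply is_derive_continuous, Hd.
  - lra.
  - specialize (H1 _ H). specialize (H2 (- (Rabs y / om)) ltac:(lra)).
    pose proof (Rle_abs y). pose proof (Rle_abs (- y)) as Hy. rewrite Rabs_Ropp in Hy. lra.
  - now exists t.
Qed.

(** The time law along the graph is a scalar autonomous equation for the angle. Its speed is at
    least [om], so the angle reaches [2 PI], and the time when it does is the period. *)
Lemma graph_periodic_orbit X1 X2 W W1 W2 r1 r2 c1 c2 om s (rho : R -> R) :
  annulus X1 X2 W W1 W2 r1 r2 c1 c2 om s ->
  (forall th, r1 < rho th < r2) ->
  (forall th, rho (th + 2 * PI) = rho th) ->
  (forall th, is_derive rho th (rad_speed X1 X2 (rho th) th / ang_speed X1 X2 (rho th) th)) ->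
  periodic_orbit X1 X2 (graph_curve rho).
Proof.
  intros An Hr Hper Hd.
  open_annulus An.
  assert (Hpos : forall th, 0 < rho th) by (intros th; specialize (Hr th); lra).
  assert (Hang : forall th, om <= ang_speed X1 X2 (rho th) th)
    by (intros th; apply Hrot; specialize (Hr th); lra).
  assert (Hrc : forall t, continuous rho t) by (intros; eapply is_derive_continuous, Hd).
  destruct (unif_lip_elim _ (radial_field_lip _ _ _ _ _ _ _ _ _ _ _ An)) as [L0 [HL0 [Hbd0 _]]].
  (* The unknown is now the angle, which also enters through [rho]; so [rho], [cos] and [sin] need
     Lipschitz bounds in the angle. *)
  assert (Urho : unif_lip (fun (_ : unit) _ => True) (fun _ x => rho x)).
  { apply (unif_lip_of_derive rho _ (Rmax r2 L0) Hd); intros t.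
    - specialize (Hr t). rewrite Rabs_right by lra. eapply Rle_trans; [| apply Rmax_l]. lra.
    - specialize (Hbd0 t (rho t)). unfold radial_field in Hbd0.
      rewrite clamp_id in Hbd0 by (specialize (Hr t); lra).
      eapply Rle_trans; [exact Hbd0 | apply Rmax_r]. }
  assert (Ucos : unif_lip (fun (_ : unit) _ => True) (fun _ x => cos x)).
  { apply (unif_lip_of_derive cos (fun x => - sin x) 1).
    - intros; apply is_derive_cos.
    - apply Rabs_cos_le.
    - intros; rewrite Rabs_Ropp; apply Rabs_sin_le. }
  assert (Usin : unif_lip (fun (_ : unit) _ => True) (fun _ x => sin x)).
  { apply (unif_lip_of_derive sin cos 1).
    - intros; apply is_derive_sin.
    - apply Rabs_sin_le.
    - apply Rabs_cos_le. }
  assert (Upol : forall f, bipoly f -> unif_lip (fun (_ : unit) _ => True) (fun _ x => polar f (rho x) x)).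
  { intros f Hf. apply (bipoly_unif_lip f Hf _ (fun _ x => rho x * cos x) (fun _ x => - (rho x * sin x))).
    - exact (unif_lip_mult _ _ _ Urho Ucos).
    - exact (unif_lip_opp _ _ (unif_lip_mult _ _ _ Urho Usin)). }
  assert (Uang : unif_lip (fun (_ : unit) _ => True) (fun _ x => ang_speed X1 X2 (rho x) x)).
  { pose proof (Upol X1 HX1). pose proof (Upol X2 HX2).
    assert (unif_lip (fun (_ : unit) _ => True) (fun _ x => / rho x)).
    { apply (unif_lip_inv _ (fun _ x => rho x) r1 Hr1); [| exact Urho].
      intros _ x _. specialize (Hr x). lra. }
    unfold ang_speed. unif_lip_auto. }
  destruct (unif_lip_elim _ Uang) as [L [HL [Hbd Hlip]]].
  destruct (ode_exists (fun _ x => ang_speed X1 X2 (rho x) x) L L 0) as [th [Hth0 Hthd]]; auto.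
  { intros _. apply (Hlip tt). }
  { intros x Hx t. apply (ang_speed_continuous X1 X2 (fun s => rho (x s)) x); auto.
    - specialize (Hpos (x t)). lra.
    - now apply (continuous_comp x rho). }
  { intros _. apply (Hbd tt). }
  destruct (surjective_of_speed th (fun t => ang_speed X1 X2 (rho (th t)) (th t)) om Hom Hth0 Hthd) as [Hge [Hle Hsurj]].
  { intros t. apply Hang. }
  destruct (Hsurj (2 * PI)) as [T HT]. pose proof PI_RGT_0 as HPI.
  assert (HTpos : 0 < T).
  { destruct (Rlt_dec 0 T); [assumption |]. specialize (Hle T ltac:(lra)).
    assert (om * T <= 0) by nra. lra. }
  (* [th (t + T) - 2 PI] and [th] solve the same [2 PI]-periodic equation and agree at time 0. *)
  assert (Hthper : forall t, th (t + T) = th t + 2 * PI).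
  { intros t. apply cond_eq. intros e He. eapply Rle_lt_trans; [| exact He].
    replace (th (t + T) - (th t + 2 * PI)) with ((th (t + T) - 2 * PI) - th t) by ring.
    eapply Rle_trans.
    - apply (ode_dependence (fun _ x => ang_speed X1 X2 (rho x) x) L (fun t => th (t + T) - 2 * PI) th); auto.
      + intros _. apply (Hlip tt).
      + intros u. eapply is_derive_val.
        * apply is_derive_Rminus; [| apply @is_derive_const].
          apply (is_derive_Rcomp th (fun t => t + T)); [apply Hthd |].
          apply is_derive_Rplus; [apply @is_derive_id | apply @is_derive_const].
        * unfold one, zero; simpl.
          replace (rho (th (u + T) - 2 * PI)) with (rho (th (u + T)))
            by (rewrite <- (Hper (th (u + T) - 2 * PI)); f_equal; ring).
          rewrite <- (ang_speed_2PI X1 X2 _ (th (u + T) - 2 * PI)).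
          replace (th (u + T) - 2 * PI + 2 * PI) with (th (u + T)) by ring. ring.
    - simpl. rewrite Rplus_0_l, HT, Hth0. replace (2 * PI - 2 * PI - 0) with 0 by ring.
      rewrite Rabs_R0. lra. }
  exists (fun t => rho (th t) * cos (th t)), (fun t => - (rho (th t) * sin (th t))), T.
  split; [| split; [exact HTpos | split; [| split]]].
  - intros t. pose proof (Hang (th t)) as Ha.
    assert (Hrt : is_derive (fun s => rho (th s)) t (rad_speed X1 X2 (rho (th t)) (th t))).
    { eapply is_derive_val; [apply (is_derive_Rcomp rho th); [apply Hd | apply Hthd] |]. simpl. field. lra. }
    destruct (cartesian_derive (fun s => rho (th s)) th t _ _ Hrt (Hthd t)) as [Da Db].
    destruct (polar_components X1 X2 (rho (th t)) (th t)) as [E1 E2]; [specialize (Hpos (th t)); lra |].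
    unfold polar in E1, E2. rewrite E1, E2. split; eapply is_derive_val; eauto; ring.
  - intros t. rewrite Hthper, Hper.
    replace (th t + 2 * PI) with (th t + - (-1) * (2 * PI)) by ring.
    destruct (sincos_turn (th t) (-1) (or_intror eq_refl)) as [-> ->]. auto.
  - destruct (Hsurj PI) as [t2 Ht2]. exists 0, t2. intros E. injection E as E _.
    rewrite Hth0, Ht2, cos_0, cos_PI in E. pose proof (Hpos 0). pose proof (Hpos PI). lra.
  - intros a b. split.
    + intros [y [-> ->]]. destruct (Hsurj y) as [t <-]. now exists t.
    + intros [t [-> ->]]. now exists (th t).
Qed.

(** * Isolation of the periodic orbit *)

Lemma polar_coordinates (a b : R) : 0 < a ^ 2 + b ^ 2 ->
  exists rho th, 0 < rho /\ rho ^ 2 = a ^ 2 + b ^ 2 /\ a = rho * cos th /\ b = - (rho * sin th).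
Proof.
  intros H. set (rho := sqrt (a ^ 2 + b ^ 2)).
  assert (Hr : 0 < rho) by now apply sqrt_lt_R0.
  assert (Hr2 : rho ^ 2 = a ^ 2 + b ^ 2) by (apply pow2_sqrt; lra).
  assert (Hc : -1 <= a / rho <= 1).
  { assert (Ea : a = a / rho * rho) by (field; lra). set (q := a / rho) in *.
    assert (q ^ 2 <= 1).
    { apply (Rmult_le_reg_r (rho ^ 2)); [nra |].
      replace (q ^ 2 * rho ^ 2) with (a ^ 2) by (rewrite Ea; ring).
      pose proof (pow2_ge_0 b). lra. }
    split; nra. }
  assert (Hs : rho * sin (acos (a / rho)) = Rabs b).
  { rewrite sin_acos by exact Hc. rewrite <- (sqrt_pow2 rho) at 1 by lra.
    rewrite <- sqrt_mult_alt by nra. rewrite <- sqrt_Rsqr_abs. f_equal.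
    unfold Rsqr. replace (rho ^ 2 * (1 - a / rho * (a / rho))) with (rho ^ 2 - a ^ 2) by (field; lra).
    rewrite Hr2. ring. }
  destruct (Rle_dec b 0) as [Hb|Hb].
  - exists rho, (acos (a / rho)). repeat split; auto.
    + rewrite cos_acos by exact Hc. field. lra.
    + rewrite Hs, Rabs_left1 by exact Hb. ring.
  - exists rho, (- acos (a / rho)). repeat split; auto.
    + rewrite cos_neg, cos_acos by exact Hc. field. lra.
    + rewrite sin_neg. replace (- (rho * - sin (acos (a / rho)))) with (rho * sin (acos (a / rho))) by ring.
      rewrite Hs, Rabs_right; lra.
Qed.

Lemma periodic_nat (f : R -> R) (T : R) :
  (forall t, f (t + T) = f t) -> forall n t, f (t + INR n * T) = f t.
Proof.
  intros H. induction n; intros t.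
  - simpl. f_equal. ring.
  - rewrite S_INR. replace (t + (INR n + 1) * T) with ((t + INR n * T) + T) by ring.
    now rewrite H.
Qed.

Lemma periodic_same_angle (f : R -> R) (a b : R) :
  (forall t, f (t + 2 * PI) = f t) -> cos a = cos b -> sin a = sin b -> f a = f b.
Proof.
  intros Hf Hc Hs.
  assert (H0 : sin ((a - b) / 2) = 0).
  { assert (E : cos (a - b) = 1).
    { rewrite cos_minus, Hc, Hs. pose proof (sin2_cos2 b). unfold Rsqr in H. lra. }
    replace (a - b) with (2 * ((a - b) / 2)) in E by field.
    rewrite cos_2a_sin in E. nra. }
  destruct (sin_eq_0_0 _ H0) as [k Hk].
  assert (Ea : a = b + IZR k * (2 * PI)) by lra.
  destruct (Z_le_gt_dec 0 k).
  - rewrite Ea, <- (Z2Nat.id k) by assumption. rewrite <- INR_IZR_INZ. now apply periodic_nat.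
  - assert (Eb : b = a + IZR (- k) * (2 * PI)) by (rewrite opp_IZR; lra).
    rewrite Eb, <- (Z2Nat.id (- k)) by lia. rewrite <- INR_IZR_INZ. symmetry. now apply periodic_nat.
Qed.

(** Increments in two variables reduce to the one-variable notion by restricting [f] to segments
    [x -> (a + x d1, b + x d2)]; dividing the displacement by [e] keeps the directions in the unit
    box, and [x = 0] is compared with [x = e]. *)
Lemma bipoly_local_lip (f : R -> R -> R) (K : R) : bipoly f ->
  exists M, 0 < M /\ forall e a b a' b', 0 < e <= 1 -> Rabs a <= K -> Rabs b <= K ->
    Rabs (a - a') <= e -> Rabs (b - b') <= e -> Rabs (f a b - f a' b') <= M * e.
Proof.
  intros Hf.
  set (D := fun (p : R * R * R * R) (x : R) => let '(a, b, d1, d2) := p in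
     Rabs a <= K /\ Rabs b <= K /\ Rabs d1 <= 1 /\ Rabs d2 <= 1 /\ Rabs x <= 1).
  assert (U : unif_lip D (fun p x => f (fst (fst (fst p)) + x * snd (fst p)) (snd (fst (fst p)) + x * snd p))).
  { assert (Ux : unif_lip D (fun _ x => x)).
    { exists 1. intros p x y Hx Hy. destruct p as [[[? ?] ?] ?]. split; [apply Hx | lra]. }
    assert (unif_lip D (fun p _ => fst (fst (fst p))) /\ unif_lip D (fun p _ => snd (fst (fst p)))) as [].
    { split; apply (unif_lip_const D _ K); intros [[[? ?] ?] ?] x Hx; apply Hx. }
    assert (unif_lip D (fun p _ => snd (fst p)) /\ unif_lip D (fun p _ => snd p)) as [].
    { split; apply (unif_lip_const D _ 1); intros [[[? ?] ?] ?] x Hx; apply Hx. }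
    apply (bipoly_unif_lip f Hf); unif_lip_auto. }
  destruct U as [M HM]. exists (Rmax M 1). pose proof (Rmax_l M 1). pose proof (Rmax_r M 1).
  split; [lra |]. intros e a b a' b' He Ha Hb Hda Hdb.
  assert (Hdiv : forall z, Rabs z <= e -> Rabs (z / e) <= 1).
  { intros z Hz. unfold Rdiv. rewrite Rabs_mult, Rabs_inv, (Rabs_right e) by lra.
    apply (Rmult_le_reg_r e); [lra |]. rewrite Rmult_assoc, Rinv_l by lra. lra. }
  assert (HD0 : forall x, Rabs x <= 1 -> D (a, b, (a' - a) / e, (b' - b) / e) x).
  { intros x Hx. repeat split; auto; apply Hdiv; rewrite Rabs_minus_sym; auto. }
  destruct (HM (a, b, (a' - a) / e, (b' - b) / e) 0 e) as [_ E].
  - apply HD0. rewrite Rabs_R0. lra.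
  - apply HD0. rewrite Rabs_right; lra.
  - simpl in E. replace (a + 0 * ((a' - a) / e)) with a in E by ring.
    replace (b + 0 * ((b' - b) / e)) with b in E by ring.
    replace (a + e * ((a' - a) / e)) with a' in E by (field; lra).
    replace (b + e * ((b' - b) / e)) with b' in E by (field; lra).
    eapply Rle_trans; [exact E |]. rewrite Rabs_minus_sym, Rminus_0_r, (Rabs_right e) by lra.
    apply Rmult_le_compat_r; lra.
Qed.

(** Supplies the isolation radius of a limit cycle: by compactness of the circle [f] has a positive
    minimum on the curve, and a Lipschitz bound keeps it positive nearby. *)
Lemma graph_positive_neighbourhood (f : R -> R -> R) (rho : R -> R) (K : R) :
  bipoly f -> (forall t, continuous rho t) -> (forall th, rho (th + 2 * PI) = rho th) ->
  (forall th, Rabs (rho th) <= K) -> (forall th, 0 < polar f (rho th) th) ->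
  exists e0, 0 < e0 /\ forall e a b a' b', 0 < e <= e0 -> graph_curve rho a b ->
    (a - a') ^ 2 + (b - b') ^ 2 < e ^ 2 -> 0 < f a' b'.
Proof.
  intros Hf Hc Hper HK Hpos. pose proof PI_RGT_0 as HPI.
  destruct (continuity_ab_min (fun th => polar f (rho th) th) 0 (2 * PI)) as [m [Hm _]]; [lra | |].
  { intros t _. apply continuity_pt_filterlim.
    apply (polar_continuous f rho (fun t => t)); auto. apply continuous_id. }
  set (mu := polar f (rho m) m). assert (Hmu : 0 < mu) by apply Hpos.
  assert (Hall : forall th, mu <= polar f (rho th) th).
  { assert (Hp : forall t, polar f (rho (t + 2 * PI)) (t + 2 * PI) = polar f (rho t) t).
    { intros t. now rewrite Hper, polar_2PI. }
    assert (Hred : forall th, exists th', 0 <= th' <= 2 * PI /\ cos th' = cos th /\ sin th' = sin th).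
    { intros th. destruct (base_Int_part (th / (2 * PI))) as [H1 H2].
      set (k := IZR (Int_part (th / (2 * PI)))) in *. set (q := th / (2 * PI)) in *.
      assert (Eq : th = q * (2 * PI)) by (unfold q; field; lra).
      exists (th - k * (2 * PI)). split; [split; nra |].
      assert (cos (k * (2 * PI)) = 1 /\ sin (k * (2 * PI)) = 0) as [Ec Es].
      { replace (k * (2 * PI)) with (2 * (k * PI)) by ring.
        assert (sin (k * PI) = 0) by (apply sin_eq_0_1; now exists (Int_part q)).
        rewrite cos_2a_sin, sin_2a, H. split; ring. }
      rewrite cos_minus, sin_minus, Ec, Es. split; ring. }
    intros th. destruct (Hred th) as [th' [Hth' [Ec Es]]].
    rewrite <- (periodic_same_angle (fun th => polar f (rho th) th) th' th Hp Ec Es).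
    now apply Hm. }
  destruct (bipoly_local_lip f K Hf) as [M [HM HL]].
  (* Within this distance [f] drops by at most half of its minimum [mu] on the curve. *)
  exists (Rmin 1 (mu / (2 * M))).
  assert (0 < mu / (2 * M)) by (apply Rdiv_lt_0_compat; lra).
  split; [apply Rmin_glb_lt; lra |].
  intros e a b a' b' He [th [Ea Eb]] Hd.
  pose proof (Rmin_l 1 (mu / (2 * M))). pose proof (Rmin_r 1 (mu / (2 * M))).
  assert (Hab : forall x y, x ^ 2 + y ^ 2 < e ^ 2 -> Rabs x <= e).
  { intros x y Hxy. apply Rabs_le. split; nra. }
  assert (HKa : forall c, Rabs c <= 1 -> Rabs (rho th * c) <= K).
  { intros c Hc1. rewrite Rabs_mult. specialize (HK th). pose proof (Rabs_pos (rho th)).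
    pose proof (Rabs_pos c). nra. }
  specialize (HL e a b a' b' ltac:(lra)). specialize (Hall th). unfold polar in Hall.
  rewrite <- Ea, <- Eb in Hall.
  assert (Rabs (f a b - f a' b') <= M * e).
  { apply HL.
    - rewrite Ea. apply HKa, Rabs_cos_le.
    - rewrite Eb, Rabs_Ropp. apply HKa, Rabs_sin_le.
    - apply (Hab _ _ Hd).
    - apply (Hab (b - b') (a - a')). lra. }
  assert (M * e <= mu / 2).
  { replace (mu / 2) with (M * (mu / (2 * M))) by (field; lra). apply Rmult_le_compat_l; lra. }
  pose proof (Rle_abs (f a b - f a' b')). lra.
Qed.

Lemma constant_of_derive_0 (f : R -> R) (a b : R) :
  (forall t, is_derive f t 0) -> f a = f b.
Proof.
  assert (H : forall f a b, a <= b -> (forall t, is_derive f t 0) -> f a = f b).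
  { clear. intros f a b Hab H. apply Rle_antisym.
    - apply (nondecreasing_of_derive f (fun _ => 0)); auto. intros; lra.
    - apply Ropp_le_cancel.
      apply (nondecreasing_of_derive (fun t => - f t) (fun _ => 0)); auto; [| intros; lra].
      intros t _. eapply is_derive_val; [apply is_derive_Ropp, H | ring]. }
  intros Hf. destruct (Rle_dec a b); [now apply H | symmetry; apply H; auto; lra].
Qed.

(* Membership in the ring [r1 < rho < r2, c1 < W < c2], as positivity of two polynomials. *)
Definition level_gap (W : R -> R -> R) (c1 c2 a b : R) : R := (c2 - W a b) * (W a b - c1).
Definition ring_gap (r1 r2 a b : R) : R :=
  (r2 ^ 2 - (a ^ 2 + b ^ 2)) * ((a ^ 2 + b ^ 2) - r1 ^ 2).

Lemma bipoly_level_gap W c1 c2 : bipoly W -> bipoly (level_gap W c1 c2).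
Proof. intros H. unfold level_gap. bipoly_auto. Qed.

Lemma bipoly_ring_gap r1 r2 : bipoly (ring_gap r1 r2).
Proof. unfold ring_gap. bipoly_auto. Qed.

(** Traversed in the direction [-s], the orbit cannot leave the annulus after [t0]; by periodicity
    each of its points recurs at such a later moment. *)
Lemma orbit_stays_in_annulus X1 X2 W W1 W2 r1 r2 c1 c2 om s (x y : R -> R) (T t0 : R) :
  annulus X1 X2 W W1 W2 r1 r2 c1 c2 om s ->
  is_solution X1 X2 x y -> 0 < T -> (forall t, x (t + T) = x t /\ y (t + T) = y t) ->
  0 < level_gap W c1 c2 (x t0) (y t0) -> 0 < ring_gap r1 r2 (x t0) (y t0) ->
  forall t, 0 < level_gap W c1 c2 (x t) (y t) /\ 0 < ring_gap r1 r2 (x t) (y t).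
Proof.
  intros An Hsol HT Hper HA0 HB0.
  open_annulus An.
  set (u := fun t => t0 + - s * t).
  assert (Hu : forall t, is_derive u t (- s)).
  { intros t. unfold u. auto_derive; [easy | ring]. }
  assert (Hxc : forall t, continuous (fun t => x (u t)) t).
  { intros t. apply (continuous_comp u x); eapply is_derive_continuous; [apply Hu | apply Hsol]. }
  assert (Hyc : forall t, continuous (fun t => y (u t)) t).
  { intros t. apply (continuous_comp u y); eapply is_derive_continuous; [apply Hu | apply Hsol]. }
  assert (Hpol : forall a b, 0 <= ring_gap r1 r2 a b ->
    exists rho th, r1 <= rho <= r2 /\ a = rho * cos th /\ b = - (rho * sin th) /\
       rho ^ 2 = a ^ 2 + b ^ 2).
  { intros a b H. apply bracket_iff in H; [| nra].
    destruct (polar_coordinates a b) as [rho [th [H1 [H2 [H3 H4]]]]]; [nra |].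
    exists rho, th. repeat split; auto; nra. }
  assert (Htrap : forall t, 0 < t ->
    0 < level_gap W c1 c2 (x (u t)) (y (u t)) /\ 0 < ring_gap r1 r2 (x (u t)) (y (u t))).
  { apply (trapping (fun t => level_gap W c1 c2 (x (u t)) (y (u t))) (fun t => ring_gap r1 r2 (x (u t)) (y (u t)))).
    - intros t. apply (bipoly_continuous _ (bipoly_level_gap W c1 c2 HW) (fun t => x (u t)) (fun t => y (u t))); auto.
    - intros t. apply (bipoly_continuous _ (bipoly_ring_gap r1 r2) (fun t => x (u t)) (fun t => y (u t))); auto.
    - intros t HA HB. destruct (Hpol _ _ HB) as [rho [th [H1 [H2 [H3 H4]]]]].
      unfold level_gap in HA. apply bracket_iff in HA; [| exact Hc12].
      apply bracket_iff_strict; [nra |]. rewrite <- H4.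
      rewrite H2, H3 in HA. fold (polar W rho th) in HA.
      pose proof (Hin th). pose proof (Hout th).
      assert (rho <> r1) by (intros ->; lra). assert (rho <> r2) by (intros ->; lra).
      split; nra.
    - intros t HA HB. destruct (Hpol _ _ (Rlt_le _ _ HB)) as [rho [th [H1 [H2 [H3 H4]]]]].
      set (g := flux X1 X2 W1 W2 rho th).
      set (w := fun t => W (x (u t)) (y (u t))).
      assert (Hw : is_derive w t (g * - s)).
      { eapply is_derive_val.
        - apply (Hgrad (fun t => x (u t)) (fun t => y (u t)) t).
          + apply (is_derive_Rcomp x u); [apply (Hsol (u t)) | apply Hu].
          + apply (is_derive_Rcomp y u); [apply (Hsol (u t)) | apply Hu].
        - rewrite H2, H3. unfold g, flux, polar. ring. }
      exists ((0 - g * - s) * (w t - c1) + (c2 - w t) * (g * - s - 0)). split.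
      + unfold level_gap in HA. fold (w t) in HA. apply bracket_zero in HA.
        assert (Ew : w t = polar W rho th) by (unfold w; rewrite H2, H3; reflexivity).
        destruct HA as [HA|HA]; rewrite HA; rewrite Ew in HA.
        * pose proof (Hfl1 rho th H1 HA) as Hf. fold g in Hf. nra.
        * pose proof (Hfl2 rho th H1 HA) as Hf. fold g in Hf. nra.
      + apply (is_derive_Rmult (fun t => c2 - w t) (fun t => w t - c1)).
        * apply is_derive_Rminus; [apply @is_derive_const | exact Hw].
        * apply is_derive_Rminus; [exact Hw | apply @is_derive_const].
    - unfold u. rewrite Rmult_0_r, Rplus_0_r. lra.
    - unfold u. rewrite Rmult_0_r, Rplus_0_r. lra. }
  intros t. destruct (INR_unbounded (s * (t - t0) / T)) as [n Hn].
  assert (Hxn : x (t + - s * (INR n * T)) = x t /\ y (t + - s * (INR n * T)) = y t).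
  { pose proof (periodic_nat x T (fun t => proj1 (Hper t)) n) as P.
    pose proof (periodic_nat y T (fun t => proj2 (Hper t)) n) as Q.
    destruct Hs as [-> | ->].
    - rewrite <- (P (t + - (1) * (INR n * T))), <- (Q (t + - (1) * (INR n * T))).
      split; f_equal; ring.
    - rewrite <- (P t), <- (Q t). split; f_equal; ring. }
  specialize (Htrap (INR n * T - s * (t - t0))).
  assert (Eu : u (INR n * T - s * (t - t0)) = t + - s * (INR n * T)).
  { unfold u. destruct Hs as [-> | ->]; ring. }
  rewrite Eu in Htrap. destruct Hxn as [Ex Ey]. rewrite Ex, Ey in Htrap. apply Htrap.
  apply (Rmult_lt_compat_r T) in Hn; [| exact HT].
  replace (s * (t - t0) / T * T) with (s * (t - t0)) in Hn by (field; lra). lra.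
Qed.

(** Integrating the angular velocity [w] gives a continuous branch of the angle at once. [C] and [S]
    are the components of the position in the frame turned by that angle, and [m] is the logarithmic
    derivative of the distance to the origin. *)
Lemma polar_lift (X1 X2 : R -> R -> R) (x y : R -> R) :
  bipoly X1 -> bipoly X2 -> is_solution X1 X2 x y ->
  (forall t, 0 < x t ^ 2 + y t ^ 2) ->
  exists rho th : R -> R,
    (forall t, 0 < rho t /\ x t = rho t * cos (th t) /\ y t = - (rho t * sin (th t))) /\
    (forall t, is_derive th t (ang_speed X1 X2 (rho t) (th t))).
Proof.
  intros HX1 HX2 Hsol Hn.
  assert (Hxc : forall t, continuous x t) by (intros t; eapply is_derive_continuous, (Hsol t)).
  assert (Hyc : forall t, continuous y t) by (intros t; eapply is_derive_continuous, (Hsol t)).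
  destruct (polar_coordinates (x 0) (y 0) (Hn 0)) as [rho0 [th0 [Hr0 [_ [Ex0 Ey0]]]]].
  set (n := fun t => x t ^ 2 + y t ^ 2).
  set (Y1 := fun t => X1 (x t) (y t)). set (Y2 := fun t => X2 (x t) (y t)).
  set (w := fun t => (y t * Y1 t - x t * Y2 t) / n t).
  set (m := fun t => (x t * Y1 t + y t * Y2 t) / n t).
  assert (HY1c : forall t, continuous Y1 t) by (intros; now apply (bipoly_continuous X1 HX1)).
  assert (HY2c : forall t, continuous Y2 t) by (intros; now apply (bipoly_continuous X2 HX2)).
  assert (Hnc : forall t, continuous n t).
  { intros t. specialize (Hxc t). specialize (Hyc t). unfold n. cont. }
  assert (Hwc : forall t, continuous w t).
  { intros t. specialize (Hxc t). specialize (Hyc t). specialize (HY1c t). specialize (HY2c t).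
    specialize (Hnc t). specialize (Hn t). unfold w. cont. fold (n t) in Hn. lra. }
  set (th := picard_step (fun s _ => w s) th0 (fun _ => 0)).
  assert (Hth0 : th 0 = th0) by apply picard_step_0.
  assert (Hth : forall t, is_derive th t (w t)).
  { intros t. apply (picard_step_derive (fun s _ => w s) th0 (fun _ => 0) t). apply Hwc. }
  set (C := fun t => x t * cos (th t) - y t * sin (th t)).
  set (S := fun t => x t * sin (th t) + y t * cos (th t)).
  assert (Hsplit : forall t, Y1 t = m t * x t + w t * y t /\ Y2 t = m t * y t - w t * x t).
  { intros t. specialize (Hn t). unfold m, w, n. split; field; lra. }
  assert (Hcth : forall t, is_derive (fun t => cos (th t)) t (- sin (th t) * w t)).
  { intros t. apply (is_derive_Rcomp cos th); [apply is_derive_cos | apply Hth]. }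
  assert (Hsth : forall t, is_derive (fun t => sin (th t)) t (cos (th t) * w t)).
  { intros t. apply (is_derive_Rcomp sin th); [apply is_derive_sin | apply Hth]. }
  assert (HS : forall t, is_derive S t (m t * S t)).
  { intros t. destruct (Hsol t) as [Dx Dy]. destruct (Hsplit t) as [E1 E2].
    eapply is_derive_val.
    - apply is_derive_Rplus.
      + apply (is_derive_Rmult x (fun t => sin (th t))); [exact Dx | apply Hsth].
      + apply (is_derive_Rmult y (fun t => cos (th t))); [exact Dy | apply Hcth].
    - fold (Y1 t) (Y2 t). rewrite E1, E2. unfold S. ring. }
  assert (HC : forall t, is_derive C t (m t * C t)).
  { intros t. destruct (Hsol t) as [Dx Dy]. destruct (Hsplit t) as [E1 E2].
    eapply is_derive_val.
    - apply is_derive_Rminus.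
      + apply (is_derive_Rmult x (fun t => cos (th t))); [exact Dx | apply Hcth].
      + apply (is_derive_Rmult y (fun t => sin (th t))); [exact Dy | apply Hsth].
    - fold (Y1 t) (Y2 t). rewrite E1, E2. unfold C. ring. }
  assert (HCS : forall t, C t ^ 2 + S t ^ 2 = n t).
  { intros t. pose proof (sin2_cos2 (th t)) as E. unfold Rsqr in E.
    replace (C t ^ 2 + S t ^ 2) with (n t * (sin (th t) * sin (th t) + cos (th t) * cos (th t)))
      by (unfold C, S, n; ring). rewrite E. ring. }
  assert (Hinit : S 0 = 0 /\ C 0 = rho0).
  { unfold S, C. rewrite Hth0, Ex0, Ey0. split; [ring |].
    pose proof (sin2_cos2 th0) as E. unfold Rsqr in E.
    replace (rho0 * cos th0 * cos th0 - - (rho0 * sin th0) * sin th0)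
      with (rho0 * (sin th0 * sin th0 + cos th0 * cos th0)) by ring. rewrite E. ring. }
  (* Both [C] and [S] solve [z' = m z], and [S 0 = 0], so the ratio [S / |(x,y)|] stays [0]. *)
  assert (Hm2 : forall t, is_derive n t (2 * m t * n t)).
  { intros t. apply (is_derive_ext (fun t => C t * C t + S t * S t)).
    - intros u. rewrite <- (HCS u). change (C u * C u + S u * S u = C u ^ 2 + S u ^ 2). ring.
    - eapply is_derive_val.
      + apply is_derive_Rplus; [apply (is_derive_Rmult C C) | apply (is_derive_Rmult S S)]; auto.
      + rewrite <- HCS. simpl. ring. }
  assert (HS0 : forall t, S t = 0).
  { intros t.
    assert (E : S t * S t * / n t = S 0 * S 0 * / n 0).
    { apply (constant_of_derive_0 (fun t => S t * S t * / n t)). intros u.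
      eapply is_derive_val.
      - apply (is_derive_Rmult (fun t => S t * S t) (fun t => / n t)).
        + apply (is_derive_Rmult S S); apply HS.
        + apply (is_derive_inv n); [apply Hm2 | specialize (Hn u); unfold n; lra].
      - simpl. specialize (Hn u). fold (n u) in Hn. field. lra. }
    rewrite (proj1 Hinit) in E. specialize (Hn t). fold (n t) in Hn.
    assert (S t * S t = 0).
    { replace (S t * S t) with (S t * S t * / n t * n t) by (field; lra). rewrite E. ring. }
    nra. }
  assert (HCn : forall t, C t <> 0).
  { intros t E. specialize (HCS t). rewrite E, HS0 in HCS. specialize (Hn t). unfold n in HCS. lra. }
  assert (HCp : forall t, 0 < C t).
  { intros t. destruct (Rlt_dec 0 (C t)) as [|H]; [assumption | exfalso].
    destruct (IVT_gen C 0 t 0) as [c [_ Hc]].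
    - intros u. apply continuity_pt_filterlim. eapply is_derive_continuous, HC.
    - rewrite (proj2 Hinit), Rmin_right, Rmax_left by lra. lra.
    - now apply (HCn c). }
  assert (Hrec : forall t, x t = C t * cos (th t) /\ y t = - (C t * sin (th t))).
  { intros t. pose proof (sin2_cos2 (th t)) as E. unfold Rsqr in E.
    pose proof (HS0 t) as Z. split.
    - replace (C t * cos (th t))
        with (x t * (sin (th t) * sin (th t) + cos (th t) * cos (th t)) - S t * sin (th t))
        by (unfold C, S; ring). rewrite E, Z. ring.
    - replace (- (C t * sin (th t)))
        with (y t * (sin (th t) * sin (th t) + cos (th t) * cos (th t)) - S t * cos (th t))
        by (unfold C, S; ring). rewrite E, Z. ring. }
  exists C, th. split.
  - intros t. destruct (Hrec t). auto.
  - intros t. eapply is_derive_val; [apply Hth |].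
    destruct (Hrec t) as [Ex Ey]. specialize (HCp t).
    assert (En : n t = C t ^ 2) by (rewrite <- HCS, HS0; ring).
    unfold w, ang_speed, polar. rewrite <- Ex, <- Ey, En. fold (Y1 t) (Y2 t).
    rewrite Ex, Ey. field. lra.
Qed.

(** A periodic nondecreasing function is constant, being squeezed between values one period
    apart. *)
Lemma periodic_nondecreasing_derive_0 (f : R -> R) (T t d : R) :
  0 < T -> (forall t, f (t + T) = f t) -> (forall a b, a <= b -> f a <= f b) ->
  is_derive f t d -> d <= 0.
Proof.
  intros HT Hper Hmon Hd. destruct (Rle_dec d 0) as [|H]; [assumption | exfalso].
  apply is_derive_Reals in Hd. destruct (Hd (d / 2)) as [e He]; [lra |].
  set (h := Rmin (e / 2) T). pose proof (cond_pos e).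
  assert (Hh : 0 < h) by (apply Rmin_glb_lt; lra).
  assert (h <= e / 2) by apply Rmin_l. assert (h <= T) by apply Rmin_r.
  specialize (He h ltac:(lra) ltac:(rewrite Rabs_right; lra)).
  assert (E : f (t + h) = f t).
  { apply Rle_antisym; [| apply Hmon; lra]. rewrite <- (Hper t). apply Hmon. lra. }
  rewrite E, Rminus_diag in He. unfold Rdiv at 1 in He. rewrite Rmult_0_l in He.
  apply Rabs_def2 in He. lra.
Qed.

(** The comparison uses [E = s D^2], with [D] the difference of the values of [W] at equal angle:
    its derivative is positive wherever the radii differ, whichever curve is the outer one there. A
    periodic [E] leaves no room for this. *)
Lemma annulus_unique_orbit X1 X2 W W1 W2 r1 r2 c1 c2 om s (rho : R -> R) (x y : R -> R) (T : R) :
  annulus X1 X2 W W1 W2 r1 r2 c1 c2 om s ->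
  (forall th, r1 < rho th < r2 /\ c1 < polar W (rho th) th < c2) ->
  (forall th, rho (th + 2 * PI) = rho th) ->
  (forall th, is_derive rho th (rad_speed X1 X2 (rho th) th / ang_speed X1 X2 (rho th) th)) ->
  is_solution X1 X2 x y -> 0 < T -> (forall t, x (t + T) = x t /\ y (t + T) = y t) ->
  (forall t, 0 < level_gap W c1 c2 (x t) (y t) /\ 0 < ring_gap r1 r2 (x t) (y t)) ->
  forall a b, graph_curve rho a b <-> exists t, a = x t /\ b = y t.
Proof.
  intros An Hin_ann Hrper Hrd Hsol HT Hper Hgap.
  open_annulus An.
  assert (Hn : forall t, r1 ^ 2 < x t ^ 2 + y t ^ 2 < r2 ^ 2).
  { intros t. destruct (Hgap t) as [_ H]. apply bracket_iff_strict in H; [exact H | nra]. }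
  assert (Hw : forall t, c1 < W (x t) (y t) < c2).
  { intros t. destruct (Hgap t) as [H _]. now apply bracket_iff_strict in H. }
  destruct (polar_lift X1 X2 x y HX1 HX2 Hsol) as [C [th [HC Hth]]].
  { intros t. specialize (Hn t). nra. }
  assert (HCn : forall t, C t ^ 2 = x t ^ 2 + y t ^ 2).
  { intros t. destruct (HC t) as [_ [Ex Ey]]. pose proof (sin2_cos2 (th t)) as E. unfold Rsqr in E.
    rewrite Ex, Ey.
    replace ((C t * cos (th t)) ^ 2 + (- (C t * sin (th t))) ^ 2)
      with (C t ^ 2 * (sin (th t) * sin (th t) + cos (th t) * cos (th t))) by ring.
    rewrite E. ring. }
  assert (HCr : forall t, r1 < C t < r2).
  { intros t. specialize (Hn t). rewrite <- HCn in Hn. destruct (HC t) as [HCp _]. split; nra. }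
  assert (HWC : forall t, W (x t) (y t) = polar W (C t) (th t)).
  { intros t. destruct (HC t) as [_ [Ex Ey]]. unfold polar. now rewrite <- Ex, <- Ey. }
  set (D := fun t => W (x t) (y t) - polar W (rho (th t)) (th t)).
  set (g := fun r t => flux X1 X2 W1 W2 r t / ang_speed X1 X2 r t).
  assert (HD : forall t, is_derive D t (ang_speed X1 X2 (C t) (th t) * (g (C t) (th t) - g (rho (th t)) (th t)))).
  { intros t. eapply is_derive_val.
    - apply is_derive_Rminus.
      + apply (Hgrad x y t); apply (Hsol t).
      + apply (polar_W_derive X1 X2 W W1 W2 r1 r2 c1 c2 om s (fun t => rho (th t)) th t (ang_speed X1 X2 (C t) (th t)) An).
        * destruct (Hin_ann (th t)). lra.
        * apply Hth.
        * apply (is_derive_Rcomp rho th); [apply Hrd | apply Hth].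
    - pose proof (Hrot (C t) (th t) ltac:(specialize (HCr t); lra)).
      destruct (HC t) as [_ [Ex Ey]]. unfold g, flux, polar in *. simpl. rewrite <- Ex, <- Ey.
      field. split; [| lra].
      pose proof (Hrot (rho (th t)) (th t) ltac:(destruct (Hin_ann (th t)); lra)). lra. }
  assert (Hsign : forall t, C t <> rho (th t) ->
    0 < s * (D t * (ang_speed X1 X2 (C t) (th t) * (g (C t) (th t) - g (rho (th t)) (th t))))).
  { intros t Hne. destruct (Hin_ann (th t)) as [Ha Hb]. specialize (HCr t). specialize (Hw t).
    rewrite HWC in Hw. unfold D. rewrite HWC.
    pose proof (Hrot (C t) (th t) ltac:(lra)) as Hang.
    assert (key : forall y1 y2, r1 < y1 -> y1 < y2 -> y2 < r2 -> c1 < polar W y1 (th t) -> polar W y2 (th t) < c2 ->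
      0 < (polar W y2 (th t) - polar W y1 (th t)) *
        (ang_speed X1 X2 (C t) (th t) * (s * g y2 (th t) - s * g y1 (th t)))).
    { intros y1 y2 H1 H2 H3 H4 H5.
      pose proof (Hrad y1 y2 (th t) ltac:(lra) H2 ltac:(lra)).
      pose proof (Hmono y1 y2 (th t) ltac:(lra) H2 ltac:(lra) ltac:(lra) ltac:(lra)).
      unfold g. apply Rmult_lt_0_compat; [lra |]. apply Rmult_lt_0_compat; lra. }
    destruct (Rlt_dec (C t) (rho (th t))).
    - pose proof (key (C t) (rho (th t)) ltac:(lra) ltac:(lra) ltac:(lra) ltac:(lra) ltac:(lra)). lra.
    - pose proof (key (rho (th t)) (C t) ltac:(lra) ltac:(lra) ltac:(lra) ltac:(lra) ltac:(lra)). lra. }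
  set (E := fun t => s * (D t * D t)).
  set (E' := fun t => 2 * (s * (D t * (ang_speed X1 X2 (C t) (th t) * (g (C t) (th t) - g (rho (th t)) (th t)))))).
  assert (HE : forall t, is_derive E t (E' t)).
  { intros t. eapply is_derive_val.
    - apply (is_derive_Rmult (fun _ => s) (fun t => D t * D t)); [apply @is_derive_const |].
      apply (is_derive_Rmult D D); apply HD.
    - unfold E', zero. simpl. ring. }
  assert (HE0 : forall t, 0 <= E' t).
  { intros t. destruct (Req_dec (C t) (rho (th t))) as [Eq|Ne].
    - unfold E'. rewrite Eq, Rminus_diag, !Rmult_0_r. lra.
    - unfold E'. pose proof (Hsign t Ne). lra. }
  assert (HEmon : forall a b, a <= b -> E a <= E b).
  { intros a b Hab. apply (nondecreasing_of_derive E E'); auto. }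
  (* After time [T] the lifted angle need not return, but its sine and cosine do; this is enough
     because [rho] is [2 PI]-periodic. *)
  assert (HEper : forall t, E (t + T) = E t).
  { intros t. unfold E. assert (HDp : D (t + T) = D t).
    { destruct (Hper t) as [Px Py]. unfold D. rewrite Px, Py.
      destruct (HC t) as [HCp [Ex Ey]], (HC (t + T)) as [HCp' [Ex' Ey']].
      assert (HCC : C (t + T) = C t).
      { pose proof (HCn (t + T)) as E1. rewrite Px, Py, <- HCn in E1. nra. }
      rewrite Px, HCC in Ex'. rewrite Py, HCC in Ey'.
      assert (Ec : cos (th (t + T)) = cos (th t)) by (apply (Rmult_eq_reg_l (C t)); lra).
      assert (Es : sin (th (t + T)) = sin (th t)) by (apply (Rmult_eq_reg_l (C t)); lra).
      unfold polar. rewrite (periodic_same_angle rho _ _ Hrper Ec Es), Ec, Es. reflexivity. }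
    now rewrite HDp. }
  assert (Heq : forall t, C t = rho (th t)).
  { intros t. destruct (Req_dec (C t) (rho (th t))) as [|Ne]; [assumption | exfalso].
    pose proof (periodic_nondecreasing_derive_0 E T t (E' t) HT HEper HEmon (HE t)).
    pose proof (Hsign t Ne). unfold E' in H. lra. }
  intros a b. split.
  - intros [y0 [-> ->]].
    destruct (surjective_of_speed (fun t => th t - th 0) (fun t => ang_speed X1 X2 (C t) (th t)) om Hom) as [_ [_ Hsurj]].
    + ring.
    + intros t. eapply is_derive_val; [apply is_derive_Rminus; [apply Hth | apply @is_derive_const] |].
      unfold zero; simpl. ring.
    + intros t. apply Hrot. specialize (HCr t). lra.
    + destruct (Hsurj (y0 - th 0)) as [t Ht]. assert (Et : th t = y0) by lra. exists t.
      destruct (HC t) as [_ [Ex Ey]]. rewrite Heq, Et in Ex, Ey. auto.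
  - intros [t [-> ->]]. exists (th t). destruct (HC t) as [_ [Ex Ey]]. rewrite <- Heq. auto.
Qed.

(** A periodic orbit passing close to the closed graph has a point in the open ring, hence stays in
    the ring and coincides with the graph. The window for [W] and the nonemptiness serve to tell the
    six cycles apart. *)
Lemma annulus_limit_cycle X1 X2 W W1 W2 r1 r2 c1 c2 om s :
  annulus X1 X2 W W1 W2 r1 r2 c1 c2 om s ->
  exists G, limit_cycle X1 X2 G /\ (exists a b, G a b) /\
    forall a b, G a b -> c1 < W a b < c2 /\ a ^ 2 + b ^ 2 < r2 ^ 2.
Proof.
  intros An.
  destruct (periodic_graph _ _ _ _ _ _ _ _ _ _ _ An) as [rho [Hann [Hper Hd]]].
  open_annulus An.
  assert (Hnorm : forall th, (rho th * cos th) ^ 2 + (- (rho th * sin th)) ^ 2 = rho th ^ 2).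
  { intros th. pose proof (sin2_cos2 th) as E. unfold Rsqr in E.
    replace ((rho th * cos th) ^ 2 + (- (rho th * sin th)) ^ 2)
      with (rho th ^ 2 * (sin th * sin th + cos th * cos th)) by ring.
    rewrite E. ring. }
  exists (graph_curve rho). split; [split | split].
  - apply (graph_periodic_orbit X1 X2 W W1 W2 r1 r2 c1 c2 om s rho An); auto. intros th; apply Hann.
  - assert (Hrc : forall t, continuous rho t) by (intros; eapply is_derive_continuous, Hd).
    assert (HK : forall th, Rabs (rho th) <= r2).
    { intros th. destruct (Hann th). rewrite Rabs_right; lra. }
    destruct (graph_positive_neighbourhood (level_gap W c1 c2) rho r2) as [e1 [He1 H1]]; auto.
    { now apply bipoly_level_gap. }
    { intros th. apply bracket_iff_strict; [exact Hc12 | apply (Hann th)]. }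
    destruct (graph_positive_neighbourhood (ring_gap r1 r2) rho r2) as [e2 [He2 H2]]; auto.
    { apply bipoly_ring_gap. }
    { intros th. apply bracket_iff_strict; [nra |]. rewrite Hnorm. destruct (Hann th). split; nra. }
    exists (Rmin e1 e2). split; [apply Rmin_glb_lt; lra |].
    intros G' [x [y [T [Hsol [HT [HperG [_ HG']]]]]]] [a [b [a' [b' [Hab [Hab' Hdist]]]]]].
    pose proof (Rmin_l e1 e2). pose proof (Rmin_r e1 e2).
    assert (0 < Rmin e1 e2) by (apply Rmin_glb_lt; lra).
    apply HG' in Hab'. destruct Hab' as [t0 [-> ->]].
    intros p q. rewrite (HG' p q).
    apply (annulus_unique_orbit X1 X2 W W1 W2 r1 r2 c1 c2 om s rho x y T An Hann Hper Hd Hsol HT HperG).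
    apply (orbit_stays_in_annulus X1 X2 W W1 W2 r1 r2 c1 c2 om s x y T t0 An Hsol HT HperG).
    + apply (H1 (Rmin e1 e2) a b); auto; lra.
    + apply (H2 (Rmin e1 e2) a b); auto; lra.
  - exists (rho 0 * cos 0), (- (rho 0 * sin 0)). now exists 0.
  - intros a b [th [-> ->]]. destruct (Hann th) as [Ha Hb]. split; [exact Hb |].
    rewrite Hnorm. nra.
Qed.

(** * Six annuli *)

(** Kept in expanded form because its coefficients, up to [kappa] and powers of [mu], are the values
    prescribed to [m_1, ..., m_7]. *)
Definition Q6 (x : R) : R :=
  720 * x - 1764 * x ^ 2 + 1624 * x ^ 3 - 735 * x ^ 4 + 175 * x ^ 5 - 21 * x ^ 6 + x ^ 7.

Lemma Q6_factor (x : R) :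
  Q6 x = x * (x - 1) * (x - 2) * (x - 3) * (x - 4) * (x - 5) * (x - 6).
Proof. unfold Q6. ring. Qed.

Lemma Q6_root (i : nat) : (1 <= i <= 6)%nat -> Q6 (INR i) = 0.
Proof.
  intros H. rewrite Q6_factor.
  destruct i as [|[|[|[|[|[|[|i]]]]]]]; try lia; simpl; ring.
Qed.

(** The derivative of [Q6] at [i] is [(-1)^i i! (6 - i)!], of modulus at least 36, so the slope 10
    is safe up to distance [1/16]. *)
Lemma Q6_steep (i : nat) (x y : R) : (1 <= i <= 6)%nat ->
  INR i - /16 <= x -> x <= y -> y <= INR i + /16 ->
  10 * (y - x) <= (-1) ^ i * (Q6 y - Q6 x).
Proof.
  intros Hi Hx Hxy Hy.
  set (dQ := fun x => 720 - 3528 * x + 4872 * x ^ 2 - 2940 * x ^ 3 + 875 * x ^ 4 - 126 * x ^ 5 + 7 * x ^ 6).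
  assert (H : (-1) ^ i * Q6 x - 10 * x <= (-1) ^ i * Q6 y - 10 * y); [| lra].
  apply (nondecreasing_of_derive (fun z => (-1) ^ i * Q6 z - 10 * z) (fun z => (-1) ^ i * dQ z - 10)); auto.
  - intros t _. unfold Q6, dQ. auto_derive; [easy | simpl; ring].
  (* The derivative is expanded around [i], and the powers of [h] are then treated as independent
     small quantities, which makes the bound linear. *)
  - intros t Ht. set (h := t - INR i). assert (Hh : - /16 <= h <= /16) by (unfold h; lra).
    assert (Et : t = INR i + h) by (unfold h; ring). rewrite Et. clearbody h. clear Et Ht t.
    assert (H2 : 0 <= h ^ 2 <= /16 ^ 2) by (split; nra).
    assert (H3 : - /16 ^ 3 <= h ^ 3 <= /16 ^ 3).
    { replace (h ^ 3) with (h * h ^ 2) by ring. split; nra. }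
    assert (H4 : - /16 ^ 4 <= h ^ 4 <= /16 ^ 4).
    { replace (h ^ 4) with (h ^ 2 * h ^ 2) by ring. split; nra. }
    assert (H5 : - /16 ^ 5 <= h ^ 5 <= /16 ^ 5).
    { replace (h ^ 5) with (h ^ 2 * h ^ 3) by ring. split; nra. }
    assert (H6 : - /16 ^ 6 <= h ^ 6 <= /16 ^ 6).
    { replace (h ^ 6) with (h ^ 3 * h ^ 3) by ring. split; nra. }
    clear Hx Hxy Hy.
    destruct i as [|[|[|[|[|[|[|i]]]]]]]; try lia; unfold dQ.
    all: match goal with |- 0 <= (-1) ^ ?n * _ - 10 =>
      replace (INR n) with (IZR (Z.of_nat n)) by (rewrite INR_IZR_INZ; reflexivity);
      cbv [Z.of_nat Pos.of_succ_nat Pos.succ] end; ring_simplify; lra.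
Qed.

Lemma Q6_bound (x : R) : 0 <= x <= 7 -> Rabs (Q6 x) <= 1000000.
Proof.
  intros H. rewrite Q6_factor, !Rabs_mult.
  assert (B : forall c, 0 <= c <= 7 -> Rabs (x - c) <= 7) by (intros; apply Rabs_le; lra).
  assert (P : forall a b m, 0 <= m -> Rabs a <= m -> Rabs b <= 7 -> Rabs a * Rabs b <= m * 7).
  { intros a b m Hm Ha Hb. apply Rmult_le_compat; auto using Rabs_pos. }
  assert (H0 : Rabs x <= 7) by (apply Rabs_le; lra).
  rewrite <- !Rabs_mult.
  repeat match goal with
  | |- Rabs (?a * ?b) <= ?m => rewrite (Rabs_mult a b); apply (Rle_trans _ ((m / 7) * 7)); [apply P; [lra | | apply B; lra] | lra]
  end. lra.
Qed.

(** The radii 1 and 4 enclose all six rings, whose squared radii are [2 i - 1/8] and [2 i + 1/8]. *)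
Definition ring_bounded (B : R) (f : R -> R -> R) : Prop :=
  forall x y th, 1 <= x <= 4 -> 1 <= y <= 4 ->
    Rabs (f x th) <= B /\ Rabs (f x th - f y th) <= B * Rabs (x - y).

(** In the application the numerator comes from the flux and the denominator is the angular speed:
    the first grows at a definite rate while the second is nearly constant. *)
Lemma quotient_increment (N1 N2 D1 D2 a b : R) :
  0 < D1 -> 0 < D2 ->
  a <= N2 - N1 -> Rabs N1 * Rabs (D2 - D1) <= b -> b < a * D1 ->
  N1 / D1 < N2 / D2.
Proof.
  intros H1 H2 Ha Hb Hab.
  assert (E : N2 / D2 - N1 / D1 = ((N2 - N1) * D1 - N1 * (D2 - D1)) / (D1 * D2)) by (field; lra).
  assert (N1 * (D2 - D1) <= b).
  { eapply Rle_trans; [apply Rle_abs |]. now rewrite Rabs_mult. }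
  assert (a * D1 <= (N2 - N1) * D1) by (apply Rmult_le_compat_r; lra).
  assert (0 < ((N2 - N1) * D1 - N1 * (D2 - D1)) / (D1 * D2)).
  { apply Rdiv_lt_0_compat; [lra | apply Rmult_lt_0_compat; lra]. }
  lra.
Qed.

(** The ring extends to [rho^2 / 2 = i - 1/16] and [i + 1/16], twice as far as the levels; as
    [W / mu^2] differs from [rho^2 / 2] by at most [10^-7], the levels stay inside it. The bound on
    [mu M] is matched to the bound [10^6] on [Q6], so that the variation of the angular speed cannot
    spoil the monotonicity of [dW / dtheta]. The factor [(-1)^i] is the sign of the slope of [Q6] at
    [i]. *)
Lemma scaled_annulus X1 X2 W W1 W2 (x1 x2 w E : R -> R -> R) (mu lam kap M : R) (i : nat) :
  bipoly X1 -> bipoly X2 -> bipoly W -> has_gradient W W1 W2 ->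
  0 < mu -> 0 < lam -> kap <> 0 -> 0 <= M -> mu * M <= / 10000000 ->
  (forall rho th, 1 <= rho <= 4 -> polar X1 (mu * rho) th = mu * (- (rho * sin th) + mu * x1 rho th)) ->
  (forall rho th, 1 <= rho <= 4 -> polar X2 (mu * rho) th = mu * (- (rho * cos th) + mu * x2 rho th)) ->
  (forall rho th, 1 <= rho <= 4 -> polar W (mu * rho) th = mu ^ 2 * (rho ^ 2 / 2 + mu * w rho th)) ->
  (forall rho th, 1 <= rho <= 4 ->
     flux X1 X2 W1 W2 (mu * rho) th = lam * (kap * Q6 (rho ^ 2 / 2) + E rho th)) ->
  ring_bounded M x1 -> ring_bounded M x2 -> ring_bounded M w -> ring_bounded (Rabs kap / 100) E ->
  (1 <= i <= 6)%nat ->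
  annulus X1 X2 W W1 W2 (mu * sqrt (2 * INR i - / 8)) (mu * sqrt (2 * INR i + / 8))
    (mu ^ 2 * (INR i - / 32)) (mu ^ 2 * (INR i + / 32)) (/ 2) (sign kap * (-1) ^ i).
Proof.
  intros HX1 HX2 HW Hgrad Hmu Hlam Hkap HM HmuM P1 P2 PW PF B1 B2 Bw BE Hi.
  set (n := INR i).
  assert (Hn : 1 <= n <= 6).
  { unfold n. split; [replace 1 with (INR 1) by reflexivity | replace 6 with (INR 6) by (simpl; ring)];
      apply le_INR; lia. }
  set (ra := sqrt (2 * n - / 8)). set (rb := sqrt (2 * n + / 8)).
  assert (Hra2 : ra ^ 2 = 2 * n - / 8) by (apply pow2_sqrt; lra).
  assert (Hrb2 : rb ^ 2 = 2 * n + / 8) by (apply pow2_sqrt; lra).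
  assert (Hra0 : 0 <= ra) by apply sqrt_pos. assert (Hrb0 : 0 <= rb) by apply sqrt_pos.
  assert (Hra1 : 1 <= ra) by nra. assert (Hrb4 : rb <= 4) by nra.
  assert (Hrab : ra < rb) by nra.
  set (sg := sign kap * (-1) ^ i).
  assert (Hsgk : sign kap * kap = Rabs kap).
  { destruct (Rlt_dec 0 kap); [rewrite sign_eq_1, Rabs_right by lra | rewrite sign_eq_m1, Rabs_left by lra]; ring. }
  assert (Hsk : sign kap = 1 \/ sign kap = -1).
  { destruct (Rlt_dec 0 kap); [left; apply sign_eq_1; lra | right; apply sign_eq_m1; lra]. }
  assert (Hpw : (-1) ^ i = 1 \/ (-1) ^ i = -1).
  { clear. induction i; simpl; [now left |]. destruct IHi as [-> | ->]; [right | left]; ring. }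
  assert (Hsg : sg = 1 \/ sg = -1).
  { unfold sg. destruct Hsk as [-> | ->], Hpw as [-> | ->]; [left | right | right | left]; ring. }
  assert (Hkp : 0 < Rabs kap) by now apply Rabs_pos_lt.
  assert (Hsabs : forall z, - Rabs z <= sg * z <= Rabs z).
  { intros z. pose proof (Rle_abs z). pose proof (Rle_abs (- z)) as Hz. rewrite Rabs_Ropp in Hz.
    destruct Hsg as [-> | ->]; lra. }
  assert (Hscale : forall r, mu * ra <= r <= mu * rb -> exists rho, r = mu * rho /\ ra <= rho <= rb).
  { intros r Hr. exists (r / mu). split; [field; lra |].
    assert (Er : r = mu * (r / mu)) by (field; lra). rewrite Er in Hr.
    split; apply (Rmult_le_reg_l mu); lra. }
  assert (Hwb : forall rho th, ra <= rho <= rb -> Rabs (mu * w rho th) <= / 10000000).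
  { intros rho th Hr. destruct (Bw rho rho th) as [Bw1 _]; [lra | lra |].
    rewrite Rabs_mult, Rabs_right by lra. eapply Rle_trans; [| exact HmuM].
    apply Rmult_le_compat_l; lra. }
  assert (HQs : forall rho rho', ra <= rho -> rho <= rho' -> rho' <= rb ->
    10 * (rho' - rho) <= (-1) ^ i * (Q6 (rho' ^ 2 / 2) - Q6 (rho ^ 2 / 2))).
  { intros rho rho' H1 H2 H3. eapply Rle_trans; [| apply (Q6_steep i (rho ^ 2 / 2) (rho' ^ 2 / 2) Hi)].
    - assert (0 <= (rho' - rho) * (rho' + rho - 2)) by (apply Rmult_le_pos; lra). nra.
    - fold n. nra.
    - nra.
    - fold n. nra. }
  assert (Hang : forall rho th, ra <= rho <= rb ->
    ang_speed X1 X2 (mu * rho) th = 1 - mu * ((sin th * x1 rho th + cos th * x2 rho th) / rho)).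
  { intros rho th Hr. unfold ang_speed. rewrite P1, P2 by lra.
    pose proof (sin2_cos2 th) as S. unfold Rsqr in S.
    replace (- (sin th * (mu * (- (rho * sin th) + mu * x1 rho th)) + cos th * (mu * (- (rho * cos th) + mu * x2 rho th))) / (mu * rho))
      with ((sin th * sin th + cos th * cos th) - mu * ((sin th * x1 rho th + cos th * x2 rho th) / rho))
      by (field; lra). rewrite S. ring. }
  set (m := fun rho th => sin th * x1 rho th + cos th * x2 rho th).
  assert (Hm : forall rho rho' th, ra <= rho <= rb -> ra <= rho' <= rb ->
    Rabs (m rho th) <= 2 * M /\ Rabs (m rho' th - m rho th) <= 2 * M * Rabs (rho' - rho)).
  { intros rho rho' th Hr Hr'.
    destruct (B1 rho' rho th) as [_ b1]; [lra | lra |]. destruct (B2 rho' rho th) as [_ b2]; [lra | lra |].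
    destruct (B1 rho rho th) as [b1' _]; [lra | lra |]. destruct (B2 rho rho th) as [b2' _]; [lra | lra |].
    pose proof (Rabs_sin_le th). pose proof (Rabs_cos_le th).
    assert (K : forall c z K, Rabs c <= 1 -> Rabs z <= K -> Rabs (c * z) <= K).
    { intros c z K Hc Hz. rewrite Rabs_mult. pose proof (Rabs_pos c). pose proof (Rabs_pos z). nra. }
    split.
    - unfold m. eapply Rle_trans; [apply Rabs_triang |].
      pose proof (K _ _ _ H b1'). pose proof (K _ _ _ H0 b2'). lra.
    - unfold m. replace (sin th * x1 rho' th + cos th * x2 rho' th - (sin th * x1 rho th + cos th * x2 rho th))
        with (sin th * (x1 rho' th - x1 rho th) + cos th * (x2 rho' th - x2 rho th)) by ring.
      eapply Rle_trans; [apply Rabs_triang |].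
      pose proof (K _ _ _ H b1). pose proof (K _ _ _ H0 b2). lra. }
  assert (Hmr : forall rho th, ra <= rho <= rb -> Rabs (m rho th / rho) <= 2 * M).
  { intros rho th Hr. destruct (Hm rho rho th Hr Hr) as [A _].
    unfold Rdiv. rewrite Rabs_mult, Rabs_inv, (Rabs_right rho) by lra.
    assert (0 < / rho <= 1).
    { split; [apply Rinv_0_lt_compat; lra |]. rewrite <- Rinv_1. apply Rinv_le_contravar; lra. }
    pose proof (Rabs_pos (m rho th)). nra. }
  assert (Hangb : forall rho th, ra <= rho <= rb -> / 2 <= ang_speed X1 X2 (mu * rho) th).
  { intros rho th Hr. rewrite Hang by exact Hr. fold (m rho th).
    pose proof (Rle_abs (m rho th / rho)). pose proof (Hmr rho th Hr).
    assert (mu * (m rho th / rho) <= mu * (2 * M)) by (apply Rmult_le_compat_l; lra). lra. }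
  assert (Hangd : forall rho rho' th, ra <= rho <= rb -> ra <= rho' <= rb ->
    Rabs (ang_speed X1 X2 (mu * rho') th - ang_speed X1 X2 (mu * rho) th) <= 4 * (mu * M) * Rabs (rho' - rho)).
  { intros rho rho' th Hr Hr'. rewrite !Hang by assumption. fold (m rho th) (m rho' th).
    replace (1 - mu * (m rho' th / rho') - (1 - mu * (m rho th / rho)))
      with (mu * - ((m rho' th - m rho th) / rho' - (m rho th / rho) * ((rho' - rho) / rho'))) by (field; lra).
    rewrite Rabs_mult, Rabs_Ropp, (Rabs_right mu) by lra.
    replace (4 * (mu * M) * Rabs (rho' - rho)) with (mu * (2 * M * Rabs (rho' - rho) + 2 * M * Rabs (rho' - rho))) by ring.
    apply Rmult_le_compat_l; [lra |].
    assert (0 < / rho' <= 1).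
    { split; [apply Rinv_0_lt_compat; lra |]. rewrite <- Rinv_1. apply Rinv_le_contravar; lra. }
    assert (D : forall z, Rabs (z / rho') <= Rabs z).
    { intros z. unfold Rdiv. rewrite Rabs_mult, (Rabs_right (/ rho')) by lra. pose proof (Rabs_pos z). nra. }
    eapply Rle_trans; [apply Rabs_triang |]. rewrite Rabs_Ropp, Rabs_mult.
    apply Rplus_le_compat.
    - eapply Rle_trans; [apply D | apply Hm; assumption].
    - apply Rmult_le_compat; auto using Rabs_pos. }
  assert (HEb : forall rho th, ra <= rho <= rb -> Rabs (E rho th) <= Rabs kap / 100).
  { intros rho th Hr. apply (BE rho rho th); lra. }
  assert (Hside : forall rho th k, ra <= rho <= rb -> Rabs k <= / 32 -> / 32 <= Rabs k ->
    polar W (mu * rho) th = mu ^ 2 * (n + k) ->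
    Rabs (rho ^ 2 / 2 - n - k) <= / 10000000).
  { intros rho th k Hr Hk1 Hk2 HWk. rewrite PW in HWk by lra.
    apply Rmult_eq_reg_l in HWk; [| nra].
    replace (rho ^ 2 / 2 - n - k) with (- (mu * w rho th)) by lra. rewrite Rabs_Ropp. now apply Hwb. }
  (* [rc], introduced below, is the radius at which [Q6 (rho^2 / 2)] vanishes; the flux on either
     level is estimated from there. *)
  assert (Hc : sqrt (2 * n) ^ 2 = 2 * n) by (apply pow2_sqrt; lra).
  assert (Hc0 : 0 <= sqrt (2 * n)) by apply sqrt_pos.
  set (rc := sqrt (2 * n)) in *.
  assert (Hrc : ra <= rc <= rb) by (split; nra).
  assert (HQc : Q6 (rc ^ 2 / 2) = 0).
  { rewrite Hc. replace (2 * n / 2) with (INR i) by (unfold n; field). now apply Q6_root. }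
  split.
  - nra.
  - nra.
  - nra.
  - lra.
  - exact Hsg.
  - exact HX1.
  - exact HX2.
  - exact HW.
  - exact Hgrad.
  - intros r th Hr. destruct (Hscale r Hr) as [rho [-> Hrho]]. now apply Hangb.
  - intros r r' th H1 H2 H3.
    destruct (Hscale r ltac:(lra)) as [rho [-> Hrho]]. destruct (Hscale r' ltac:(lra)) as [rho' [-> Hrho']].
    assert (Hlt : rho < rho') by (apply (Rmult_lt_reg_l mu); lra).
    rewrite !PW by lra. apply Rmult_lt_compat_l; [nra |].
    destruct (Bw rho rho' th) as [_ b]; [lra | lra |].
    assert (mu * Rabs (w rho th - w rho' th) <= mu * (M * Rabs (rho - rho'))) by (apply Rmult_le_compat_l; lra).
    rewrite (Rabs_left (rho - rho')) in H by lra.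
    pose proof (Rle_abs (w rho th - w rho' th)).
    assert (mu * (w rho th - w rho' th) <= mu * Rabs (w rho th - w rho' th)) by (apply Rmult_le_compat_l; lra).
    assert (mu * M * (rho' - rho) <= / 10000000 * (rho' - rho)) by (apply Rmult_le_compat_r; lra).
    assert (2 * (rho' - rho) <= (rho' + rho) * (rho' - rho)) by (apply Rmult_le_compat_r; lra).
    nra.
  - intros th. rewrite PW by lra. rewrite Hra2. apply Rmult_lt_compat_l; [nra |].
    pose proof (Hwb ra th ltac:(lra)). pose proof (Rle_abs (mu * w ra th)). fold n. lra.
  - intros th. rewrite PW by lra. rewrite Hrb2. apply Rmult_lt_compat_l; [nra |].
    pose proof (Hwb rb th ltac:(lra)). pose proof (Rle_abs (- (mu * w rb th))) as H0. rewrite Rabs_Ropp in H0.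
    fold n. lra.
  - intros r th Hr HWr. destruct (Hscale r Hr) as [rho [-> Hrho]].
    pose proof (Hside rho th (- / 32) Hrho ltac:(rewrite Rabs_Ropp, Rabs_right; lra)
      ltac:(rewrite Rabs_Ropp, Rabs_right; lra) HWr) as Hq.
    apply Rabs_le_between in Hq.
    assert (rho < rc) by nra.
    pose proof (HQs rho rc ltac:(lra) ltac:(lra) ltac:(lra)) as HQ. rewrite HQc in HQ.
    rewrite PF by lra.
    (* The difference of the values of [rho^2 / 2] is nearly [1/32], and [rc + rho] is at most 8.
       With slope 10 the main part of the flux is at least [|kap| / 16], well above the error
       [|kap| / 100]. *)
    assert (/ 160 <= rc - rho) by nra.
    specialize (HEb rho th Hrho). pose proof (Hsabs (E rho th)).
    assert (sg * (kap * Q6 (rho ^ 2 / 2)) <= - (Rabs kap * (10 * / 160))).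
    { unfold sg. replace (sign kap * (-1) ^ i * (kap * Q6 (rho ^ 2 / 2)))
        with (- ((sign kap * kap) * ((-1) ^ i * (0 - Q6 (rho ^ 2 / 2))))) by ring.
      rewrite Hsgk. apply Ropp_le_contravar, Rmult_le_compat_l; lra. }
    replace (sg * (lam * (kap * Q6 (rho ^ 2 / 2) + E rho th)))
      with (- (lam * - (sg * (kap * Q6 (rho ^ 2 / 2)) + sg * E rho th))) by ring.
    apply Ropp_lt_gt_0_contravar. apply Rmult_lt_0_compat; lra.
  - intros r th Hr HWr. destruct (Hscale r Hr) as [rho [-> Hrho]].
    pose proof (Hside rho th (/ 32) Hrho ltac:(rewrite Rabs_right; lra)
      ltac:(rewrite Rabs_right; lra) HWr) as Hq.
    apply Rabs_le_between in Hq.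
    assert (rc < rho) by nra.
    pose proof (HQs rc rho ltac:(lra) ltac:(lra) ltac:(lra)) as HQ. rewrite HQc in HQ.
    rewrite PF by lra.
    assert (/ 160 <= rho - rc) by nra.
    specialize (HEb rho th Hrho). pose proof (Hsabs (E rho th)).
    assert (Rabs kap * (10 * / 160) <= sg * (kap * Q6 (rho ^ 2 / 2))).
    { unfold sg. replace (sign kap * (-1) ^ i * (kap * Q6 (rho ^ 2 / 2)))
        with ((sign kap * kap) * ((-1) ^ i * (Q6 (rho ^ 2 / 2) - 0))) by ring.
      rewrite Hsgk. apply Rmult_le_compat_l; lra. }
    replace (sg * (lam * (kap * Q6 (rho ^ 2 / 2) + E rho th)))
      with (lam * (sg * (kap * Q6 (rho ^ 2 / 2)) + sg * E rho th)) by ring.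
    apply Rmult_lt_0_compat; lra.
  - intros r r' th H1 H2 H3 _ _.
    destruct (Hscale r ltac:(lra)) as [rho [-> Hrho]]. destruct (Hscale r' ltac:(lra)) as [rho' [-> Hrho']].
    assert (Hlt : rho < rho') by (apply (Rmult_lt_reg_l mu); lra).
    rewrite !PF by lra.
    set (N := fun rho => sg * (kap * Q6 (rho ^ 2 / 2) + E rho th)).
    assert (HN : N rho / ang_speed X1 X2 (mu * rho) th < N rho' / ang_speed X1 X2 (mu * rho') th).
    { pose proof (Hangb rho th Hrho). pose proof (Hangb rho' th Hrho').
      (* The numerator gains at least [10 - 1/100] times [|kap|] per unit of radius, hence 9 times;
         its bound [2 * 10^6 |kap|] times the Lipschitz constant [4 * 10^-7] of the angular speed
         stays below [|kap|]. *)
      apply (quotient_increment _ _ _ _ (9 * Rabs kap * (rho' - rho)) (Rabs kap * (rho' - rho))); try lra.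
      - pose proof (HQs rho rho' ltac:(lra) ltac:(lra) ltac:(lra)) as HQ.
        destruct (BE rho' rho th) as [_ b]; [lra | lra |]. rewrite (Rabs_right (rho' - rho)) in b by lra.
        pose proof (Hsabs (E rho' th - E rho th)).
        assert (Rabs kap * (10 * (rho' - rho)) <= Rabs kap * ((-1) ^ i * (Q6 (rho' ^ 2 / 2) - Q6 (rho ^ 2 / 2))))
          by (apply Rmult_le_compat_l; lra).
        rewrite <- Hsgk in H5 at 2.
        assert (0 < Rabs kap * (rho' - rho)) by (apply Rmult_lt_0_compat; lra).
        unfold N, sg. unfold sg in H4. lra.
      - pose proof (Hangd rho rho' th Hrho Hrho') as Hd.
        rewrite (Rabs_right (rho' - rho)) in Hd by lra.
        assert (HNb : Rabs (N rho) <= Rabs kap * 2000000).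
        { unfold N. rewrite Rabs_mult. replace (Rabs sg) with 1
            by (destruct Hsg as [-> | ->]; [rewrite Rabs_right | rewrite Rabs_left]; lra).
          rewrite Rmult_1_l. eapply Rle_trans; [apply Rabs_triang |]. rewrite Rabs_mult.
          pose proof (Q6_bound (rho ^ 2 / 2) ltac:(split; nra)).
          assert (Rabs kap * Rabs (Q6 (rho ^ 2 / 2)) <= Rabs kap * 1000000) by (apply Rmult_le_compat_l; lra).
          specialize (HEb rho th Hrho). lra. }
        assert (4 * (mu * M) * (rho' - rho) <= 4 * / 10000000 * (rho' - rho))
          by (apply Rmult_le_compat_r; lra).
        replace (Rabs kap * (rho' - rho)) with ((Rabs kap * 2000000) * (/ 2000000 * (rho' - rho))) by field.
        apply Rmult_le_compat; try apply Rabs_pos; lra.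
      - assert (0 < Rabs kap * (rho' - rho)) by (apply Rmult_lt_0_compat; lra).
        assert (9 * Rabs kap * (rho' - rho) * / 2 <= 9 * Rabs kap * (rho' - rho) * ang_speed X1 X2 (mu * rho) th)
          by (apply Rmult_le_compat_l; lra). lra. }
    apply (Rmult_lt_compat_l lam) in HN; [| exact Hlam].
    unfold N, Rdiv in *. lra.
Qed.

(** The windows of values of [W] are disjoint, so cycles from different rings have no common
    point. *)
Lemma scaled_limit_cycles X1 X2 W W1 W2 (x1 x2 w E : R -> R -> R) (mu lam kap M : R) :
  bipoly X1 -> bipoly X2 -> bipoly W -> has_gradient W W1 W2 ->
  0 < mu -> 0 < lam -> kap <> 0 -> 0 <= M -> mu * M <= / 10000000 ->
  (forall rho th, 1 <= rho <= 4 -> polar X1 (mu * rho) th = mu * (- (rho * sin th) + mu * x1 rho th)) ->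
  (forall rho th, 1 <= rho <= 4 -> polar X2 (mu * rho) th = mu * (- (rho * cos th) + mu * x2 rho th)) ->
  (forall rho th, 1 <= rho <= 4 -> polar W (mu * rho) th = mu ^ 2 * (rho ^ 2 / 2 + mu * w rho th)) ->
  (forall rho th, 1 <= rho <= 4 ->
     flux X1 X2 W1 W2 (mu * rho) th = lam * (kap * Q6 (rho ^ 2 / 2) + E rho th)) ->
  ring_bounded M x1 -> ring_bounded M x2 -> ring_bounded M w -> ring_bounded (Rabs kap / 100) E ->
  has_limit_cycles_in 6 X1 X2 (4 * mu).
Proof.
  intros HX1 HX2 HW Hgrad Hmu Hlam Hkap HM HmuM P1 P2 PW PF B1 B2 Bw BE.
  (* The cycle numbered [i] from 0 sits at the level [i + 1], hence [S i]; from 6 on the chosen set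
     is arbitrary. *)
  assert (Hex : forall i, exists G, (i < 6)%nat -> limit_cycle X1 X2 G /\ (exists a b, G a b) /\
     forall a b, G a b -> mu ^ 2 * (INR (S i) - / 32) < W a b < mu ^ 2 * (INR (S i) + / 32) /\
        a ^ 2 + b ^ 2 < (4 * mu) ^ 2).
  { intros i. destruct (Compare_dec.lt_dec i 6) as [Hi|Hi]; [| now exists (fun _ _ => True)].
    destruct (annulus_limit_cycle _ _ _ _ _ _ _ _ _ _ _
      (scaled_annulus X1 X2 W W1 W2 x1 x2 w E mu lam kap M (S i) HX1 HX2 HW Hgrad Hmu Hlam Hkap HM HmuM
        P1 P2 PW PF B1 B2 Bw BE ltac:(lia))) as [G [HG1 [HG2 HG3]]].
    exists G. intros _. split; [exact HG1 | split; [exact HG2 |]].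
    intros a b Hab. destruct (HG3 a b Hab) as [Hw Hn]. split; [exact Hw |].
    eapply Rlt_le_trans; [exact Hn |]. rewrite !Rpow_mult_distr.
    assert (HS : INR (S i) <= 6).
    { replace 6 with (INR 6) by (simpl; ring). apply le_INR. lia. }
    pose proof (pos_INR i). assert (1 <= INR (S i)) by (rewrite S_INR; lra).
    rewrite pow2_sqrt by lra. rewrite Rmult_comm. apply Rmult_le_compat_r; [nra | lra]. }
  destruct (functional_choice _ Hex) as [L HL]. exists L. split.
  - intros i Hi. destruct (HL i Hi) as [H1 [_ H3]]. split; [exact H1 |].
    intros a b Hab. now apply H3.
  - intros i j [Hij Hj] Hsame.
    destruct (HL i ltac:(lia)) as [_ [[a [b Hab]] Hi3]]. destruct (HL j Hj) as [_ [_ Hj3]].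
    destruct (Hi3 a b Hab) as [Hi _]. apply Hsame in Hab. destruct (Hj3 a b Hab) as [Hj' _].
    assert (INR (S i) + 1 <= INR (S j)) by (rewrite <- S_INR; apply le_INR; lia).
    assert (mu ^ 2 * (INR (S i) + / 32) < mu ^ 2 * (INR (S j) - / 32)) by (apply Rmult_lt_compat_l; nra).
    lra.
Qed.

(** * Computing with polynomials *)

(** The evaluation [ev] of the coefficients is a parameter, so that nested lists represent
    polynomials in several variables. *)
Fixpoint pev {C : Type} (ev : C -> R) (x : R) (l : list C) : R :=
  match l with [] => 0 | c :: l' => ev c + x * pev ev x l' end.

Fixpoint padd {C : Type} (add : C -> C -> C) (l m : list C) : list C :=
  match l, m with
  | [], _ => m
  | _, [] => l
  | a :: l', b :: m' => add a b :: padd add l' m'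
  end.

Fixpoint pmul {C : Type} (zero : C) (add mul : C -> C -> C) (l m : list C) : list C :=
  match l with
  | [] => []
  | a :: l' => padd add (map (mul a) m) (zero :: pmul zero add mul l' m)
  end.

(* [(c + x l)' = l + x l'] needs no integer multiples of coefficients. *)
Fixpoint pderiv {C : Type} (zero : C) (add : C -> C -> C) (l : list C) : list C :=
  match l with
  | [] => []
  | _ :: l' => padd add l' (zero :: pderiv zero add l')
  end.

Lemma pev_add {C : Type} (ev : C -> R) (add : C -> C -> C) (x : R) :
  (forall a b, ev (add a b) = ev a + ev b) ->
  forall l m, pev ev x (padd add l m) = pev ev x l + pev ev x m.
Proof.
  intros H. induction l as [|a l IH]; intros [|b m]; simpl; try ring.
  rewrite H, IH. ring.
Qed.

Lemma pev_mul {C : Type} (ev : C -> R) (zero : C) (add mul : C -> C -> C) (x : R) :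
  ev zero = 0 ->
  (forall a b, ev (add a b) = ev a + ev b) -> (forall a b, ev (mul a b) = ev a * ev b) ->
  forall l m, pev ev x (pmul zero add mul l m) = pev ev x l * pev ev x m.
Proof.
  intros H0 Ha Hm l m. induction l as [|a l IH]; simpl; [ring |].
  rewrite pev_add by exact Ha. simpl. rewrite IH, H0.
  replace (pev ev x (map (mul a) m)) with (ev a * pev ev x m); [ring |].
  clear IH. induction m as [|b m IHm]; simpl; [ring |]. rewrite Hm, <- IHm. ring.
Qed.

(* Polynomials in [r], then in [(r,u)], then in [(r,u,v)], with rational coefficients. *)
Definition qadd (a b : Q) : Q := Qred (a + b).
Definition qmul (a b : Q) : Q := Qred (a * b).
Definition Qr := list Q.
Definition Qru := list Qr.
Definition Qruv := list Qru.
Definition add1 : Qr -> Qr -> Qr := padd qadd.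
Definition mul1 : Qr -> Qr -> Qr := pmul 0%Q qadd qmul.
Definition add2 : Qru -> Qru -> Qru := padd add1.
Definition mul2 : Qru -> Qru -> Qru := pmul [] add1 mul1.
Definition add3 : Qruv -> Qruv -> Qruv := padd add2.
Definition mul3 : Qruv -> Qruv -> Qruv := pmul [] add2 mul2.
Definition du : Qruv -> Qruv := map (pderiv [] add1).
Definition dv : Qruv -> Qruv := pderiv [] add2.
Definition cst1 (c : Qr) : Qruv := [[c]].
Definition neg3 (p : Qruv) : Qruv := mul3 (cst1 [(-1)%Q]) p.

Definition ev1 (r : R) : Qr -> R := pev Q2R r.
Definition ev2 (r u : R) : Qru -> R := pev (ev1 r) u.
Definition ev3 (r u v : R) : Qruv -> R := pev (ev2 r u) v.

Lemma Q2R_add (a b : Q) : Q2R (qadd a b) = Q2R a + Q2R b.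
Proof. unfold qadd. rewrite (Qeq_eqR _ _ (Qred_correct _)). apply Q2R_plus. Qed.
Lemma Q2R_mul (a b : Q) : Q2R (qmul a b) = Q2R a * Q2R b.
Proof. unfold qmul. rewrite (Qeq_eqR _ _ (Qred_correct _)). apply Q2R_mult. Qed.
Lemma Q2R_0 : Q2R 0 = 0.
Proof. unfold Q2R. simpl. ring. Qed.

Lemma ev1_add r a b : ev1 r (add1 a b) = ev1 r a + ev1 r b.
Proof. apply pev_add, Q2R_add. Qed.
Lemma ev1_mul r a b : ev1 r (mul1 a b) = ev1 r a * ev1 r b.
Proof. apply pev_mul; [apply Q2R_0 | apply Q2R_add | apply Q2R_mul]. Qed.
Lemma ev2_add r u a b : ev2 r u (add2 a b) = ev2 r u a + ev2 r u b.
Proof. apply pev_add, ev1_add. Qed.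
Lemma ev2_mul r u a b : ev2 r u (mul2 a b) = ev2 r u a * ev2 r u b.
Proof. apply pev_mul; [reflexivity | apply ev1_add | apply ev1_mul]. Qed.
Lemma ev3_add r u v a b : ev3 r u v (add3 a b) = ev3 r u v a + ev3 r u v b.
Proof. apply pev_add, ev2_add. Qed.
Lemma ev3_mul r u v a b : ev3 r u v (mul3 a b) = ev3 r u v a * ev3 r u v b.
Proof. apply pev_mul; [reflexivity | apply ev2_add | apply ev2_mul]. Qed.
Lemma ev3_cst r u v c : ev3 r u v (cst1 c) = ev1 r c.
Proof. unfold ev3, cst1. simpl. unfold ev2. simpl. ring. Qed.
Lemma ev3_neg r u v p : ev3 r u v (neg3 p) = - ev3 r u v p.
Proof.
  unfold neg3. rewrite ev3_mul, ev3_cst. unfold ev1, Q2R. simpl. field.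
Qed.

Lemma has_gradient_const (c : R) : has_gradient (fun _ _ => c) (fun _ _ => 0) (fun _ _ => 0).
Proof.
  intros x y t dx dy _ _. eapply is_derive_val; [apply @is_derive_const |].
  unfold zero; simpl; ring.
Qed.

Lemma has_gradient_fst : has_gradient (fun a _ => a) (fun _ _ => 1) (fun _ _ => 0).
Proof.
  intros x y t dx dy Hx _. eapply is_derive_val; [apply Hx | ring].
Qed.

Lemma has_gradient_snd : has_gradient (fun _ b => b) (fun _ _ => 0) (fun _ _ => 1).
Proof.
  intros x y t dx dy _ Hy. eapply is_derive_val; [apply Hy | ring].
Qed.

Lemma has_gradient_plus (f f1 f2 g g1 g2 : R -> R -> R) :
  has_gradient f f1 f2 -> has_gradient g g1 g2 ->
  has_gradient (fun a b => f a b + g a b) (fun a b => f1 a b + g1 a b) (fun a b => f2 a b + g2 a b).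
Proof.
  intros Hf Hg x y t dx dy Hx Hy. eapply is_derive_val.
  - apply (is_derive_Rplus (fun s => f (x s) (y s)) (fun s => g (x s) (y s))).
    + exact (Hf x y t dx dy Hx Hy).
    + exact (Hg x y t dx dy Hx Hy).
  - ring.
Qed.

Lemma has_gradient_mult (f f1 f2 g g1 g2 : R -> R -> R) :
  has_gradient f f1 f2 -> has_gradient g g1 g2 ->
  has_gradient (fun a b => f a b * g a b) (fun a b => f1 a b * g a b + f a b * g1 a b)
    (fun a b => f2 a b * g a b + f a b * g2 a b).
Proof.
  intros Hf Hg x y t dx dy Hx Hy. eapply is_derive_val.
  - apply (is_derive_Rmult (fun s => f (x s) (y s)) (fun s => g (x s) (y s))).
    + exact (Hf x y t dx dy Hx Hy).
    + exact (Hg x y t dx dy Hx Hy).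
  - simpl. ring.
Qed.

Lemma has_gradient_ext (f f1 f2 g g1 g2 : R -> R -> R) :
  (forall a b, f a b = g a b) -> (forall a b, f1 a b = g1 a b) -> (forall a b, f2 a b = g2 a b) ->
  has_gradient f f1 f2 -> has_gradient g g1 g2.
Proof.
  intros E E1 E2 H x y t dx dy Hx Hy. rewrite <- E1, <- E2.
  apply (is_derive_ext (fun s => f (x s) (y s))); [intros; apply E | now apply H].
Qed.

Lemma ev2_gradient (r : R) (p : Qru) :
  has_gradient (fun u _ => ev2 r u p) (fun u _ => ev2 r u (pderiv [] add1 p)) (fun _ _ => 0).
Proof.
  induction p as [|c p IH].
  - exact (has_gradient_const 0).
  - pose proof (has_gradient_plus _ _ _ _ _ _ (has_gradient_const (ev1 r c))
      (has_gradient_mult _ _ _ _ _ _ has_gradient_fst IH)) as G.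
    eapply has_gradient_ext; [| | | exact G]; intros a b; cbv beta.
    + reflexivity.
    + assert (E : ev2 r a (pderiv [] add1 (c :: p)) = ev2 r a p + a * ev2 r a (pderiv [] add1 p)).
      { change (pderiv [] add1 (c :: p)) with (add2 p ([] :: pderiv [] add1 p)). rewrite ev2_add.
        change (ev2 r a ([] :: pderiv [] add1 p)) with (0 + a * ev2 r a (pderiv [] add1 p)). ring. }
      rewrite E. ring.
    + ring.
Qed.

Lemma ev3_gradient (r : R) (p : Qruv) :
  has_gradient (fun u v => ev3 r u v p) (fun u v => ev3 r u v (du p)) (fun u v => ev3 r u v (dv p)).
Proof.
  induction p as [|c p IH].
  - exact (has_gradient_const 0).
  - pose proof (has_gradient_plus _ _ _ _ _ _ (ev2_gradient r c)
      (has_gradient_mult _ _ _ _ _ _ has_gradient_snd IH)) as G.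
    eapply has_gradient_ext; [| | | exact G]; intros a b; cbv beta.
    + reflexivity.
    + change (ev3 r a b (du (c :: p))) with (ev2 r a (pderiv [] add1 c) + b * ev3 r a b (du p)). ring.
    + assert (E : ev3 r a b (dv (c :: p)) = ev3 r a b p + b * ev3 r a b (dv p)).
      { change (dv (c :: p)) with (add3 p ([] :: dv p)). rewrite ev3_add.
        change (ev3 r a b ([] :: dv p)) with (0 + b * ev3 r a b (dv p)). ring. }
      rewrite E. ring.
Qed.

Lemma ev2_bipoly (r : R) (p : Qru) : bipoly (fun u _ => ev2 r u p).
Proof.
  induction p as [|c p IH]; [exact (bipoly_const 0) |].
  apply (bipoly_plus (fun _ _ => ev1 r c) (fun u _ => u * ev2 r u p)); [exact (bipoly_const _) |].
  apply (bipoly_mult (fun u _ => u)); [apply bipoly_fst | exact IH].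
Qed.

Lemma ev3_bipoly (r : R) (p : Qruv) : bipoly (fun u v => ev3 r u v p).
Proof.
  induction p as [|c p IH]; [exact (bipoly_const 0) |].
  apply (bipoly_plus (fun u _ => ev2 r u c) (fun u v => v * ev3 r u v p)); [apply ev2_bipoly |].
  apply (bipoly_mult (fun _ v => v)); [apply bipoly_snd | exact IH].
Qed.

Lemma unif_lip_pev {C P : Type} (D : P -> R -> Prop) (ev : P -> R -> C -> R) (a : P -> R -> R) :
  (forall c, unif_lip D (fun p x => ev p x c)) -> unif_lip D a ->
  forall l, unif_lip D (fun p x => pev (ev p x) (a p x) l).
Proof.
  intros He Ha. induction l as [|c l IH]; simpl; [apply unif_lip_num |].
  apply (unif_lip_plus D (fun p x => ev p x c)); [apply He |].
  now apply (unif_lip_mult D a).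
Qed.

Lemma unif_lip_ev3 {P : Type} (D : P -> R -> Prop) (r a b : P -> R -> R) (p : Qruv) :
  unif_lip D r -> unif_lip D a -> unif_lip D b ->
  unif_lip D (fun q x => ev3 (r q x) (a q x) (b q x) p).
Proof.
  intros Hr Ha Hb. unfold ev3, ev2, ev1.
  apply (unif_lip_pev D (fun q x => pev (pev Q2R (r q x)) (a q x)) b); [| exact Hb]. intros c2.
  apply (unif_lip_pev D (fun q x => pev Q2R (r q x)) a); [| exact Ha]. intros c1.
  apply (unif_lip_pev D (fun _ _ => Q2R) r); [| exact Hr]. intros c. apply unif_lip_num.
Qed.

(* [rem3 r mu a b K p] is the cofactor of [mu ^ K] in [p(mu a, mu b)] when the terms of degree less than [K] vanish. *)
Definition zero1 (c : Qr) : bool := forallb (fun q => Qeq_bool q 0) c.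

Fixpoint low2 (n : nat) (p : Qru) : bool :=
  match n, p with
  | O, _ | _, [] => true
  | S m, c :: p' => zero1 c && low2 m p'
  end.

Fixpoint low3 (n : nat) (p : Qruv) : bool :=
  match n, p with
  | O, _ | _, [] => true
  | S m, c :: p' => low2 n c && low3 m p'
  end.

Fixpoint rem2 (r mu a : R) (n : nat) (p : Qru) : R :=
  match n, p with
  | O, _ => ev2 r (mu * a) p
  | S _, [] => 0
  | S m, _ :: p' => a * rem2 r mu a m p'
  end.

Fixpoint rem3 (r mu a b : R) (n : nat) (p : Qruv) : R :=
  match n, p with
  | O, _ => ev3 r (mu * a) (mu * b) p
  | S _, [] => 0
  | S m, c :: p' => rem2 r mu a n c + b * rem3 r mu a b m p'
  end.

Lemma zero1_correct (r : R) (c : Qr) : zero1 c = true -> ev1 r c = 0.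
Proof.
  induction c as [|q c IH]; [reflexivity |]. simpl. intros H. apply andb_prop in H.
  destruct H as [Hq Hc]. unfold ev1 in *. simpl. rewrite (IH Hc).
  apply Qeq_bool_eq in Hq. rewrite (Qeq_eqR _ _ Hq), Q2R_0. ring.
Qed.

Lemma low2_correct (r mu a : R) (p : Qru) (n : nat) :
  low2 n p = true -> ev2 r (mu * a) p = mu ^ n * rem2 r mu a n p.
Proof.
  revert n. induction p as [|c p IH]; intros [|n] H; simpl in *; try ring.
  - unfold ev2. simpl. ring.
  - apply andb_prop in H. destruct H as [Hc Hp]. unfold ev2 in *. simpl.
    rewrite (zero1_correct r c Hc), (IH n Hp). ring.
Qed.

Lemma low3_correct (r mu a b : R) (p : Qruv) (n : nat) :
  low3 n p = true -> ev3 r (mu * a) (mu * b) p = mu ^ n * rem3 r mu a b n p.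
Proof.
  revert n. induction p as [|c p IH]; intros [|n] H; try (simpl; ring).
  - unfold ev3. simpl. ring.
  - cbn [low3] in H. apply andb_prop in H. destruct H as [Hc Hp]. cbn [rem3].
    unfold ev3 in *. cbn [pev].
    rewrite (low2_correct r mu a c (S n) Hc), (IH n Hp). simpl. ring.
Qed.

(** The factor [mu^n] was removed syntactically and not by division, so the cofactor is controlled
    down to [mu = 0]. *)
Lemma unif_lip_rem3 {P : Type} (D : P -> R -> Prop) (r mu a b : P -> R -> R) (n : nat) (p : Qruv) :
  unif_lip D r -> unif_lip D mu -> unif_lip D a -> unif_lip D b ->
  unif_lip D (fun q x => rem3 (r q x) (mu q x) (a q x) (b q x) n p).
Proof.
  intros Hr Hmu Ha Hb.
  assert (H2 : forall n p, unif_lip D (fun q x => rem2 (r q x) (mu q x) (a q x) n p)).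
  { clear n p. induction n as [|n IH]; intros p.
    - apply (unif_lip_ext D (fun q x => ev3 (r q x) (mu q x * a q x) 0 [p])).
      { intros q x _. unfold ev3. destruct p; simpl; ring. }
      apply (unif_lip_ev3 D r (fun q x => mu q x * a q x) (fun _ _ => 0)); auto.
      + now apply (unif_lip_mult D mu a).
      + apply unif_lip_num.
    - destruct p as [|c p]; simpl; [apply unif_lip_num |].
      apply (unif_lip_mult D a); auto. }
  revert p. induction n as [|n IH]; intros p.
  - apply (unif_lip_ext D (fun q x => ev3 (r q x) (mu q x * a q x) (mu q x * b q x) p)).
    { intros q x _. destruct p; reflexivity. }
    apply (unif_lip_ev3 D r (fun q x => mu q x * a q x) (fun q x => mu q x * b q x)); auto.
    + now apply (unif_lip_mult D mu a).
    + now apply (unif_lip_mult D mu b).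
  - destruct p as [|c p]; cbn [rem3]; [apply unif_lip_num |].
    apply (unif_lip_plus D (fun q x => rem2 (r q x) (mu q x) (a q x) (S n) c)); [apply H2 |].
    now apply (unif_lip_mult D b).
Qed.

(** * The homological equation *)

Definition mono (i j : nat) (c : Qr) : Qruv := repeat [] j ++ [repeat [] i ++ [c]].

Definition H3 : Qruv :=
  [[[]; []; [1 # 2]; [-1 # 2]; [1 # 8]]; []; [[1 # 2]]; [[1]; [-1]]; [[0; 1]]]%Q.

Definition Hu3 : Qruv := du H3.
Definition Hv3 : Qruv := dv H3.

(* [p_k] has divergence [1, u, v, v^2, u v, u^2] for [k = 0, ..., 5]. *)
Definition div_primitive (k : nat) : Qruv :=
  match k with
  | 0%nat => mono 1 0 [1%Q] | 1%nat => mono 2 0 [(1 # 2)%Q] | 2%nat => mono 1 1 [1%Q]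
  | 3%nat => mono 1 2 [1%Q] | 4%nat => mono 2 1 [(1 # 2)%Q] | _ => mono 3 0 [(1 # 3)%Q]
  end.

(* Row [k] lists the polynomials [M_1(r), ..., M_7(r)] for which
   [H_u p_k + {G_k, H} = M_1 H + ... + M_7 H^7 + O(|(u,v)|^15)] is solvable for [G_k]. *)
Definition melnikov_table : list (list Qr) := Eval compute in (
  [   [[1];
    [-9 # 2; 3 # 2];
    [-107; 132; -13];
    [-66087 # 16; 121899 # 16; -51903 # 16; 2211 # 16];
    [-704829 # 4; 1718793 # 4; -2547615 # 8; 274005 # 4; -13011 # 8];
    [-252566697 # 32; 768052119 # 32; -100601865 # 4; 41262843 # 4; -43035627 # 32; 651213 # 32];
    [-5851030041 # 16; 2666657241 # 2; -28862664567 # 16; 4395610773 # 4; -4619287605 # 16; 50593563 # 2; -4244463 # 16]];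
   [[];
    [3 # 4];
    [-83 # 16; 3 # 2];
    [-19959 # 128; 10113 # 64; -381 # 32];
    [-5412765 # 1024; 565461 # 64; -421467 # 128; 1917 # 16];
    [-831466617 # 4096; 957162711 # 2048; -82505325 # 256; 8175921 # 128; -86931 # 64];
    [-137847396687 # 16384; 50477325885 # 2048; -50628508545 # 2048; 617258487 # 64; -304560621 # 256; 529281 # 32]];
   [[];
    [-3 # 2];
    [-51 # 4; 13];
    [-16461 # 64; 6807 # 16; -2211 # 16];
    [-765801 # 128; 13884; -304299 # 32; 13011 # 8];
    [-276914565 # 2048; 108686331 # 256; -58624575 # 128; 5967105 # 32; -651213 # 32];
    [-9213282549 # 4096; 10488392901 # 1024; -4312427337 # 256; 48091917 # 4; -219296973 # 64; 4244463 # 16]];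
   [[];
    [1 # 2];
    [9 # 2; -1];
    [1327 # 16; -303 # 4; 57 # 16];
    [29565 # 16; -21585 # 8; 12657 # 16; -51 # 8];
    [1257897 # 32; -1197537 # 16; 151905 # 4; -59751 # 16; -5337 # 32];
    [16578177 # 32; -14477709 # 16; 745431 # 4; 2184573 # 8; -3071817 # 32; 67437 # 16]];
   [[];
    [];
    [-1 # 4];
    [759 # 64; 23 # 16];
    [56607 # 128; -2535 # 8; -345 # 32];
    [33220155 # 2048; -5984469 # 256; 839409 # 128; 2955 # 32];
    [2571521931 # 4096; -1352193915 # 1024; 203999607 # 256; -988653 # 8; -54495 # 64]];
   [[];
    [1 # 2];
    [-11 # 8; 1];
    [-4623 # 64; 2721 # 32; -127 # 16];
    [-1366365 # 512; 153117 # 32; -123795 # 64; 639 # 8];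
    [-221115129 # 2048; 265714263 # 1024; -23988429 # 128; 2507289 # 64; -28977 # 32];
    [-38228662095 # 8192; 14397730749 # 1024; -14869904769 # 1024; 187041759 # 32; -95688885 # 128; 176427 # 16]]])%Q.

Definition melnikov (k : nat) : list Qr := nth k melnikov_table [].

Fixpoint energy3 (M : list Qr) : Qruv :=
  match M with [] => [] | c :: M' => mul3 H3 (add3 (cst1 c) (energy3 M')) end.

Definition coeff (p : Qruv) (i j : nat) : Qr := nth i (nth j p []) [].

Definition hom_part (n : nat) (p : Qruv) : Qruv :=
  map (fun j => repeat [] (n - j) ++ [coeff p (n - j) j]) (seq 0 (S n)).

Definition scale1 (q : Q) (c : Qr) : Qr := mul1 [q] c.
Definition qnat (n : nat) : Q := inject_Z (Z.of_nat n).

(* Coefficient of [u^i v^j], [i + j = n], in [v g_u - u g_v = f]: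
   [(i+1) g_(i+1,j-1) - (j+1) g_(i-1,j+1) = f_(i,j)]. *)
Fixpoint solve_up (n : nat) (f : Qruv) (j fuel : nat) (before : Qr) : list (nat * Qr) :=
  match fuel with
  | O => []
  | S fuel' =>
      let g := scale1 (/ qnat (j + 1))%Q
        (add1 (scale1 (qnat (n - j + 1)) before) (scale1 (-1)%Q (coeff f (n - j) j))) in
      (j + 1, g)%nat :: solve_up n f (j + 2) fuel' g
  end.

Fixpoint solve_down (n : nat) (f : Qruv) (j fuel : nat) (after : Qr) : list (nat * Qr) :=
  match fuel with
  | O => []
  | S fuel' =>
      let g := scale1 (/ qnat (n - j + 1))%Q
        (add1 (scale1 (qnat (j + 1)) after) (coeff f (n - j) j)) in
      (j - 1, g)%nat :: solve_down n f (j - 2) fuel' g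
  end.

(** The rotation derivative links coefficients whose [j] differ by 2, which splits the system into
    two chains. For odd [n] both chains are determined, one from each end. For even [n] the kernel,
    spanned by [(u^2 + v^2)^(n/2)], is fixed by a zero coefficient of [u^n], and the equation at
    [v^n] is a solvability condition, met because the [M] polynomials have been subtracted. *)
Definition solve_hom (n : nat) (f : Qruv) : Qruv :=
  let sols := solve_up n f 0 (n - n / 2) [] ++
    (if Nat.even n then solve_up n f 1 (n / 2) [] else solve_down n f n (S (n / 2)) []) in
  fold_right (fun jg acc => add3 (mono (n - fst jg) (fst jg) (snd jg)) acc) [] sols.

Definition bracket3 (g : Qruv) : Qruv := add3 (mul3 (du g) Hv3) (neg3 (mul3 (dv g) Hu3)).

(** Clears one degree at a time. As [H] starts with [(u^2 + v^2) / 2], the bracket of a form of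
    degree [n] consists of its rotation derivative, of degree [n], and of higher terms, so degrees
    already cleared stay clear. *)
Fixpoint normal_form (fuel n : nat) (cur : Qruv) : Qruv :=
  match fuel with
  | O => []
  | S fuel' =>
      let g := solve_hom n (neg3 (hom_part n cur)) in
      add3 g (normal_form fuel' (S n) (add3 cur (bracket3 g)))
  end.

Definition G3 (k : nat) : Qruv :=
  normal_form 14 1 (add3 (mul3 Hu3 (div_primitive k)) (neg3 (energy3 (melnikov k)))).

Definition remainder3 (k : nat) : Qruv :=
  add3 (add3 (mul3 Hu3 (div_primitive k)) (neg3 (energy3 (melnikov k)))) (bracket3 (G3 k)).

(** This evaluation certifies the table and the solver together: for each of the six model fields no
    term of degree below 15 is left. *)
Lemma remainder3_low : forallb (fun k => low3 15 (remainder3 k)) (seq 0 6) = true.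
Proof. vm_compute. reflexivity. Qed.

Fixpoint energy_poly (r : R) (M : list Qr) (h : R) : R :=
  match M with [] => 0 | c :: M' => h * (ev1 r c + energy_poly r M' h) end.

Lemma ev3_H (r u v : R) : ev3 r u v H3 = H r u v.
Proof.
  cbv [ev3 ev2 ev1 H3 pev H]. unfold Q2R. simpl. field.
Qed.

Definition Hu (r u v : R) : R := u - 3 / 2 * u ^ 2 + / 2 * u ^ 3 - v ^ 3.
Definition Hv (r u v : R) : R := v + 3 * v ^ 2 - 3 * u * v ^ 2 + 4 * r * v ^ 3.

Lemma ev3_Hu (r u v : R) : ev3 r u v Hu3 = Hu r u v.
Proof.
  let t := eval vm_compute in Hu3 in change Hu3 with t.
  cbv [ev3 ev2 ev1 pev Hu]. unfold Q2R. simpl. field.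
Qed.

Lemma ev3_Hv (r u v : R) : ev3 r u v Hv3 = Hv r u v.
Proof.
  let t := eval vm_compute in Hv3 in change Hv3 with t.
  cbv [ev3 ev2 ev1 pev Hv]. unfold Q2R. simpl. field.
Qed.

Lemma H_u_explicit (r u v : R) : H_u r u v = Hu r u v.
Proof.
  apply is_derive_unique. unfold H, Hu. auto_derive; [easy | simpl; field].
Qed.

Lemma H_v_explicit (r u v : R) : H_v r u v = Hv r u v.
Proof.
  apply is_derive_unique. unfold H, Hv. auto_derive; [easy | simpl; field].
Qed.

Lemma ev3_energy (r u v : R) (M : list Qr) :
  ev3 r u v (energy3 M) = energy_poly r M (H r u v).
Proof.
  induction M as [|c M IH]; [reflexivity |]. simpl.
  rewrite ev3_mul, ev3_add, ev3_cst, ev3_H, IH. reflexivity.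
Qed.

(** Stated for arbitrary [M], [g] and [p], which keeps the large computed polynomials closed; the
    smallness of the last term comes from [remainder_order]. *)
Lemma homological_identity (M : list Qr) (g p : Qruv) (r u v : R) :
  Hu r u v * ev3 r u v p + ev3 r u v (du g) * Hv r u v - ev3 r u v (dv g) * Hu r u v
  = energy_poly r M (H r u v)
    + ev3 r u v (add3 (add3 (mul3 Hu3 p) (neg3 (energy3 M))) (bracket3 g)).
Proof.
  unfold bracket3.
  rewrite !ev3_add, !ev3_neg, !ev3_mul, ev3_energy, ev3_Hu, ev3_Hv. ring.
Qed.

Lemma homological_equation (k : nat) (r u v : R) :
  Hu r u v * ev3 r u v (div_primitive k)
  + ev3 r u v (du (G3 k)) * Hv r u v - ev3 r u v (dv (G3 k)) * Hu r u v
  = energy_poly r (melnikov k) (H r u v) + ev3 r u v (remainder3 k).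
Proof. exact (homological_identity (melnikov k) (G3 k) (div_primitive k) r u v). Qed.

Lemma remainder_order (k : nat) (r mu a b : R) : (k < 6)%nat ->
  ev3 r (mu * a) (mu * b) (remainder3 k) = mu ^ 15 * rem3 r mu a b 15 (remainder3 k).
Proof.
  intros Hk. apply low3_correct.
  pose proof remainder3_low as A. rewrite forallb_forall in A. apply A.
  apply in_seq. lia.
Qed.

(** * Choice of the parameters *)

(* Once [c00], [c02], [c11] are eliminated, the equations [m_4 = T4], [m_5 = T5] read
   [elim_a c10 + elim_b c20 + elim_e c01 + elim_t = T]. *)
Definition elim_a4 (r : R) : R :=
  - 216735/256 + 5525/16 * r.
Definition elim_b4 (r : R) : R :=
  - 55535/128 + 1775/8 * r.
Definition elim_a5 (r : R) : R :=
  - 29874879/1024 + 2132493/64 * r - 7767 * r^2.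
Definition elim_b5 (r : R) : R :=
  - 7633503/512 + 590961/32 * r - 5007 * r^2.
Definition elim_e4 (r : R) : R :=
  435/16 + 5415/8 * r - 70 * r^2.
Definition elim_e5 (r : R) : R :=
  28395/32 + 360459/16 * r - 39687/2 * r^2 + 1176 * r^3.
Definition elim_t4 (r T1 T2 T3 : R) : R :=
  (- 209235/32 + 368005/32 * r - 22635/8 * r^2 + 70 * r^3) * T1 + (9485/16 - 1557/8 * r - 35/8 *
  r^2) * T2 + (- 759/16 - 23/4 * r) * T3.
Definition elim_t5 (r T1 T2 T3 : R) : R :=
  (- 17741655/64 + 43383201/64 * r - 7309617/16 * r^2 + 148047/2 * r^3 - 1176 * r^4) * T1 +
  (627723/32 - 325467/16 * r + 3729 * r^2 + 147/2 * r^3) * T2 + (- 56607/32 + 2535/2 * r + 345/8 *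
  r^2) * T3.
Definition elim_det (r : R) : R := elim_a4 r * elim_b5 r - elim_a5 r * elim_b4 r.
(** Once [m_1, ..., m_5] vanish, [m_6] and [m_7] are [quot6 f_poly] and [quot6 cof7], up to
    numerical constants and the common factor [c01 / elim_det]. *)
Definition quot6 (r : R) : R :=
  - 7 + 4 * r + 4 * r^2.
Definition cof7 (r : R) : R :=
  754402395063 - 731722940397 * r - 1629692127604 * r^2 - 444092265984 * r^3 + 727765002240 * r^4 +
  1340741582848 * r^5 - 620371378176 * r^6.
Definition f_slope (r : R) : R :=
  - 459924741 - 4187166208 * r - 4793534976 * r^2 - 433455104 * r^3 + 6909788160 * r^4.
(* The next five lemmas are Bezout relations with [f_poly]. *)
Lemma elim_a4_nonzero (r : R) : f_poly r = 0 -> - 43347 + 17680 * r <> 0.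
Proof.
  intros Hf Hg.
  assert (E : (
    6589787063762500) * f_poly r + (
    - 12352096206944755030533 - 5107985951676687827020 * r - 2401676205534287988800 * r^2 -
    1222485836898182272000 * r^3 - 515090866856417280000 * r^4) * (- 43347 + 17680 * r) = 540572284476639482545151451) by (unfold f_poly; ring).
  rewrite Hf, Hg in E. lra.
Qed.

Lemma elim_cubic_nonzero (r : R) : f_poly r = 0 -> 2770317 - 11417834 * r + 11442688 * r^2 + 442880 * r^3 <> 0.
Proof.
  intros Hf Hg.
  assert (E : (
    492208144080406360919460315564959686197182 - 940188122235446790244171468243578717431488 * r -
    35756873827273843856669372042281822215680 * r^2) * f_poly r + (
    - 137256674045097577941444780075891910630146687 - 218964663792905686915572015447744122536159904
    * r - 109565597750818961560473010885351539729456640 * r^2 +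
    42231859816576938585526435005810819827310592 * r^3 +
    111575335716361403250768950493313743916695552 * r^4) * (2770317 - 11417834 * r + 11442688 * r^2 + 442880 * r^3) = 4121251266764471229683005690694603251702574168463) by (unfold f_poly; ring).
  rewrite Hf, Hg in E. lra.
Qed.

Lemma f_slope_nonzero (r : R) : f_poly r = 0 -> f_slope r <> 0.
Proof.
  intros Hf Hg.
  assert (E : (
    456318804866476373179690992593164429536344579051 -
    83572683720678160250013380385540985456507527336 * r +
    25227569910761230877144021912151467674095456256 * r^2 -
    357310551126164939134097404959329839860726282240 * r^3) * f_poly r + (
    - 48463928557019706545662454722623094571859366150 -
    156999082480632013449350626135884892178009417827 * r -
    16326965157218397664542499776226364357514792536 * r^2 -
    6166229107655378393114070298113419423204752384 * r^3 +
    71462110225232987826819480991865967972145256448 * r^4) * (f_slope r) = 378629493710588036122796617600943601556153351348234008531) by (unfold f_poly, f_slope; ring).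
  rewrite Hf, Hg in E. lra.
Qed.

Lemma quot6_nonzero (r : R) : f_poly r = 0 -> quot6 r <> 0.
Proof.
  intros Hf Hg.
  assert (E : (
    - 1667000752 - 799751100 * r) * f_poly r + (
    - 803799595465610795 - 439004255905028864 * r - 159055068458299904 * r^2 + 277959556593647616 *
    r^3 + 276305534086348800 * r^4) * (quot6 r) = 4324834895744850653) by (unfold f_poly, quot6; ring).
  rewrite Hf, Hg in E. lra.
Qed.

Lemma cof7_nonzero (r : R) : f_poly r = 0 -> cof7 r <> 0.
Proof.
  intros Hf Hg.
  assert (E : (
    - 624283211593092244566800109309218229980526142594678207877791196106293 -
    1308418250288640084993397877780807997478959349943653519236936494471396 * r -
    6867214511224882078070770552189480275617446117933354412195027122693632 * r^2 +
    6052937676284546811893119264537692627982030858886488062737729872689152 * r^3 +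
    2210826673715730045496771068591977524542830786327795605087789106266112 * r^4 -
    1486858315061476113325721068598684075015006651006846017246483366281216 * r^5) * f_poly r + (
    1049154440941587722540305733752779071953830026332584147053556236161 +
    1991393435163014491097152505341233734962329961321281351952596341760 * r +
    8776215247885157716704831431116677649591310919323657931136395434496 * r^2 -
    1973613110964960148553338641906214222496247318159565281973501362176 * r^3 -
    3312169562437365737087891187213472884744011720306550433744589094912 * r^4) * (cof7 r) = 303981344324921995124452715724908779262129804251897130025829927607529880443660) by (unfold f_poly, cof7; ring).
  rewrite Hf, Hg in E. lra.
Qed.


(** The index counts from 0, so this is [m_(j+1)]. *)
Definition mcoef (j : nat) (d : nat -> R) (r : R) : R :=
  d 0%nat * ev1 r (nth j (melnikov 0) []) + d 1%nat * ev1 r (nth j (melnikov 1) [])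
  + d 2%nat * ev1 r (nth j (melnikov 2) []) + d 3%nat * ev1 r (nth j (melnikov 3) [])
  + d 4%nat * ev1 r (nth j (melnikov 4) []) + d 5%nat * ev1 r (nth j (melnikov 5) []).

(* Cramer's rule for the two equations in [(c10, c20)] left after eliminating [c00], [c02] and [c11]. *)
Definition sol10 (c T1 T2 T3 T4 T5 r : R) : R :=
  ((T4 - elim_e4 r * c - elim_t4 r T1 T2 T3) * elim_b5 r
   - (T5 - elim_e5 r * c - elim_t5 r T1 T2 T3) * elim_b4 r) / elim_det r.
Definition sol20 (c T1 T2 T3 T4 T5 r : R) : R :=
  (elim_a4 r * (T5 - elim_e5 r * c - elim_t5 r T1 T2 T3)
   - elim_a5 r * (T4 - elim_e4 r * c - elim_t4 r T1 T2 T3)) / elim_det r.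

(** The first three equations are triangular in [c00], [c02], [c11]. With all targets [T] equal to 0
    the entries 0, 3 and 4 become the formulas that define [delta_0]. *)
Definition sol (c T1 T2 T3 T4 T5 r : R) (k : nat) : R :=
  let c10 := sol10 c T1 T2 T3 T4 T5 r in
  let c20 := sol20 c T1 T2 T3 T4 T5 r in
  match k with
  | 0%nat => T1
  | 1%nat => c10
  | 2%nat => c
  | 3%nat => - (3/2) * c10 + 3 * c - c20 + (9 - 3 * r) * T1 + 2 * T2
  | 4%nat => (12 * r - 191/4) * c10 + (40 * r + 3) * c + (8 * r - 47/2) * c20
             + (- 266 + 438 * r - 40 * r^2) * T1 + (36 - 8 * r) * T2 - 4 * T3
  | _ => c20
  end.

Ltac unfold_mcoef :=
  cbv [mcoef sol melnikov melnikov_table nth ev1 pev Q2R Qnum Qden].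

Lemma sol_cramer (c T1 T2 T3 T4 T5 r : R) : elim_det r <> 0 ->
  elim_a4 r * sol10 c T1 T2 T3 T4 T5 r + elim_b4 r * sol20 c T1 T2 T3 T4 T5 r
    = T4 - elim_e4 r * c - elim_t4 r T1 T2 T3 /\
  elim_a5 r * sol10 c T1 T2 T3 T4 T5 r + elim_b5 r * sol20 c T1 T2 T3 T4 T5 r
    = T5 - elim_e5 r * c - elim_t5 r T1 T2 T3.
Proof.
  intros H. unfold sol10, sol20. unfold elim_det in *.
  generalize (elim_t4 r T1 T2 T3) (elim_t5 r T1 T2 T3).
  revert H. generalize (elim_a4 r) (elim_b4 r) (elim_a5 r) (elim_b5 r) (elim_e4 r) (elim_e5 r).
  intros. split; field; assumption.
Qed.

Lemma mcoef_sol (c T1 T2 T3 T4 T5 r : R) : elim_det r <> 0 ->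
  let d := sol c T1 T2 T3 T4 T5 r in
  mcoef 0 d r = T1 /\ mcoef 1 d r = T2 /\ mcoef 2 d r = T3 /\ mcoef 3 d r = T4 /\ mcoef 4 d r = T5.
Proof.
  intros H d. destruct (sol_cramer c T1 T2 T3 T4 T5 r H) as [E4 E5].
  unfold d. unfold_mcoef.
  revert E4 E5. generalize (sol10 c T1 T2 T3 T4 T5 r) (sol20 c T1 T2 T3 T4 T5 r). intros x y E4 E5.
  unfold elim_a4, elim_b4, elim_a5, elim_b5, elim_e4, elim_e5, elim_t4, elim_t5 in *.
  split; [field | split; [field | split; [field | split]]].
  - apply Rminus_diag_uniq. apply Rminus_diag_eq in E4. etransitivity; [| exact E4]. field.
  - apply Rminus_diag_uniq. apply Rminus_diag_eq in E5. etransitivity; [| exact E5]. field.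
Qed.

(** The origin of [f]: with [m_1, ..., m_5] cleared, [m_6] is a multiple of [f_poly r], so a root of
    [f] clears it too, while the factors [quot6] and [cof7] of [m_7] do not vanish at such a
    root. *)
Lemma mcoef_6_7_sol (c r : R) : elim_det r <> 0 ->
  mcoef 5 (sol c 0 0 0 0 0 r) r = c * (2205/262144 * quot6 r * f_poly r / elim_det r) /\
  mcoef 6 (sol c 0 0 0 0 0 r) r = c * (315/524288 * quot6 r * cof7 r / elim_det r).
Proof.
  intros H. unfold_mcoef.
  unfold sol10, sol20, elim_t4, elim_t5.
  assert (Hd : elim_det r = - (105/8192) * (2770317 - 11417834 * r + 11442688 * r^2 + 442880 * r^3))
    by (unfold elim_det, elim_a4, elim_b4, elim_a5, elim_b5; field).
  rewrite Hd in *.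
  unfold quot6, f_poly, cof7, elim_a4, elim_b4, elim_a5, elim_b5, elim_e4, elim_e5.
  split; field; intros E; apply H; rewrite E; ring.
Qed.

Lemma elim_det_cubic (r : R) :
  elim_det r = - (105/8192) * (2770317 - 11417834 * r + 11442688 * r^2 + 442880 * r^3).
Proof. unfold elim_det, elim_a4, elim_b4, elim_a5, elim_b5. field. Qed.

Lemma elim_det_nonzero (r : R) : f_poly r = 0 -> elim_det r <> 0.
Proof.
  intros Hf. rewrite elim_det_cubic. pose proof (elim_cubic_nonzero r Hf). lra.
Qed.

(** The conditions on [delta_0] are the equations [m_1 = ... = m_5 = 0] solved one after the other:
    [c20] agrees with Cramer's rule, and [c10] comes from the equation for [m_4], in which its
    coefficient [elim_a4] is nonzero. *)
Lemma sol_star (rs : R) (ds : nat -> R) :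
  f_poly rs = 0 ->
  ds 0%nat = 0 ->
  ds 3%nat = - (3/2) * ds 1%nat + 3 * ds 2%nat - ds 5%nat ->
  ds 4%nat = (12 * rs - 191/4) * ds 1%nat + (40 * rs + 3) * ds 2%nat
             + (8 * rs - 47/2) * ds 5%nat ->
  ds 1%nat = 2 / (17680 * rs - 43347) *
             ((1792 * rs^2 - 17328 * rs - 696) * ds 2%nat
              + (11107 - 5680 * rs) * ds 5%nat) ->
  ds 5%nat = (6544683 + 11682846 * rs + 30378720 * rs^2
              - 40278528 * rs^3 - 21471232 * rs^4)
             / (2 * (2770317 - 11417834 * rs + 11442688 * rs^2
                     + 442880 * rs^3)) * ds 2%nat ->
  forall k, (k < 6)%nat -> ds k = sol (ds 2%nat) 0 0 0 0 0 rs k.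
Proof.
  intros Hf H0 H3 H4 H1 H5.
  pose proof (elim_a4_nonzero rs Hf) as Ha. pose proof (elim_cubic_nonzero rs Hf) as Hc.
  assert (E20 : sol20 (ds 2%nat) 0 0 0 0 0 rs = ds 5%nat).
  { rewrite H5. unfold sol20, elim_t4, elim_t5. rewrite elim_det_cubic.
    unfold elim_a4, elim_b4, elim_a5, elim_b5, elim_e4, elim_e5. field. lra. }
  assert (E10 : sol10 (ds 2%nat) 0 0 0 0 0 rs = ds 1%nat).
  { destruct (sol_cramer (ds 2%nat) 0 0 0 0 0 rs (elim_det_nonzero rs Hf)) as [E4 _].
    rewrite E20 in E4. rewrite H1.
    apply (Rmult_eq_reg_l (elim_a4 rs)); [| unfold elim_a4; lra].
    replace (elim_a4 rs * sol10 (ds 2%nat) 0 0 0 0 0 rs)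
      with (0 - elim_e4 rs * ds 2%nat - elim_t4 rs 0 0 0 - elim_b4 rs * ds 5%nat) by lra.
    unfold elim_a4, elim_e4, elim_t4, elim_b4. field. lra. }
  intros k Hk.
  destruct k as [|[|[|[|[|[|k]]]]]]; try lia; unfold sol; rewrite ?E10, ?E20; auto.
  - rewrite H3. ring.
  - rewrite H4. ring.
Qed.

(** With [s = mu^4] this isolates the response to the targets: it enters [m_6] with a factor [mu^4],
    beyond the leading order [mu^2]. *)
Lemma sol_linear (s c T1 T2 T3 T4 T5 r : R) (k : nat) : elim_det r <> 0 ->
  sol c (s * T1) (s * T2) (s * T3) (s * T4) (s * T5) r k
  = sol c 0 0 0 0 0 r k + s * sol 0 T1 T2 T3 T4 T5 r k.
Proof.
  intros H.
  assert (E10 : sol10 c (s * T1) (s * T2) (s * T3) (s * T4) (s * T5) r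
    = sol10 c 0 0 0 0 0 r + s * sol10 0 T1 T2 T3 T4 T5 r).
  { unfold sol10, elim_t4, elim_t5. field. exact H. }
  assert (E20 : sol20 c (s * T1) (s * T2) (s * T3) (s * T4) (s * T5) r
    = sol20 c 0 0 0 0 0 r + s * sol20 0 T1 T2 T3 T4 T5 r).
  { unfold sol20, elim_t4, elim_t5. field. exact H. }
  destruct k as [|[|[|[|[|k]]]]]; unfold sol; rewrite ?E10, ?E20; field.
Qed.

Lemma mcoef_linear (j : nat) (s r : R) (d e g : nat -> R) :
  (forall k, g k = d k + s * e k) -> mcoef j g r = mcoef j d r + s * mcoef j e r.
Proof. intros E. unfold mcoef. rewrite !E. ring. Qed.

Lemma sol_continuous (c : R) (T1 T2 T3 T4 T5 r : R -> R) (x : R) (k : nat) :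
  continuous T1 x -> continuous T2 x -> continuous T3 x -> continuous T4 x -> continuous T5 x ->
  continuous r x -> elim_det (r x) <> 0 ->
  continuous (fun y => sol c (T1 y) (T2 y) (T3 y) (T4 y) (T5 y) (r y) k) x.
Proof.
  intros H1 H2 H3 H4 H5 Hr Hd.
  assert (C10 : continuous (fun y => sol10 c (T1 y) (T2 y) (T3 y) (T4 y) (T5 y) (r y)) x).
  { unfold sol10. apply continuous_Rdiv; [exact Hd | |].
    - unfold elim_e4, elim_e5, elim_t4, elim_t5, elim_b4, elim_b5. cont.
    - unfold elim_det, elim_a4, elim_a5, elim_b4, elim_b5. cont. }
  assert (C20 : continuous (fun y => sol20 c (T1 y) (T2 y) (T3 y) (T4 y) (T5 y) (r y)) x).
  { unfold sol20. apply continuous_Rdiv; [exact Hd | |].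
    - unfold elim_e4, elim_e5, elim_t4, elim_t5, elim_a4, elim_a5. cont.
    - unfold elim_det, elim_a4, elim_a5, elim_b4, elim_b5. cont. }
  destruct k as [|[|[|[|[|k]]]]]; unfold sol; cont.
Qed.

Lemma ev1_continuous (l : Qr) (r : R -> R) (x : R) :
  continuous r x -> continuous (fun y => ev1 (r y) l) x.
Proof.
  intros Hr. unfold ev1. induction l as [|q l IH]; simpl; [apply continuous_const |]. cont.
Qed.

Lemma mcoef_continuous (j : nat) (d : R -> nat -> R) (r : R -> R) (x : R) :
  (forall k, continuous (fun y => d y k) x) -> continuous r x ->
  continuous (fun y => mcoef j (d y) (r y)) x.
Proof.
  intros Hd Hr. unfold mcoef.
  repeat apply continuous_Rplus; apply continuous_Rmult; auto; now apply ev1_continuous.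
Qed.

(** The difference quotient is an explicit polynomial, so near a root [f_poly] can be divided by the
    increment without losing continuity at 0. *)
Lemma f_poly_taylor (r h : R) : f_poly (r + h) = f_poly r + h * (f_slope r + h *
  (- 2093583104 - 1597844992 * (3 * r + h) - 108363776 * (6 * r^2 + 4 * r * h + h^2)
   + 1381957632 * (10 * r^3 + 10 * r^2 * h + 5 * r * h^2 + h^3))).
Proof. unfold f_poly, f_slope. ring. Qed.

Lemma continuous_at_right (f : R -> R) (l tau : R) :
  continuous f 0 -> f 0 = l -> 0 < tau -> at_right 0 (fun x => Rabs (f x - l) < tau).
Proof.
  intros Hc <- Ht. apply continuity_pt_filterlim in Hc. destruct (Hc tau Ht) as [m [Hm H]].
  exists (mkposreal m Hm). intros x Hx Hx0. apply H. split; [split; [exact I | lra] | exact Hx].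
Qed.

(** [kap] is the value of [m_7] at the unperturbed parameters. Five targets are met exactly; the
    errors [e6] and [e7] in the other two are small because all quantities are continuous in [mu] at
    0. *)
Lemma parameter_choice (rs : R) (ds : nat -> R) :
  f_poly rs = 0 -> ds 2%nat <> 0 ->
  (forall k, (k < 6)%nat -> ds k = sol (ds 2%nat) 0 0 0 0 0 rs k) ->
  exists kap, kap <> 0 /\ forall tau, 0 < tau -> exists m, 0 < m /\ forall mu, 0 < mu < m ->
    exists (d : nat -> R) (r e6 e7 : R),
      (forall k, (k < 6)%nat -> Rabs (d k - ds k) < tau) /\ Rabs (r - rs) < tau /\
      mcoef 0 d r = 720 * kap * mu ^ 12 /\ mcoef 1 d r = - (1764) * kap * mu ^ 10 /\
      mcoef 2 d r = 1624 * kap * mu ^ 8 /\ mcoef 3 d r = - (735) * kap * mu ^ 6 /\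
      mcoef 4 d r = 175 * kap * mu ^ 4 /\ mcoef 5 d r = (- (21) * kap + e6) * mu ^ 2 /\
      mcoef 6 d r = kap + e7 /\ Rabs e6 < tau /\ Rabs e7 < tau.
Proof.
  intros Hf Hc Hds.
  pose proof (elim_det_nonzero rs Hf) as Hdet. pose proof (quot6_nonzero rs Hf) as Hq.
  pose proof (cof7_nonzero rs Hf) as H7. pose proof (f_slope_nonzero rs Hf) as Hs.
  set (c := ds 2%nat) in *.
  set (kap := c * (315/524288 * quot6 rs * cof7 rs / elim_det rs)).
  assert (Hinv : / elim_det rs <> 0) by now apply Rinv_neq_0_compat.
  assert (Hkap : kap <> 0).
  { unfold kap, Rdiv. repeat apply Rmult_integral_contrapositive_currified; auto; lra. }
  set (slope := c * (2205/262144 * quot6 rs * f_slope rs / elim_det rs)).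
  assert (Hslope : slope <> 0).
  { unfold slope, Rdiv. repeat apply Rmult_integral_contrapositive_currified; auto; lra. }
  exists kap. split; [exact Hkap |]. intros tau Htau.
  (* To leading order [m_6] is [slope bet mu^2]; this [bet] makes it [-21 kap mu^2]. *)
  set (bet := - (21) * kap / slope).
  set (r := fun mu => rs + bet * mu ^ 2).
  assert (Hr0 : r 0 = rs) by (unfold r; ring).
  assert (Hrc : continuous r 0) by (unfold r; cont).
  (* The common factor [mu^4] of the five targets is split off for the use of [sol_linear]. *)
  set (d := fun mu => sol c (mu ^ 4 * (720 * kap * mu ^ 8)) (mu ^ 4 * (- (1764) * kap * mu ^ 6))
    (mu ^ 4 * (1624 * kap * mu ^ 4)) (mu ^ 4 * (- (735) * kap * mu ^ 2)) (mu ^ 4 * (175 * kap)) (r mu)).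
  set (dh := fun mu => sol 0 (720 * kap * mu ^ 8) (- (1764) * kap * mu ^ 6)
    (1624 * kap * mu ^ 4) (- (735) * kap * mu ^ 2) (175 * kap) (r mu)).
  assert (Hdet0 : elim_det (r 0) <> 0) by now rewrite Hr0.
  assert (Hdc : forall k, continuous (fun mu => d mu k) 0).
  { intros k. unfold d.
    apply (sol_continuous c (fun mu => mu ^ 4 * (720 * kap * mu ^ 8)) (fun mu => mu ^ 4 * (- (1764) * kap * mu ^ 6))
      (fun mu => mu ^ 4 * (1624 * kap * mu ^ 4)) (fun mu => mu ^ 4 * (- (735) * kap * mu ^ 2))
      (fun mu => mu ^ 4 * (175 * kap)) r); auto; cont. }
  assert (Hdhc : forall k, continuous (fun mu => dh mu k) 0).
  { intros k. unfold dh.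
    apply (sol_continuous 0 (fun mu => 720 * kap * mu ^ 8) (fun mu => - (1764) * kap * mu ^ 6)
      (fun mu => 1624 * kap * mu ^ 4) (fun mu => - (735) * kap * mu ^ 2)
      (fun mu => 175 * kap) r); auto; cont. }
  assert (Hd0 : forall k, (k < 6)%nat -> d 0 k = ds k).
  { intros k Hk. rewrite Hds by exact Hk. unfold d. rewrite Hr0. f_equal; ring. }
  assert (Hdetc : continuous (fun mu => elim_det (r mu)) 0).
  { unfold elim_det, elim_a4, elim_a5, elim_b4, elim_b5. cont. }
  set (ft := fun mu => f_slope rs + bet * mu ^ 2 *
    (- 2093583104 - 1597844992 * (3 * rs + bet * mu ^ 2) - 108363776 * (6 * rs^2 + 4 * rs * (bet * mu ^ 2) + (bet * mu ^ 2)^2)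
     + 1381957632 * (10 * rs^3 + 10 * rs^2 * (bet * mu ^ 2) + 5 * rs * (bet * mu ^ 2)^2 + (bet * mu ^ 2)^3))).
  assert (Hft : forall mu, f_poly (r mu) = bet * mu ^ 2 * ft mu).
  { intros mu. unfold r, ft. rewrite f_poly_taylor, Hf. ring. }
  (* [h6] is [m_6 / mu^2] written without dividing by [mu], hence continuous at 0. *)
  set (h6 := fun mu => c * (2205/262144 * quot6 (r mu) * (bet * ft mu) / elim_det (r mu))
     + mu ^ 2 * mcoef 5 (dh mu) (r mu)).
  assert (Hh6c : continuous h6 0).
  { unfold h6. apply continuous_Rplus.
    - apply continuous_Rmult; [apply continuous_const |]. apply continuous_Rdiv; auto.
      unfold quot6, ft. cont.
    - apply continuous_Rmult; [cont |]. now apply mcoef_continuous. }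
  assert (Hh60 : h6 0 = - (21) * kap).
  { unfold h6. rewrite Hr0. replace (ft 0) with (f_slope rs) by (unfold ft; ring).
    replace (c * (2205 / 262144 * quot6 rs * (bet * f_slope rs) / elim_det rs)) with (bet * slope)
      by (unfold slope, Rdiv; ring).
    unfold bet. simpl. field. exact Hslope. }
  assert (Hh7c : continuous (fun mu => mcoef 6 (d mu) (r mu)) 0) by now apply mcoef_continuous.
  assert (Hh70 : mcoef 6 (d 0) (r 0) = kap).
  { replace (mcoef 6 (d 0) (r 0)) with (mcoef 6 (sol c 0 0 0 0 0 rs) rs).
    - apply (mcoef_6_7_sol c rs Hdet).
    - rewrite Hr0. unfold mcoef. rewrite <- !Hds, <- !Hd0 by lia. reflexivity. }
  assert (Hev : at_right 0 (fun mu => (forall k, (k < 6)%nat -> Rabs (d mu k - ds k) < tau) /\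
    Rabs (r mu - rs) < tau /\ Rabs (h6 mu - - (21) * kap) < tau /\
    Rabs (mcoef 6 (d mu) (r mu) - kap) < tau /\
    Rabs (elim_det (r mu) - elim_det (r 0)) < Rabs (elim_det (r 0)))).
  { assert (K : forall k, (k < 6)%nat -> at_right 0 (fun mu => Rabs (d mu k - ds k) < tau)).
    { intros k Hk. exact (continuous_at_right _ _ tau (Hdc k) (Hd0 k Hk) Htau). }
    repeat apply filter_and.
    - apply (filter_imp (fun mu => ((((Rabs (d mu 0%nat - ds 0%nat) < tau /\ Rabs (d mu 1%nat - ds 1%nat) < tau) /\
        Rabs (d mu 2%nat - ds 2%nat) < tau) /\ Rabs (d mu 3%nat - ds 3%nat) < tau) /\
        Rabs (d mu 4%nat - ds 4%nat) < tau) /\ Rabs (d mu 5%nat - ds 5%nat) < tau)).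
      + intros mu H k Hk. destruct k as [|[|[|[|[|[|k]]]]]]; try lia; tauto.
      + repeat apply filter_and; apply K; lia.
    - exact (continuous_at_right _ _ tau Hrc Hr0 Htau).
    - exact (continuous_at_right _ _ tau Hh6c Hh60 Htau).
    - exact (continuous_at_right _ _ tau Hh7c Hh70 Htau).
    - exact (continuous_at_right _ _ _ Hdetc eq_refl (Rabs_pos_lt _ Hdet0)). }
  destruct Hev as [m Hm]. exists m. split; [apply cond_pos |]. intros mu Hmu.
  destruct (Hm mu) as (K1 & K2 & K3 & K4 & K5);
    [change (Rabs (mu - 0) < m); rewrite Rminus_0_r, Rabs_right; lra | lra |].
  assert (Hdmu : elim_det (r mu) <> 0).
  { intros E. rewrite E, Rminus_0_l, Rabs_Ropp in K5. lra. }
  exists (d mu), (r mu), (h6 mu - - (21) * kap), (mcoef 6 (d mu) (r mu) - kap).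
  destruct (mcoef_sol c (mu ^ 4 * (720 * kap * mu ^ 8)) (mu ^ 4 * (- (1764) * kap * mu ^ 6))
    (mu ^ 4 * (1624 * kap * mu ^ 4)) (mu ^ 4 * (- (735) * kap * mu ^ 2)) (mu ^ 4 * (175 * kap)) (r mu) Hdmu)
    as [E1 [E2 [E3 [E4 E5]]]].
  split; [| split; [| split; [| split; [| split; [| split; [| split; [| split; [| split; [| split]]]]]]]]].
  - exact K1.
  - exact K2.
  - unfold d. rewrite E1. ring.
  - unfold d. rewrite E2. ring.
  - unfold d. rewrite E3. ring.
  - unfold d. rewrite E4. ring.
  - unfold d. rewrite E5. ring.
  - rewrite (mcoef_linear 5 (mu ^ 4) (r mu) (sol c 0 0 0 0 0 (r mu)) (dh mu)).
    + rewrite (proj1 (mcoef_6_7_sol c (r mu) Hdmu)), Hft. unfold h6. field. exact Hdmu.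
    + intros k. unfold d, dh. now apply sol_linear.
  - ring.
  - exact K3.
  - exact K4.
Qed.

(** * The perturbed system *)

Definition sum6 (d e : nat -> R) : R :=
  d 0%nat * e 0%nat + d 1%nat * e 1%nat + d 2%nat * e 2%nat
  + d 3%nat * e 3%nat + d 4%nat * e 4%nat + d 5%nat * e 5%nat.

Definition cubic (e : nat -> nat -> R) (u v : R) : R :=
  e 0%nat 0%nat + e 0%nat 1%nat * v + e 0%nat 2%nat * v ^ 2 + e 0%nat 3%nat * v ^ 3
  + e 1%nat 0%nat * u + e 1%nat 1%nat * u * v + e 1%nat 2%nat * u * v ^ 2
  + e 2%nat 0%nat * u ^ 2 + e 2%nat 1%nat * u ^ 2 * v + e 3%nat 0%nat * u ^ 3.

Lemma cubic_linear_explicit (p : R -> R -> (nat -> R) -> R) :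
  cubic_linear_in_delta p ->
  exists c : nat -> nat -> nat -> R, forall u v d,
    p u v d = cubic (fun i j => sum6 d (fun k => c k i j)) u v.
Proof.
  intros [c Hc]. exists c. intros u v d. rewrite Hc. unfold cubic, sum6. simpl. ring.
Qed.

Definition div_coeffs (d : nat -> R) (P Q : nat -> nat -> R) : Prop :=
  P 1%nat 0%nat + Q 0%nat 1%nat = d 0%nat /\
  2 * P 2%nat 0%nat + Q 1%nat 1%nat = d 1%nat /\
  P 1%nat 1%nat + 2 * Q 0%nat 2%nat = d 2%nat /\
  P 1%nat 2%nat + 3 * Q 0%nat 3%nat = d 3%nat /\
  2 * P 2%nat 1%nat + 2 * Q 1%nat 2%nat = d 4%nat /\
  3 * P 3%nat 0%nat + Q 2%nat 1%nat = d 5%nat.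

Lemma divergence_coefficients (d : nat -> R) (P Q : nat -> nat -> R) :
  (forall u v, Derive (fun s => cubic P s v) u + Derive (fun s => cubic Q u s) v =
     d 0%nat + d 1%nat * u + d 2%nat * v + d 5%nat * u^2 + d 4%nat * u * v + d 3%nat * v^2) ->
  div_coeffs d P Q.
Proof.
  intros H.
  assert (Eu : forall u v, Derive (fun s => cubic P s v) u =
    P 1%nat 0%nat + P 1%nat 1%nat * v + P 1%nat 2%nat * v ^ 2 + 2 * P 2%nat 0%nat * u
    + 2 * P 2%nat 1%nat * u * v + 3 * P 3%nat 0%nat * u ^ 2).
  { intros u v. apply is_derive_unique. unfold cubic. auto_derive; [easy | simpl; ring]. }
  assert (Ev : forall u v, Derive (fun s => cubic Q u s) v =
    Q 0%nat 1%nat + 2 * Q 0%nat 2%nat * v + 3 * Q 0%nat 3%nat * v ^ 2 + Q 1%nat 1%nat * u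
    + 2 * Q 1%nat 2%nat * u * v + Q 2%nat 1%nat * u ^ 2).
  { intros u v. apply is_derive_unique. unfold cubic. auto_derive; [easy | simpl; ring]. }
  assert (H' : forall u v, P 1%nat 0%nat + P 1%nat 1%nat * v + P 1%nat 2%nat * v ^ 2 + 2 * P 2%nat 0%nat * u
    + 2 * P 2%nat 1%nat * u * v + 3 * P 3%nat 0%nat * u ^ 2 + (Q 0%nat 1%nat + 2 * Q 0%nat 2%nat * v + 3 * Q 0%nat 3%nat * v ^ 2 + Q 1%nat 1%nat * u
    + 2 * Q 1%nat 2%nat * u * v + Q 2%nat 1%nat * u ^ 2) =
     d 0%nat + d 1%nat * u + d 2%nat * v + d 5%nat * u^2 + d 4%nat * u * v + d 3%nat * v^2).
  { intros u v. rewrite <- H, Eu, Ev. reflexivity. }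
  (* These six points separate the coefficients of a quadratic polynomial in two variables. *)
  pose proof (H' 0 0). pose proof (H' 1 0). pose proof (H' (-1) 0).
  pose proof (H' 0 1). pose proof (H' 0 (-1)). pose proof (H' 1 1).
  unfold div_coeffs. repeat split; lra.
Qed.

(* A primitive of the Hamiltonian part [(p - p_0, q)] of the perturbation, [p_0] being the field [sum_k d_k p_k] along [u]. *)
Definition Psi (P Q : nat -> nat -> R) (u v : R) : R :=
  (P 0%nat 0%nat * v + P 0%nat 1%nat / 2 * v ^ 2 + P 0%nat 2%nat / 3 * v ^ 3 + P 0%nat 3%nat / 4 * v ^ 4)
  + (-1) * (Q 0%nat 0%nat * u + Q 0%nat 1%nat * u * v + Q 0%nat 2%nat * u * v ^ 2 + Q 0%nat 3%nat * u * v ^ 3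
     + Q 1%nat 0%nat / 2 * u ^ 2 + Q 1%nat 1%nat / 2 * u ^ 2 * v + Q 1%nat 2%nat / 2 * u ^ 2 * v ^ 2
     + Q 2%nat 0%nat / 3 * u ^ 3 + Q 2%nat 1%nat / 3 * u ^ 3 * v + Q 3%nat 0%nat / 4 * u ^ 4).

Definition prim0 (d : nat -> R) (u v : R) : R :=
  d 0%nat * u + d 1%nat / 2 * u ^ 2 + d 2%nat * u * v + d 3%nat * u * v ^ 2
  + d 4%nat / 2 * u ^ 2 * v + d 5%nat / 3 * u ^ 3.

Lemma has_gradient_pow (f f1 f2 : R -> R -> R) (n : nat) :
  has_gradient f f1 f2 ->
  has_gradient (fun a b => f a b ^ n) (fun a b => INR n * f a b ^ pred n * f1 a b)
    (fun a b => INR n * f a b ^ pred n * f2 a b).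
Proof.
  intros Hf x y t dx dy Hx Hy. eapply is_derive_val.
  - apply (is_derive_pow (fun s => f (x s) (y s)) n t _ (Hf x y t dx dy Hx Hy)).
  - ring.
Qed.

Lemma Psi_gradient (d : nat -> R) (P Q : nat -> nat -> R) : div_coeffs d P Q ->
  has_gradient (Psi P Q) (fun u v => - cubic Q u v) (fun u v => cubic P u v - prim0 d u v).
Proof.
  intros (E0 & E1 & E2 & E3 & E4 & E5).
  (* The gradient is produced by unification from the syntax of [Psi] and afterwards compared with
     the stated one. *)
  eassert (G : has_gradient (Psi P Q) _ _).
  { unfold Psi. repeat match goal with
    | |- has_gradient (fun u v => u) _ _ => exact has_gradient_fst
    | |- has_gradient (fun u v => v) _ _ => exact has_gradient_snd
    | |- has_gradient (fun u v => _ + _) _ _ => refine (has_gradient_plus _ _ _ _ _ _ _ _)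
    | |- has_gradient (fun u v => _ * _) _ _ => refine (has_gradient_mult _ _ _ _ _ _ _ _)
    | |- has_gradient (fun u v => _ ^ _) _ _ => refine (has_gradient_pow _ _ _ _ _)
    | |- has_gradient (fun u v => ?c) _ _ => exact (has_gradient_const c)
    end. }
  eapply has_gradient_ext; [reflexivity | | | exact G]; intros u v; unfold cubic, prim0.
  - cbn [pred INR]. field.
  - rewrite <- E0, <- E1, <- E2, <- E3, <- E4, <- E5. cbn [pred INR]. field.
Qed.

Lemma bipoly_Psi P Q : bipoly (Psi P Q).
Proof. unfold Psi. bipoly_auto. Qed.

Lemma bipoly_cubic e : bipoly (cubic e).
Proof. unfold cubic. bipoly_auto. Qed.

Lemma prim0_sum (d : nat -> R) (r u v : R) :
  prim0 d u v = sum6 d (fun k => ev3 r u v (div_primitive k)).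
Proof.
  unfold prim0, sum6.
  cbv [ev3 ev2 ev1 pev div_primitive mono repeat app]. unfold Q2R. cbn [Qnum Qden]. field.
Qed.

Lemma energy_sum (d : nat -> R) (r h : R) :
  sum6 d (fun k => energy_poly r (melnikov k) h)
  = mcoef 0 d r * h + mcoef 1 d r * h ^ 2 + mcoef 2 d r * h ^ 3 + mcoef 3 d r * h ^ 4
    + mcoef 4 d r * h ^ 5 + mcoef 5 d r * h ^ 6 + mcoef 6 d r * h ^ 7.
Proof.
  unfold sum6, mcoef. cbv [melnikov melnikov_table nth energy_poly].
  generalize (ev1 r). intros e. ring.
Qed.

(** By linearity in [delta] the solutions for the six model fields combine; [Psi + Gsum] is the
    complete correction [G] in [W = H + eps G]. *)
Definition Gsum (d : nat -> R) (r u v : R) : R := sum6 d (fun k => ev3 r u v (G3 k)).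
Definition Gsum_u (d : nat -> R) (r u v : R) : R := sum6 d (fun k => ev3 r u v (du (G3 k))).
Definition Gsum_v (d : nat -> R) (r u v : R) : R := sum6 d (fun k => ev3 r u v (dv (G3 k))).

Lemma sum6_gradient (d : nat -> R) (f f1 f2 : nat -> R -> R -> R) :
  (forall k, has_gradient (f k) (f1 k) (f2 k)) ->
  has_gradient (fun u v => sum6 d (fun k => f k u v)) (fun u v => sum6 d (fun k => f1 k u v))
    (fun u v => sum6 d (fun k => f2 k u v)).
Proof.
  intros H.
  assert (S : forall c k, has_gradient (fun u v => c * f k u v) (fun u v => c * f1 k u v) (fun u v => c * f2 k u v)).
  { intros c k. pose proof (has_gradient_mult _ _ _ _ _ _ (has_gradient_const c) (H k)) as G.
    eapply has_gradient_ext; [| | | exact G]; intros a b; cbv beta; ring. }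
  exact (has_gradient_plus _ _ _ _ _ _ (has_gradient_plus _ _ _ _ _ _ (has_gradient_plus _ _ _ _ _ _
    (has_gradient_plus _ _ _ _ _ _ (has_gradient_plus _ _ _ _ _ _ (S (d 0%nat) 0%nat) (S (d 1%nat) 1%nat))
     (S (d 2%nat) 2%nat)) (S (d 3%nat) 3%nat)) (S (d 4%nat) 4%nat)) (S (d 5%nat) 5%nat)).
Qed.

Lemma Gsum_gradient (d : nat -> R) (r : R) : has_gradient (Gsum d r) (Gsum_u d r) (Gsum_v d r).
Proof.
  exact (sum6_gradient d (fun k u v => ev3 r u v (G3 k)) (fun k u v => ev3 r u v (du (G3 k)))
    (fun k u v => ev3 r u v (dv (G3 k))) (fun k => ev3_gradient r (G3 k))).
Qed.

Lemma sum6_bipoly (d : nat -> R) (f : nat -> R -> R -> R) :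
  (forall k, bipoly (f k)) -> bipoly (fun u v => sum6 d (fun k => f k u v)).
Proof.
  intros H.
  assert (S : forall c k, bipoly (fun u v => c * f k u v)).
  { intros c k. apply (bipoly_mult (fun _ _ => c)); [apply bipoly_const | apply H]. }
  exact (bipoly_plus _ _ (bipoly_plus _ _ (bipoly_plus _ _ (bipoly_plus _ _ (bipoly_plus _ _
    (S (d 0%nat) 0%nat) (S (d 1%nat) 1%nat)) (S (d 2%nat) 2%nat)) (S (d 3%nat) 3%nat)) (S (d 4%nat) 4%nat)) (S (d 5%nat) 5%nat)).
Qed.

(** The terms of order [eps] collapse by the homological equations; the rest, of order [eps^2], is
    the derivative of the correction along [(p, q)]. *)
Lemma flux_algebra (d pk gu gv en re : nat -> R) (hu hv eps p q : R) :
  (forall k, hu * pk k + gu k * hv - gv k * hu = en k + re k) ->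
  (hu + eps * (- q + sum6 d gu)) * (hv + eps * p)
  + (hv + eps * (p - sum6 d pk + sum6 d gv)) * (- hu + eps * q)
  = eps * (sum6 d en + sum6 d re)
    + eps ^ 2 * ((- q + sum6 d gu) * p + (p - sum6 d pk + sum6 d gv) * q).
Proof.
  intros E.
  assert (S : sum6 d en + sum6 d re = hu * sum6 d pk + sum6 d gu * hv - sum6 d gv * hu).
  { transitivity (sum6 d (fun k => en k + re k)); [unfold sum6; ring |].
    unfold sum6. rewrite <- !E. ring. }
  rewrite S. ring.
Qed.

Lemma flux_identity (d : nat -> R) (r eps p q u v : R) :
  (Hu r u v + eps * (- q + Gsum_u d r u v)) * (Hv r u v + eps * p)
  + (Hv r u v + eps * (p - prim0 d u v + Gsum_v d r u v)) * (- Hu r u v + eps * q)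
  = eps * (sum6 d (fun k => energy_poly r (melnikov k) (H r u v)) + sum6 d (fun k => ev3 r u v (remainder3 k)))
    + eps ^ 2 * ((- q + Gsum_u d r u v) * p + (p - prim0 d u v + Gsum_v d r u v) * q).
Proof.
  rewrite (prim0_sum d r u v).
  exact (flux_algebra d (fun k => ev3 r u v (div_primitive k)) (fun k => ev3 r u v (du (G3 k)))
    (fun k => ev3 r u v (dv (G3 k))) (fun k => energy_poly r (melnikov k) (H r u v))
    (fun k => ev3 r u v (remainder3 k)) (Hu r u v) (Hv r u v) eps p q
    (fun k => homological_equation k r u v)).
Qed.

(* Scaled variables [u = mu a], [v = mu b], with [eps = mu ^ 15]. *)
Definition h_tail (r mu a b : R) : R := - / 2 * a ^ 3 + b ^ 3 + mu * (/ 8 * a ^ 4 - a * b ^ 3 + r * b ^ 4).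
Definition h_scaled (r mu a b : R) : R := / 2 * (a ^ 2 + b ^ 2) + mu * h_tail r mu a b.
(** The power 13 here, and 12 in [W_tail], is what remains of [eps = mu^15] after the factors [mu^2]
    and [mu^3] in front of the tails. *)
Definition X1_tail (P : nat -> nat -> R) (r mu a b : R) : R :=
  3 * b ^ 2 - 3 * mu * a * b ^ 2 + 4 * r * mu * b ^ 3 + mu ^ 13 * cubic P (mu * a) (mu * b).
Definition X2_tail (Q : nat -> nat -> R) (r mu a b : R) : R :=
  3 * / 2 * a ^ 2 - / 2 * mu * a ^ 3 + mu * b ^ 3 + mu ^ 13 * cubic Q (mu * a) (mu * b).
Definition W_tail (d : nat -> R) (P Q : nat -> nat -> R) (r mu a b : R) : R :=
  h_tail r mu a b + mu ^ 12 * (Psi P Q (mu * a) (mu * b) + Gsum d r (mu * a) (mu * b)).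

(** The divided difference of [Q6] as a polynomial, hence regular at [x = y] as well. *)
Definition Q6_slope (x y : R) : R :=
  720 - 1764 * (x + y) + 1624 * (x ^ 2 + x * y + y ^ 2)
  - 735 * (x ^ 3 + x ^ 2 * y + x * y ^ 2 + y ^ 3)
  + 175 * (x ^ 4 + x ^ 3 * y + x ^ 2 * y ^ 2 + x * y ^ 3 + y ^ 4)
  - 21 * (x ^ 5 + x ^ 4 * y + x ^ 3 * y ^ 2 + x ^ 2 * y ^ 3 + x * y ^ 4 + y ^ 5)
  + (x ^ 6 + x ^ 5 * y + x ^ 4 * y ^ 2 + x ^ 3 * y ^ 3 + x ^ 2 * y ^ 4 + x * y ^ 5 + y ^ 6).

Lemma Q6_difference (x y : R) : Q6 x - Q6 y = (x - y) * Q6_slope x y.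
Proof. unfold Q6, Q6_slope. ring. Qed.

(** Three sources of error, each smaller than the main part by one power of [mu]: replacing [H] by
    its quadratic part inside [Q6], the truncation at degree 15, and the terms of order [eps^2]. *)
Definition flux_tail (kap : R) (d : nat -> R) (P Q : nat -> nat -> R) (r mu a b : R) : R :=
  kap * h_tail r mu a b * Q6_slope (h_scaled r mu a b) (/ 2 * (a ^ 2 + b ^ 2))
  + sum6 d (fun k => rem3 r mu a b 15 (remainder3 k))
  + ((- cubic Q (mu * a) (mu * b) + Gsum_u d r (mu * a) (mu * b)) * cubic P (mu * a) (mu * b)
     + (cubic P (mu * a) (mu * b) - prim0 d (mu * a) (mu * b) + Gsum_v d r (mu * a) (mu * b))
       * cubic Q (mu * a) (mu * b)).

Record param := { pd : nat -> R; pr : R; pmu : R; pth : R }.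

(** A bounded set of data that includes [mu = 0] and all angles; the constants obtained on it are
    available before [mu] is chosen. *)
Definition near (ds : nat -> R) (rs : R) (p : param) (x : R) : Prop :=
  (forall k, (k < 6)%nat -> Rabs (pd p k - ds k) <= 1) /\ Rabs (pr p - rs) <= 1 /\
  0 <= pmu p <= 1 /\ 1 <= x <= 4.

Definition pa (p : param) (x : R) : R := x * cos (pth p).
Definition pb (p : param) (x : R) : R := - (x * sin (pth p)).

Lemma bounded_near (x y : R) : Rabs (x - y) <= 1 -> Rabs x <= Rabs y + 1.
Proof.
  intros H. replace x with (y + (x - y)) by ring.
  eapply Rle_trans; [apply Rabs_triang | lra].
Qed.

Lemma unif_lip_sum6 {P : Type} (D : P -> R -> Prop) (d : P -> nat -> R) (f : nat -> P -> R -> R) :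
  (forall k, (k < 6)%nat -> unif_lip D (fun p _ => d p k)) ->
  (forall k, unif_lip D (f k)) ->
  unif_lip D (fun p x => sum6 (d p) (fun k => f k p x)).
Proof.
  intros Hd Hf.
  assert (S : forall k, (k < 6)%nat -> unif_lip D (fun p x => d p k * f k p x)).
  { intros k Hk. apply (unif_lip_mult D (fun p _ => d p k)); auto. }
  exact (unif_lip_plus _ _ _ (unif_lip_plus _ _ _ (unif_lip_plus _ _ _ (unif_lip_plus _ _ _ (unif_lip_plus _ _ _
    (S 0%nat ltac:(lia)) (S 1%nat ltac:(lia))) (S 2%nat ltac:(lia))) (S 3%nat ltac:(lia)))
    (S 4%nat ltac:(lia))) (S 5%nat ltac:(lia))).
Qed.

Lemma unif_lip_tails (ds : nat -> R) (rs kap : R) (cp cq : nat -> nat -> nat -> R) :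
  let D := near ds rs in
  let P := fun p i j => sum6 (pd p) (fun k => cp k i j) in
  let Q := fun p i j => sum6 (pd p) (fun k => cq k i j) in
  unif_lip D (fun p x => X1_tail (P p) (pr p) (pmu p) (pa p x) (pb p x)) /\
  unif_lip D (fun p x => X2_tail (Q p) (pr p) (pmu p) (pa p x) (pb p x)) /\
  unif_lip D (fun p x => W_tail (pd p) (P p) (Q p) (pr p) (pmu p) (pa p x) (pb p x)) /\
  unif_lip D (fun p x => flux_tail kap (pd p) (P p) (Q p) (pr p) (pmu p) (pa p x) (pb p x)) /\
  unif_lip D (fun p x => h_scaled (pr p) (pmu p) (pa p x) (pb p x)).
Proof.
  intros D P Q.
  assert (Hd : forall k, (k < 6)%nat -> unif_lip D (fun p _ => pd p k)).
  { intros k Hk. apply (unif_lip_const D (fun p => pd p k) (Rabs (ds k) + 1)).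
    intros p x [H _]. now apply bounded_near, H. }
  assert (Hr : unif_lip D (fun p _ => pr p)).
  { apply (unif_lip_const D (fun p => pr p) (Rabs rs + 1)).
    intros p x (_ & H & _). now apply bounded_near. }
  assert (Hmu : unif_lip D (fun p _ => pmu p)).
  { apply (unif_lip_const D (fun p => pmu p) 1).
    intros p x (_ & _ & H & _). rewrite Rabs_right; lra. }
  assert (Hx : unif_lip D (fun _ x => x)).
  { exists 4. intros p x y (_ & _ & _ & H) _. split; [rewrite Rabs_right; lra |].
    pose proof (Rabs_pos (x - y)). lra. }
  assert (Ha : unif_lip D pa).
  { apply (unif_lip_mult D (fun _ x => x) (fun p _ => cos (pth p))); [exact Hx |].
    apply (unif_lip_const D _ 1). intros; apply Rabs_cos_le. }
  assert (Hb : unif_lip D pb).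
  { apply (unif_lip_opp D (fun p x => x * sin (pth p))).
    apply (unif_lip_mult D (fun _ x => x) (fun p _ => sin (pth p))); [exact Hx |].
    apply (unif_lip_const D _ 1). intros; apply Rabs_sin_le. }
  assert (Ha' : unif_lip D (fun p x => pa p x)) by exact Ha.
  assert (Hb' : unif_lip D (fun p x => pb p x)) by exact Hb.
  assert (Hma : unif_lip D (fun p x => pmu p * pa p x)) by unif_lip_auto.
  assert (Hmb : unif_lip D (fun p x => pmu p * pb p x)) by unif_lip_auto.
  assert (HP : forall i j, unif_lip D (fun p _ => P p i j)).
  { intros i j. apply (unif_lip_sum6 D pd (fun k _ _ => cp k i j) Hd). intros k. apply unif_lip_num. }
  assert (HQ : forall i j, unif_lip D (fun p _ => Q p i j)).
  { intros i j. apply (unif_lip_sum6 D pd (fun k _ _ => cq k i j) Hd). intros k. apply unif_lip_num. }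
  assert (cub : forall e : param -> nat -> nat -> R, (forall i j, unif_lip D (fun p _ => e p i j)) ->
    unif_lip D (fun p x => cubic (e p) (pmu p * pa p x) (pmu p * pb p x))).
  { intros e He. unfold cubic.
    unif_lip_auto. }
  pose proof (cub P HP) as CP. pose proof (cub Q HQ) as CQ.
  assert (HPsi : unif_lip D (fun p x => Psi (P p) (Q p) (pmu p * pa p x) (pmu p * pb p x))).
  { unfold Psi. unif_lip_auto. }
  assert (Hprim : unif_lip D (fun p x => prim0 (pd p) (pmu p * pa p x) (pmu p * pb p x))).
  { unfold prim0. unif_lip_auto. }
  assert (HG : unif_lip D (fun p x => Gsum (pd p) (pr p) (pmu p * pa p x) (pmu p * pb p x))).
  { exact (unif_lip_sum6 D pd (fun k p x => ev3 (pr p) (pmu p * pa p x) (pmu p * pb p x) (G3 k)) Hd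
      (fun k => unif_lip_ev3 D _ _ _ (G3 k) Hr Hma Hmb)). }
  assert (HGu : unif_lip D (fun p x => Gsum_u (pd p) (pr p) (pmu p * pa p x) (pmu p * pb p x))).
  { exact (unif_lip_sum6 D pd (fun k p x => ev3 (pr p) (pmu p * pa p x) (pmu p * pb p x) (du (G3 k))) Hd
      (fun k => unif_lip_ev3 D _ _ _ (du (G3 k)) Hr Hma Hmb)). }
  assert (HGv : unif_lip D (fun p x => Gsum_v (pd p) (pr p) (pmu p * pa p x) (pmu p * pb p x))).
  { exact (unif_lip_sum6 D pd (fun k p x => ev3 (pr p) (pmu p * pa p x) (pmu p * pb p x) (dv (G3 k))) Hd
      (fun k => unif_lip_ev3 D _ _ _ (dv (G3 k)) Hr Hma Hmb)). }
  assert (Hrem : unif_lip D (fun p x => sum6 (pd p) (fun k => rem3 (pr p) (pmu p) (pa p x) (pb p x) 15 (remainder3 k)))).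
  { exact (unif_lip_sum6 D pd (fun k p x => rem3 (pr p) (pmu p) (pa p x) (pb p x) 15 (remainder3 k)) Hd
      (fun k => unif_lip_rem3 D _ _ _ _ 15 (remainder3 k) Hr Hmu Ha Hb)). }
  assert (Hht : unif_lip D (fun p x => h_tail (pr p) (pmu p) (pa p x) (pb p x))).
  { unfold h_tail. unif_lip_auto. }
  assert (Hhs : unif_lip D (fun p x => h_scaled (pr p) (pmu p) (pa p x) (pb p x))).
  { unfold h_scaled. unif_lip_auto. }
  split; [| split; [| split; [| split]]].
  - unfold X1_tail. unif_lip_auto.
  - unfold X2_tail. unif_lip_auto.
  - unfold W_tail. unif_lip_auto.
  - unfold flux_tail. apply unif_lip_plus; [apply unif_lip_plus; [| exact Hrem] |].
    + unfold Q6_slope. unif_lip_auto.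
    + unif_lip_auto.
  - exact Hhs.
Qed.

Lemma H_gradient (r : R) : has_gradient (H r) (Hu r) (Hv r).
Proof.
  apply (has_gradient_ext (fun u v => ev3 r u v H3) (fun u v => ev3 r u v Hu3) (fun u v => ev3 r u v Hv3)).
  - intros; apply ev3_H.
  - intros; apply ev3_Hu.
  - intros; apply ev3_Hv.
  - exact (ev3_gradient r H3).
Qed.

Lemma bipoly_Hu (r : R) : bipoly (Hu r).
Proof. eapply bipoly_ext; [intros; apply ev3_Hu | apply ev3_bipoly]. Qed.
Lemma bipoly_Hv (r : R) : bipoly (Hv r).
Proof. eapply bipoly_ext; [intros; apply ev3_Hv | apply ev3_bipoly]. Qed.
Lemma bipoly_H (r : R) : bipoly (H r).
Proof. eapply bipoly_ext; [intros; apply ev3_H | apply ev3_bipoly]. Qed.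

Lemma bipoly_add_scaled (f g : R -> R -> R) (c : R) :
  bipoly f -> bipoly g -> bipoly (fun u v => f u v + c * g u v).
Proof. intros Hf Hg. bipoly_auto. Qed.

Lemma has_gradient_add_scaled (f f1 f2 g g1 g2 : R -> R -> R) (c : R) :
  has_gradient f f1 f2 -> has_gradient g g1 g2 ->
  has_gradient (fun u v => f u v + c * g u v) (fun u v => f1 u v + c * g1 u v) (fun u v => f2 u v + c * g2 u v).
Proof.
  intros Hf Hg.
  pose proof (has_gradient_plus _ _ _ _ _ _ Hf (has_gradient_mult _ _ _ _ _ _ (has_gradient_const c) Hg)) as G.
  eapply has_gradient_ext; [| | | exact G]; intros a b; cbv beta; ring.
Qed.

Lemma H_scaling (r mu a b : R) : H r (mu * a) (mu * b) = mu ^ 2 * h_scaled r mu a b.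
Proof. unfold H, h_scaled, h_tail. field. Qed.

Lemma remainder_sum (d : nat -> R) (r mu a b : R) :
  sum6 d (fun k => ev3 r (mu * a) (mu * b) (remainder3 k))
  = mu ^ 15 * sum6 d (fun k => rem3 r mu a b 15 (remainder3 k)).
Proof.
  assert (E : forall f g : nat -> R, (forall k, (k < 6)%nat -> f k = mu ^ 15 * g k) ->
    sum6 d f = mu ^ 15 * sum6 d g).
  { intros f g Hfg. unfold sum6. rewrite !Hfg by lia. ring. }
  exact (E (fun k => ev3 r (mu * a) (mu * b) (remainder3 k)) (fun k => rem3 r mu a b 15 (remainder3 k))
    (fun k Hk => remainder_order k r mu a b Hk)).
Qed.

(** The target for [m_j] carries [mu^(14 - 2 j)] and [H^j] carries [mu^(2 j)], so the seven terms
    have equal weight and add up to [kap Q6]; the factor [mu^29] is [eps mu^14]. *)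
Lemma flux_scaling (kap e6 e7 : R) (d : nat -> R) (P Q : nat -> nat -> R) (r mu a b : R) :
  mcoef 0 d r = 720 * kap * mu ^ 12 -> mcoef 1 d r = - (1764) * kap * mu ^ 10 ->
  mcoef 2 d r = 1624 * kap * mu ^ 8 -> mcoef 3 d r = - (735) * kap * mu ^ 6 ->
  mcoef 4 d r = 175 * kap * mu ^ 4 -> mcoef 5 d r = (- (21) * kap + e6) * mu ^ 2 ->
  mcoef 6 d r = kap + e7 ->
  let eps := mu ^ 15 in let u := mu * a in let v := mu * b in
  (Hu r u v + eps * (- cubic Q u v + Gsum_u d r u v)) * (Hv r u v + eps * cubic P u v)
  + (Hv r u v + eps * (cubic P u v - prim0 d u v + Gsum_v d r u v)) * (- Hu r u v + eps * cubic Q u v)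
  = mu ^ 29 * (kap * Q6 (/ 2 * (a ^ 2 + b ^ 2))
      + (mu * flux_tail kap d P Q r mu a b + e6 * h_scaled r mu a b ^ 6 + e7 * h_scaled r mu a b ^ 7)).
Proof.
  intros E0 E1 E2 E3 E4 E5 E6 eps u v.
  rewrite flux_identity, energy_sum, E0, E1, E2, E3, E4, E5, E6. unfold u, v.
  rewrite remainder_sum, H_scaling. unfold flux_tail, eps.
  set (h := h_scaled r mu a b). set (q := / 2 * (a ^ 2 + b ^ 2)).
  (* [h] differs from half the squared radius by [mu h_tail]; the divided difference turns this into
     an error term. *)
  assert (EQ : kap * Q6 h = kap * Q6 q + mu * (kap * h_tail r mu a b * Q6_slope h q)).
  { pose proof (Q6_difference h q) as D. replace (h - q) with (mu * h_tail r mu a b) in D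
      by (unfold h, q, h_scaled; ring).
    replace (Q6 h) with (Q6 q + mu * h_tail r mu a b * Q6_slope h q) by lra. ring. }
  generalize (sum6 d (fun k => rem3 r mu a b 15 (remainder3 k))). intros R1.
  generalize (Gsum_u d r (mu * a) (mu * b)) (Gsum_v d r (mu * a) (mu * b)) (cubic P (mu * a) (mu * b))
    (cubic Q (mu * a) (mu * b)) (prim0 d (mu * a) (mu * b)). intros gu gv p q' p0.
  transitivity (mu ^ 29 * (kap * Q6 h + e6 * h ^ 6 + e7 * h ^ 7 + mu * R1
     + mu * ((- q' + gu) * p + (p - p0 + gv) * q'))).
  - unfold Q6. ring.
  - rewrite EQ. ring.
Qed.

(** * Error bounds on the rings and the six limit cycles *)

Lemma ring_bounded_of_unif_lip {P : Type} (D : P -> R -> Prop) (f : P -> R -> R) (g : R -> R -> R)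
  (p : R -> P) (M N : R) :
  (forall p x y, D p x -> D p y -> Rabs (f p x) <= M /\ Rabs (f p x - f p y) <= M * Rabs (x - y)) ->
  (forall th x, 1 <= x <= 4 -> D (p th) x /\ f (p th) x = g x th) -> M <= N ->
  ring_bounded N g.
Proof.
  intros HM Hg HMN x y th Hx Hy. destruct (Hg th x Hx) as [Dx Ex], (Hg th y Hy) as [Dy Ey].
  destruct (HM (p th) x y Dx Dy) as [A B]. rewrite Ex in A. rewrite Ex, Ey in B. split; [lra |].
  eapply Rle_trans; [exact B |]. apply Rmult_le_compat_r; [apply Rabs_pos | exact HMN].
Qed.

Lemma ring_bounded_plus (A B : R) (f g : R -> R -> R) :
  ring_bounded A f -> ring_bounded B g -> ring_bounded (A + B) (fun x th => f x th + g x th).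
Proof.
  intros Hf Hg x y th Hx Hy. destruct (Hf x y th Hx Hy) as [F1 F2], (Hg x y th Hx Hy) as [G1 G2]. split.
  - eapply Rle_trans; [apply Rabs_triang | lra].
  - replace (f x th + g x th - (f y th + g y th)) with ((f x th - f y th) + (g x th - g y th)) by ring.
    eapply Rle_trans; [apply Rabs_triang | lra].
Qed.

Lemma ring_bounded_scal (A c t : R) (f : R -> R -> R) :
  ring_bounded A f -> Rabs c <= t -> ring_bounded (t * A) (fun x th => c * f x th).
Proof.
  intros Hf Hc x y th Hx Hy. destruct (Hf x y th Hx Hy) as [F1 F2]. split.
  - rewrite Rabs_mult. apply Rmult_le_compat; auto using Rabs_pos.
  - replace (c * f x th - c * f y th) with (c * (f x th - f y th)) by ring.
    rewrite Rabs_mult, Rmult_assoc. apply Rmult_le_compat; auto using Rabs_pos.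
Qed.

Lemma ring_bounded_weaken (A B : R) (f : R -> R -> R) :
  ring_bounded A f -> A <= B -> ring_bounded B f.
Proof.
  intros Hf HAB x y th Hx Hy. destruct (Hf x y th Hx Hy) as [F1 F2]. split; [lra |].
  eapply Rle_trans; [exact F2 |]. apply Rmult_le_compat_r; [apply Rabs_pos | exact HAB].
Qed.

Lemma has_limit_cycles_weaken (N : nat) (F1 F2 : R -> R -> R) (rho rho' : R) :
  0 <= rho <= rho' -> has_limit_cycles_in N F1 F2 rho -> has_limit_cycles_in N F1 F2 rho'.
Proof.
  intros Hr [L [H1 H2]]. exists L. split; [| exact H2].
  intros i Hi. destruct (H1 i Hi) as [A B]. split; [exact A |].
  intros a b Hab. eapply Rlt_le_trans; [apply (B a b Hab) |]. nra.
Qed.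

Lemma positive_lower_bound (l : list R) : (forall x, In x l -> 0 < x) ->
  exists m, 0 < m /\ forall x, In x l -> m < x.
Proof.
  induction l as [|a l IH]; intros Hl.
  - exists 1. split; [lra | intros x []].
  - destruct IH as [m [Hm Hml]]; [intros; apply Hl; now right |].
    assert (Ha : 0 < a) by (apply Hl; now left).
    exists (Rmin (a / 2) m). split; [apply Rmin_glb_lt; lra |].
    intros x [<- | Hx].
    + pose proof (Rmin_l (a / 2) m). lra.
    + pose proof (Rmin_r (a / 2) m). specialize (Hml x Hx). lra.
Qed.

Theorem theorem7 :
  forall (p q : R -> R -> (nat -> R) -> R),
    cubic_linear_in_delta p -> cubic_linear_in_delta q ->
    (forall u v (d : nat -> R),
        Derive (fun s => p s v d) u + Derive (fun s => q u s d) v =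
        d 0%nat + d 1%nat * u + d 2%nat * v + d 5%nat * u^2
        + d 4%nat * u * v + d 3%nat * v^2) ->
  forall (rs : R) (ds : nat -> R),
    f_poly rs = 0 ->
    ds 0%nat = 0 ->
    ds 3%nat = - (3/2) * ds 1%nat + 3 * ds 2%nat - ds 5%nat ->
    ds 2%nat <> 0 ->
    ds 4%nat = (12 * rs - 191/4) * ds 1%nat + (40 * rs + 3) * ds 2%nat
               + (8 * rs - 47/2) * ds 5%nat ->
    ds 1%nat = 2 / (17680 * rs - 43347) *
               ((1792 * rs^2 - 17328 * rs - 696) * ds 2%nat
                + (11107 - 5680 * rs) * ds 5%nat) ->
    ds 5%nat = (6544683 + 11682846 * rs + 30378720 * rs^2
                - 40278528 * rs^3 - 21471232 * rs^4)
               / (2 * (2770317 - 11417834 * rs + 11442688 * rs^2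
                       + 442880 * rs^3)) * ds 2%nat ->
  forall rho eta : R, 0 < rho -> 0 < eta ->
    exists (eps : R) (d : nat -> R) (r : R),
      0 < Rabs eps < eta /\
      (forall k, (k < 6)%nat -> Rabs (d k - ds k) < eta) /\
      Rabs (r - rs) < eta /\
      has_limit_cycles_in 6 (sysF1 p eps d r) (sysF2 q eps d r) rho.
Proof.
  intros p q Hp Hq Hdiv rs ds Hf D0 D3 D2 D4 D1 D5 rho eta Hrho Heta.
  destruct (cubic_linear_explicit p Hp) as [cp Ep]. destruct (cubic_linear_explicit q Hq) as [cq Eq].
  destruct (parameter_choice rs ds Hf D2 (sol_star rs ds Hf D0 D3 D4 D1 D5)) as [kap [Hkap Hpar]].
  destruct (unif_lip_tails ds rs kap cp cq) as ([M1 U1] & [M2 U2] & [M3 U3] & [M4 U4] & U5).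
  destruct (unif_lip_pow _ _ 6 U5) as [M6 U6]. destruct (unif_lip_pow _ _ 7 U5) as [M7 U7].
  set (M := Rabs M1 + Rabs M2 + Rabs M3 + Rabs M4 + Rabs M6 + Rabs M7 + 1).
  assert (HM : 1 <= M /\ M1 <= M /\ M2 <= M /\ M3 <= M /\ M4 <= M /\ M6 <= M /\ M7 <= M).
  { unfold M. pose proof (Rabs_pos M1). pose proof (Rabs_pos M2). pose proof (Rabs_pos M3).
    pose proof (Rabs_pos M4). pose proof (Rabs_pos M6). pose proof (Rabs_pos M7).
    pose proof (Rle_abs M1). pose proof (Rle_abs M2). pose proof (Rle_abs M3).
    pose proof (Rle_abs M4). pose proof (Rle_abs M6). pose proof (Rle_abs M7). repeat split; lra. }
  destruct HM as (HM & HM1 & HM2 & HM3 & HM4 & HM6 & HM7).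
  assert (Hk : 0 < Rabs kap) by now apply Rabs_pos_lt.
  (* The three error terms of the flux share the allowance [|kap| / 100]. *)
  set (small := Rabs kap / 100 / 3 / M).
  assert (Hsmall : 0 < small) by (unfold small; repeat apply Rdiv_lt_0_compat; lra).
  destruct (positive_lower_bound [1; eta; small]) as [tau [Htau Hlt]].
  { intros x Hx. simpl in Hx. repeat (destruct Hx as [<- | Hx]; [lra |]). destruct Hx. }
  assert (Ht1 : tau < 1) by (apply Hlt; simpl; tauto).
  assert (Ht2 : tau < eta) by (apply Hlt; simpl; tauto).
  assert (Ht3 : tau < small) by (apply Hlt; simpl; tauto).
  destruct (Hpar tau Htau) as [m [Hm Hmu]].
  assert (HM7pos : 0 < / 10000000 / M) by (apply Rdiv_lt_0_compat; lra).
  (* Since [m] depends on [tau], [mu] is fixed only now. The last two bounds give [mu M <= 10^-7],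
     as the annulus estimate requires, and place the disc of radius [4 mu] inside the one of radius
     [rho]. *)
  destruct (positive_lower_bound [m; 1; eta; small; / 10000000 / M; rho / 4]) as [mu [Hmu0 Hltm]].
  { intros x Hx. simpl in Hx. repeat (destruct Hx as [<- | Hx]; [lra |]). destruct Hx. }
  assert (Hmm : mu < m) by (apply Hltm; simpl; tauto).
  assert (Hmu1 : mu < 1) by (apply Hltm; simpl; tauto).
  assert (Hmue : mu < eta) by (apply Hltm; simpl; tauto).
  assert (Hmus : mu < small) by (apply Hltm; simpl; tauto).
  assert (HmuM : mu < / 10000000 / M) by (apply Hltm; simpl; tauto).
  assert (Hmur : mu < rho / 4) by (apply Hltm; simpl; tauto).
  destruct (Hmu mu (conj Hmu0 Hmm)) as (d & r & e6 & e7 & Hd & Hr & C0 & C1 & C2 & C3 & C4 & C5 & C6 & He6 & He7).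
  set (P := fun i j => sum6 d (fun k => cp k i j)). set (Q := fun i j => sum6 d (fun k => cq k i j)).
  assert (HPQ : div_coeffs d P Q).
  { apply divergence_coefficients. intros u v. rewrite <- Hdiv.
    f_equal; apply Derive_ext; intros t; symmetry; [apply Ep | apply Eq]. }
  set (eps := mu ^ 15).
  assert (Heps : 0 < eps) by (apply pow_lt; lra).
  assert (Hepsmu : eps <= mu).
  { unfold eps. replace mu with (mu * 1) at 2 by ring. change (mu ^ 15) with (mu * mu ^ 14).
    apply Rmult_le_compat_l; [lra |]. rewrite <- (pow1 14). apply pow_incr. lra. }
  exists eps, d, r. rewrite (Rabs_right eps) by lra.
  split; [lra | split; [intros k Hk'; specialize (Hd k Hk'); lra | split; [lra |]]].
  apply (has_limit_cycles_weaken 6 _ _ (4 * mu)); [lra |].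
  set (par := fun th => Build_param d r mu th).
  assert (Hnear : forall th x, 1 <= x <= 4 -> near ds rs (par th) x).
  { intros th x Hx. unfold near, par; simpl. split; [| split; [lra | split; lra]].
    intros k Hk'. specialize (Hd k Hk'). lra. }
  assert (F1 : forall u v, Hv r u v + eps * cubic P u v = sysF1 p eps d r u v).
  { intros u v. unfold sysF1. rewrite H_v_explicit, Ep. reflexivity. }
  assert (F2 : forall u v, - Hu r u v + eps * cubic Q u v = sysF2 q eps d r u v).
  { intros u v. unfold sysF2. rewrite H_u_explicit, Eq. reflexivity. }
  assert (Hcs : forall x th, (x * cos th) ^ 2 + (- (x * sin th)) ^ 2 = x ^ 2).
  { intros x th. pose proof (sin2_cos2 th) as E. unfold Rsqr in E.
    replace ((x * cos th) ^ 2 + (- (x * sin th)) ^ 2)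
      with (x ^ 2 * (sin th * sin th + cos th * cos th)) by ring. rewrite E. ring. }
  assert (Hpol : forall f x th, polar f (mu * x) th = f (mu * pa (par th) x) (mu * pb (par th) x)).
  { intros f x th. unfold polar, pa, pb, par; simpl. f_equal; ring. }
  assert (HsM : small * M * 3 = Rabs kap / 100) by (unfold small; field; lra).
  apply (scaled_limit_cycles _ _
    (fun u v => H r u v + eps * (Psi P Q u v + Gsum d r u v))
    (fun u v => Hu r u v + eps * (- cubic Q u v + Gsum_u d r u v))
    (fun u v => Hv r u v + eps * (cubic P u v - prim0 d u v + Gsum_v d r u v))
    (fun x th => X1_tail P r mu (pa (par th) x) (pb (par th) x))
    (fun x th => X2_tail Q r mu (pa (par th) x) (pb (par th) x))
    (fun x th => W_tail d P Q r mu (pa (par th) x) (pb (par th) x))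
    (fun x th => mu * flux_tail kap d P Q r mu (pa (par th) x) (pb (par th) x)
       + e6 * h_scaled r mu (pa (par th) x) (pb (par th) x) ^ 6
       + e7 * h_scaled r mu (pa (par th) x) (pb (par th) x) ^ 7)
    mu (mu ^ 29) kap M).
  - apply (bipoly_ext _ _ F1), bipoly_add_scaled; [apply bipoly_Hv | apply bipoly_cubic].
  - apply (bipoly_ext _ _ F2). apply (bipoly_add_scaled (fun u v => - Hu r u v)).
    + apply (bipoly_opp (Hu r)), bipoly_Hu.
    + apply bipoly_cubic.
  - apply (bipoly_add_scaled (H r) (fun u v => Psi P Q u v + Gsum d r u v)); [apply bipoly_H |].
    apply (bipoly_plus (Psi P Q) (Gsum d r)); [apply bipoly_Psi |].
    exact (sum6_bipoly d (fun k u v => ev3 r u v (G3 k)) (fun k => ev3_bipoly r (G3 k))).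
  - apply (has_gradient_add_scaled _ _ _ (fun u v => Psi P Q u v + Gsum d r u v)).
    + apply H_gradient.
    + exact (has_gradient_plus _ _ _ _ _ _ (Psi_gradient d P Q HPQ) (Gsum_gradient d r)).
  - exact Hmu0.
  - apply pow_lt; lra.
  - exact Hkap.
  - lra.
  - apply (Rmult_lt_compat_r M) in HmuM; [| lra].
    replace (/ 10000000 / M * M) with (/ 10000000) in HmuM by (field; lra). lra.
  - intros x th Hx. rewrite Hpol, <- F1. unfold Hv, X1_tail, eps, pb, pa; simpl pth. ring.
  - intros x th Hx. rewrite Hpol, <- F2. unfold Hu, X2_tail, eps, pb, pa; simpl pth. field.
  - intros x th Hx. rewrite Hpol, H_scaling. unfold h_scaled, W_tail, eps.
    replace (pa (par th) x ^ 2 + pb (par th) x ^ 2) with (x ^ 2) by (symmetry; apply Hcs). field.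
  - intros x th Hx. unfold flux. rewrite !Hpol, <- F1, <- F2.
    replace (x ^ 2 / 2) with (/ 2 * (pa (par th) x ^ 2 + pb (par th) x ^ 2))
      by (unfold pa, pb; rewrite Hcs; unfold Rdiv; ring).
    exact (flux_scaling kap e6 e7 d P Q r mu (pa (par th) x) (pb (par th) x) C0 C1 C2 C3 C4 C5 C6).
  - apply (ring_bounded_of_unif_lip _ _ _ par M1 M U1); auto.
  - apply (ring_bounded_of_unif_lip _ _ _ par M2 M U2); auto.
  - apply (ring_bounded_of_unif_lip _ _ _ par M3 M U3); auto.
  - rewrite <- HsM. apply (ring_bounded_weaken (small * M + small * M + small * M)); [| lra].
    apply (ring_bounded_plus (small * M + small * M) (small * M)
      (fun x th => mu * flux_tail kap d P Q r mu (pa (par th) x) (pb (par th) x)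
         + e6 * h_scaled r mu (pa (par th) x) (pb (par th) x) ^ 6)).
    + apply (ring_bounded_plus (small * M) (small * M)
        (fun x th => mu * flux_tail kap d P Q r mu (pa (par th) x) (pb (par th) x))).
      * apply (ring_bounded_scal M mu small (fun x th => flux_tail kap d P Q r mu (pa (par th) x) (pb (par th) x))).
        -- apply (ring_bounded_of_unif_lip _ _ _ par M4 M U4); auto.
        -- rewrite Rabs_right; lra.
      * apply (ring_bounded_scal M e6 small (fun x th => h_scaled r mu (pa (par th) x) (pb (par th) x) ^ 6)); [| lra].
        apply (ring_bounded_of_unif_lip _ _ _ par M6 M U6); auto.
    + apply (ring_bounded_scal M e7 small (fun x th => h_scaled r mu (pa (par th) x) (pb (par th) x) ^ 7)); [| lra].
      apply (ring_bounded_of_unif_lip _ _ _ par M7 M U7); auto.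
Qed.
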